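(* Let $k$ be a natural number, let $\Theta=(P_1,P_2,P_3)$ be a short $\theta$-graph in a cubic 3-connected graph $G$, and let $H=G-\Theta^+$. If the number of $\Theta$-connecting 2-connected endblocks of $H$ is at least $21k^2+\frac{3}{2}k$, then $G$ is $k$-good.
   Context: All graphs are finite and simple. For a subgraph $H$ of $G$, $G-H$ is obtained by deleting the vertices of $H$. A subcubic graph has maximum degree at most 3. An $A-B$ path is a path with one end in $A$, one end in $B$, and no internal vertex in $A\cup B$. A block of a graph is a maximal connected subgraph without a cut-vertex; an endblock is a block corresponding to a vertex of degree at most 1 in the block-cutvertex tree of its component; a 2-connected endblock is an endblock that is 2-connected. A $\theta$-graph (or $u,v$-$\theta$-graph) $\Theta=(P_1,P_2,P_3)$ consists of two vertices $u,v$ and three pairwise internally disjoint $u-v$ paths $P_1,P_2,P_3$ (its legs). A short $\theta$-graph in $G$ is a $u,v$-$\theta$-graph with the minimum number of edges among all $u,v$-$\theta$-graphs in $G$, for some $u,v$. $F(\Theta)$ is the set of vertices of $G-\Theta$ having at least two neighbours in $\Theta$; $\Theta^+$ is the subgraph of $G$ induced by $V(\Theta)\cup F(\Theta)$. For a connected subgraph $B$ of $G-\Theta$, $B^+$ is the subgraph of $G$ induced by $V(B)$ together with the vertices of $F(\Theta)$ having a neighbour in $B$; $N_\Theta(B^+)$ is the set of vertices of $\Theta$ having a neighbour in $B^+$. A connected subgraph $B$ of $G-\Theta^+$ is $\Theta$-connecting if $N_\Theta(B^+)\not\subseteq V(P_i)$ for every $i\in\{1,2,3\}$. $k$-good: a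 $\theta(k,i)$-necklace is a connected subcubic graph consisting of $k$ disjoint $\theta$-graphs $\Theta_1,\dots,\Theta_k$ and $k$ disjoint paths $Q_1,\dots,Q_k$ such that $\Theta_j$ has legs $L_{j,1},L_{j,2},L_{j,3}$ with $L_{j,3}$ of length $i$, $Q_j$ is an $L_{j,2}-L_{j+1,1}$ path for $j<k$, $Q_k$ is an $L_{k,2}-L_{1,1}$ path, and no interior vertex of any $Q_j$ lies in any $\Theta_{j'}$. Two subgraphs are $k$-close if they are disjoint and joined by $k$ pairwise disjoint paths of length at most 2 (each having one end in each subgraph and no internal vertex in either). For pairwise disjoint 2-connected subgraphs $B_1,\dots,B_\ell$ of $G$, a necklace on them consists of the $B_i$ together with pairwise disjoint paths $Q_1,\dots,Q_\ell$, $Q_i$ a $B_i-B_{i+1}$ path ($Q_\ell$ a $B_\ell-B_1$ path), with no interior vertex of any $Q_i$ in any $B_j$; letting $x_i,y_i$ be the two vertices of $B_i$ lying on some $Q_j$, it is $k$-wiggly if for at least $k$ indices $i$, $B_i$ contains two $x_i-y_i$ paths whose lengths differ by 1 or 2. A graph is $k$-good if it contains a $\theta(k,i)$-necklace with $i\in\{1,2\}$, a $k$-wiggly necklace, or a path and a cycle which are $k$-close. *)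

(* Defs.v *)
From HB Require Import structures.
From mathcomp Require Import all_boot.

Set Implicit Arguments.
Unset Strict Implicit.
Unset Printing Implicit Defensive.

(* A finite simple graph on a universe [T]: a vertex set, and a set of edges
   which are two-element subsets of it. All graphs at hand (G, its subgraphs,
   their unions) live on the same universe; they form a finite type, which is
   what makes it possible to count endblocks. *)
Definition wf_graph (T : finType) (g : {set T} * {set {set T}}) : bool :=
  [forall A in g.2, (#|A| == 2) && (A \subset g.1)].

Record graph (T : finType) := Graph {
  gval : {set T} * {set {set T}};
  _ : wf_graph gval }.

HB.instance Definition _ (T : finType) := [isSub for @gval T].
HB.instance Definition _ (T : finType) := [Finite of graph T by <:].

Section Graphs.
Variable T : finType.
Implicit Types (G H A B C N : graph T) (X Y : {set T}) (x y u v : T)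
  (s p q c : seq T).

Definition vset G : {set T} := (gval G).1.
Definition eset G : {set {set T}} := (gval G).2.
Definition adj G : rel T := fun x y => [set x; y] \in eset G.

Lemma wf_mkgraph X (E : {set {set T}}) :
  wf_graph (X, [set A in E | (#|A| == 2) && (A \subset X)]).
Proof. by apply/'forall_implyP => A /=; rewrite inE => /andP[]. Qed.

(* Members of [E] that are not two-element subsets of [X] are discarded. *)
Definition mkgraph X (E : {set {set T}}) : graph T := Graph (wf_mkgraph X E).

Definition subgraph A B : bool :=
  (vset A \subset vset B) && (eset A \subset eset B).

Definition induced G X : graph T := mkgraph (vset G :&: X) (eset G).
Definition delete G X : graph T := induced G (~: X).
Definition gminus G H : graph T := delete G (vset H).

Definition gunion A B : graph T :=
  mkgraph (vset A :|: vset B) (eset A :|: eset B).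
Definition gbigunion (I : finType) (F : I -> graph T) : graph T :=
  mkgraph (\bigcup_i vset (F i)) (\bigcup_i eset (F i)).

Definition nbrs G x : {set T} := [set y | adj G x y].
Definition deg G x : nat := #|nbrs G x|.
Definition cubic G : bool := [forall x in vset G, deg G x == 3].
Definition subcubic G : bool := [forall x in vset G, deg G x <= 3].

(* The empty graph is not connected. *)
Definition connected G : bool :=
  (vset G != set0) &&
  [forall x in vset G, forall y in vset G, connect (adj G) x y].

Definition kconnected (k : nat) G : bool :=
  (k < #|vset G|) &&
  [forall X : {set T}, (#|X| < k) ==> connected (delete G X)].

Definition cutvertex G v : bool :=
  (v \in vset G) &&
  [exists x in vset G :\ v, exists y in vset G :\ v,
     connect (adj G) x y && ~~ connect (adj (delete G [set v])) x y].

Definition component H C : bool :=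
  [&& subgraph C H, connected C &
   [forall C', [&& subgraph C' H, connected C' & subgraph C C']
               ==> (C' == C)]].

Definition nonsep H B : bool :=
  [&& subgraph B H, connected B & ~~ [exists v, cutvertex B v]].

Definition block H B : bool :=
  nonsep H B && [forall B', nonsep H B' && subgraph B B' ==> (B' == B)].

(* Paths are given by their nonempty sequence of distinct vertices. *)
Definition gpath G x y s : bool :=
  [&& ohead s == Some x, last x s == y, uniq s,
      [set z in s] \subset vset G & sorted (adj G) s].

Definition plen s : nat := (size s).-1.
Definition interior s : seq T := behead (take (size s).-1 s).

Definition path_graph s : graph T :=
  mkgraph [set x in s] [set [set e.1; e.2] | e in zip s (behead s)].

Definition is_path G s : bool := [exists x, exists y, gpath G x y s].

(* Cycles are given by the cyclic sequence of their vertices. *)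
Definition is_cycle G c : bool :=
  [&& 3 <= size c, uniq c, [set x in c] \subset vset G & cycle (adj G) c].

Definition cycle_graph c : graph T :=
  mkgraph [set x in c] [set [set x; next c x] | x in c].

Definition AB_path G X Y s : bool :=
  [exists x in X, exists y in Y, gpath G x y s] &&
  [forall z in interior s, z \notin X :|: Y].

Definition vdisjoint A B : bool := [disjoint vset A & vset B].

Definition pairwise_disjoint (I : finType) (F : I -> graph T) : Prop :=
  forall i j : I, i != j -> vdisjoint (F i) (F j).

Record theta := Theta {
  th_u : T; th_v : T; leg1 : seq T; leg2 : seq T; leg3 : seq T }.
Implicit Type Th : theta.

Definition legs Th : seq (seq T) := [:: leg1 Th; leg2 Th; leg3 Th].

(* [p != q] is not redundant: a path without interior vertices is internally
   disjoint from itself, and the edge uv may serve as one leg only. *)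
Definition theta_in G Th : bool :=
  [&& th_u Th != th_v Th,
      all (gpath G (th_u Th) (th_v Th)) (legs Th) &
      pairwise (fun p q => (p != q) && [disjoint interior p & interior q])
        (legs Th)].

Definition theta_graph Th : graph T :=
  gunion (path_graph (leg1 Th))
    (gunion (path_graph (leg2 Th)) (path_graph (leg3 Th))).

Definition short_theta G Th : Prop :=
  theta_in G Th /\
  forall Th', theta_in G Th' -> th_u Th' = th_u Th -> th_v Th' = th_v Th ->
    #|eset (theta_graph Th)| <= #|eset (theta_graph Th')|.

Definition Fset G Th : {set T} :=
  [set x in vset (gminus G (theta_graph Th))
     | 2 <= #|nbrs G x :&: vset (theta_graph Th)|].

Definition theta_plus G Th : graph T :=
  induced G (vset (theta_graph Th) :|: Fset G Th).

Definition sub_plus G Th B : graph T :=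
  induced G (vset B :|:
             [set x in Fset G Th | [exists y in vset B, adj G x y]]).

Definition Ntheta G Th A : {set T} :=
  [set x in vset (theta_graph Th) | [exists y in vset A, adj G x y]].

Definition theta_connecting G Th B : bool :=
  [&& subgraph B (gminus G (theta_plus G Th)), connected B &
      all (fun P => ~~ (Ntheta G Th (sub_plus G Th B) \subset P)) (legs Th)].

Definition close (k : nat) G A B : Prop :=
  vdisjoint A B /\
  exists Q : 'I_k -> seq T,
    [/\ forall i, AB_path G (vset A) (vset B) (Q i),
        forall i, plen (Q i) <= 2 &
        pairwise_disjoint (fun i => path_graph (Q i))].

(* [ordS] is the cyclic successor. *)
Definition theta_necklace (k i : nat) N : Prop :=
  [/\ connected N, subcubic N &
  exists (Th : 'I_k -> theta) (Q : 'I_k -> seq T),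
    [/\ N = gunion (gbigunion (fun j => theta_graph (Th j)))
                   (gbigunion (fun j => path_graph (Q j))),
        (forall j, theta_in N (Th j)) /\
        (forall j, plen (leg3 (Th j)) = i),
        pairwise_disjoint (fun j => theta_graph (Th j)) /\
        pairwise_disjoint (fun j => path_graph (Q j)),
        forall j, AB_path N [set x in leg2 (Th j)]
                            [set x in leg1 (Th (ordS j))] (Q j) &
        forall j j', [disjoint interior (Q j) & vset (theta_graph (Th j'))]]].

Definition necklace_on (l : nat) (B : 'I_l -> graph T) (Q : 'I_l -> seq T) N
    : Prop :=
  [/\ N = gunion (gbigunion B) (gbigunion (fun i => path_graph (Q i))),
      (forall i, kconnected 2 (B i)) /\ pairwise_disjoint B,
      pairwise_disjoint (fun i => path_graph (Q i)),
      forall i, AB_path N (vset (B i)) (vset (B (ordS i))) (Q i) &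
      forall i j, [disjoint interior (Q i) & vset (B j)]].

Definition wiggly_bead (l : nat) (B : 'I_l -> graph T) (Q : 'I_l -> seq T)
    (i : 'I_l) : Prop :=
  exists x y : T,
    [/\ x != y,
        [set z in vset (B i) | [exists j, z \in Q j]] = [set x; y] &
        exists p q : seq T,
          [/\ gpath (B i) x y p, gpath (B i) x y q &
              plen q = plen p + 1 \/ plen q = plen p + 2]].

Definition wiggly_necklace (k : nat) N : Prop :=
  exists (l : nat) (B : 'I_l -> graph T) (Q : 'I_l -> seq T),
    [/\ 0 < l, necklace_on B Q N &
        exists2 I : {set 'I_l}, k <= #|I| &
          forall i, i \in I -> wiggly_bead B Q i].

Definition good (k : nat) G : Prop :=
  [\/ exists i N, [/\ i = 1 \/ i = 2, subgraph N G & theta_necklace k i N],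
      exists2 N, subgraph N G & wiggly_necklace k N |
      exists s c, [/\ is_path G s, is_cycle G c &
                      close k G (path_graph s) (cycle_graph c)]].

End Graphs.

(* The graph whose nodes are the cut-vertices and the blocks of [C], a
   cut-vertex being adjacent to the blocks that contain it. It is a tree when
   [C] is connected. *)
Definition bc_tree (T : finType) (C : graph T) : graph (T + graph T)%type :=
  mkgraph
    [set n | match n with inl v => cutvertex C v | inr B => block C B end]
    [set [set inl v.1; inr v.2]
       | v in [set v : T * graph T | v.1 \in vset v.2]].

Definition endblock (T : finType) (H B : graph T) : bool :=
  block H B &&
  [exists C : graph T,
     [&& component H C, subgraph B C & deg (bc_tree C) (inr B) <= 1]].

(* Main.v *)
Require Import Defs.
From Stdlib Require Import Classical.
From mathcomp Require Import all_boot all_order all_algebra zify.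

Set Implicit Arguments.
Unset Strict Implicit.
Unset Printing Implicit Defensive.
Import Order.TTheory GRing.Theory Num.Theory.

(** For k = 0 the graph G itself, as a single bead, is a necklace. For k > 0 the proof always
    produces a k-wiggly necklace, whose beads are cycles; a bead comes with two marked vertices that
    cut its cycle into arcs whose lengths differ by 1 or 2, and with disjoint tails starting there.

    Local part. Let O be the vertex set of B^+ for a counted endblock B. By [block_connector], B
    yields a connector: two legs, an interval of positions on each, of total length at most 4, and,
    for every choice of an end of either interval, a bead inside O and the two intervals whose tails
    lead to the chosen ends. If a vertex of F(Theta) at B sees one leg only, shortness of Theta puts
    its two neighbours there at distance at most 2, and a bead results ([fringe_connector]).
    Otherwise choose a cycle C of B such that as many vertices as possible of O off C reach the legs
    without C ([good_cycle]). Maximality makes all vertices of O off C do so and excludes chords. By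
    Menger's theorem two vertices of C have disjoint exits to different legs or a common dominator.
    For two nearly opposite vertices of C the first outcome is a bead. If only the second occurs,
    half-turns around C spread the domination over all of C, unless |C| is 2 modulo 4; a single
    dominator for C contradicts 3-connectivity or the Theta-connecting property ([no_common_dom]).
    So |C| is 2 modulo 4, and the odd and the even vertices of C have dominators w and w'
    ([alternating_exists]). The vertex c by which the endblock hangs on the rest of H has to be
    exempted throughout.

    Now either an ear joins two odd vertices behind w, or w is a leg adjacent to every odd vertex
    ([ear_or_direct]). In the first case an ear is chosen all of whose vertices have access to w;
    each of them and each even vertex other than c then have disjoint exits to different legs
    ([ear_linked]), and a parity count in the union of C and the ear finds a bead ([config_bead]).
    In the second case |C|/2 is odd, so the neighbours on that leg of consecutive odd vertices
    cannot always be exactly 2 apart; by shortness some are at distance 1, 3 or 4, and the leg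
    segment between them closes up to a bead ([direct_cycle_connector]).

    Global part. There are three pairs of legs, so more than 7k^2 connectors share a pair. A leg
    vertex has at most one neighbour off Theta, so an interval end determines its block, and the
    intervals of one connector contain interval ends of at most three others. A digraph of outdegree
    at most 3 has an independent set with a seventh of its vertices ([sparse_independent]), which
    leaves more than k^2 connectors with disjoint intervals. Erdős-Szekeres gives k + 1 of them in
    monotone position. An even number of these is run through in zigzag between the two legs, and
    the third leg closes the ring ([leg_necklace]). *)

Lemma path_rev_sym (V : eqType) (e : rel V) : symmetric e -> forall x p y,
  path e y (rcons (rev p) x) = path e x (rcons p y).
Proof.
move=> es x p y; have := rev_path e x (rcons p y).
by rewrite last_rcons belast_rcons rev_cons => ->; apply: eq_path => v w; rewrite es.
Qed.

Lemma split_first (V : eqType) (P : pred V) a p :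
  has P (a :: p) ->
  exists q r, [/\ p = q ++ r, P (last a q) & all (predC P) (belast a q)].
Proof.
elim: p a => [|b p IH] a; first by rewrite /= orbF => Pa; exists [::], [::].
rewrite [has _ _]/=; case Pa: (P a); first by exists [::], (b :: p).
by move=> /IH[q [r [-> Pq allq]]]; exists (b :: q), r; rewrite /= Pa.
Qed.

Lemma split_last (V : eqType) (P : pred V) a p :
  has P (a :: p) ->
  exists q r, [/\ p = q ++ r, P (last a q) & all (predC P) r].
Proof.
elim: p a => [|b p IH] a; first by rewrite /= orbF => Pa; exists [::], [::].
case hP: (has P (b :: p)); last first.
  rewrite [has _ _]/= -[_ || has _ _]/(has P (b :: p)) hP orbF => Pa.
  by exists [::], (b :: p); split; rewrite // all_predC hP.
by move=> _; have [q [r [-> Pq allr]]] := IH b hP; exists (b :: q), r.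
Qed.

(** * Menger's theorem for two disjoint paths in a digraph *)

Section Menger.
Variable V : finType.
Implicit Types (g : rel V) (A B : {set V}).

Definition separates g A B w :=
  forall a p, a \in A -> path g a p -> last a p \in B -> w \in a :: p.

Definition two_linked g A B :=
  exists a1 p1 a2 p2,
    [/\ a1 \in A, a2 \in A, path g a1 p1, path g a2 p2 &
        [/\ last a1 p1 \in B, last a2 p2 \in B &
            [disjoint a1 :: p1 & a2 :: p2]]].

Definition edge_count g := #|[set d : V * V | g d.1 d.2]|.

Definition del_edge g x y : rel V := fun a b => g a b && ((a, b) != (x, y)).

Lemma del_edge_sub g x y : subrel (del_edge g x y) g.
Proof. by move=> a b /andP[]. Qed.

Lemma edge_count_del g x y : g x y -> edge_count (del_edge g x y) < edge_count g.
Proof.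
move=> gxy; apply: proper_card; apply/properP; split.
  by apply/subsetP => d; rewrite !inE => /andP[].
by exists (x, y); rewrite !inE //= /del_edge eqxx andbF.
Qed.

Lemma path_del_tail g x y a p :
  path g a p -> x \notin belast a p -> path (del_edge g x y) a p.
Proof.
elim: p a => //= b p IH a /andP[gab pb]; rewrite inE negb_or => /andP[xa xp].
rewrite IH // andbT /del_edge gab /=; apply: contra xa => /eqP[-> _] //.
Qed.

Lemma path_del_head g x y a p :
  path g a p -> y \notin p -> path (del_edge g x y) a p.
Proof.
elim: p a => //= b p IH a /andP[gab pb]; rewrite inE negb_or => /andP[xa xp].
rewrite IH // andbT /del_edge gab /=; apply: contra xa => /eqP[_ ->] //.
Qed.

Lemma path_del_split g x y a p :
  path g a p -> path (del_edge g x y) a p \/ x \in belast a p /\ y \in p.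
Proof.
elim: p a => [|b p IH] a; first by left.
move=> /= /andP[gab /IH[pb|[xp yp]]]; last by right; rewrite !inE xp yp !orbT.
case E: ((a, b) == (x, y)); last by left; rewrite /del_edge gab E.
by right; move/eqP: E => [-> ->]; rewrite !inE !eqxx.
Qed.

(** A path from [A] to [B] avoids the edge [xy], and then meets [w'], or it meets [x]. Cut at its
    first vertex in [{w', x}], it cannot have used [xy] yet. *)
Lemma separates_sources g x y A B w' s :
  g x y -> separates (del_edge g x y) A B w' ->
  separates (del_edge g x y) A [set w'; x] s -> separates g A B s.
Proof.
move=> gxy sep_w' sep_s a p aA pth pB.
have hasP : has (mem [set w'; x]) (a :: p).
  case: (path_del_split x y pth) => [pth'|[xp _]]; apply/hasP.
    by exists w'; [exact: sep_w' | rewrite !inE eqxx].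
  by exists x; [exact: mem_belast | rewrite !inE eqxx orbT].
have [q [r [defp Pq allq]]] := split_first hasP.
suff sq : s \in a :: q by rewrite defp -cat_cons mem_cat sq.
apply: (sep_s a q) => //; move: pth; rewrite defp cat_path => /andP[pq _].
apply: path_del_tail => //; apply/negP => xq.
by have := allP allq _ xq; rewrite !inE eqxx orbT.
Qed.

(** Mirror image: the part after the last vertex in [{w', y}] no longer enters [y]. *)
Lemma separates_targets g x y A B w' s :
  g x y -> separates (del_edge g x y) A B w' ->
  separates (del_edge g x y) [set w'; y] B s -> separates g A B s.
Proof.
move=> gxy sep_w' sep_s a p aA pth pB.
have hasP : has (mem [set w'; y]) (a :: p).
  case: (path_del_split x y pth) => [pth'|[_ yp]]; apply/hasP.
    by exists w'; [exact: sep_w' | rewrite !inE eqxx].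
  by exists y; rewrite inE ?yp ?orbT // !inE eqxx orbT.
have [q [r [defp Pq allr]]] := split_last hasP.
suff sr : s \in last a q :: r.
  rewrite defp -cat_cons mem_cat; move: sr; rewrite inE => /orP[/eqP->|->].
    by rewrite mem_last.
  by rewrite orbT.
move: pth pB; rewrite defp cat_path last_cat => /andP[_ pr] lB.
apply: sep_s => //; apply: path_del_head => //; apply/negP => yr.
by have := allP allr _ yr; rewrite !inE eqxx orbT.
Qed.

Lemma split_mem (a t : V) p : t \in a :: p ->
  exists q r, p = q ++ r /\ last a q = t.
Proof.
rewrite inE => /orP[/eqP->|/splitPr[q r]]; first by exists [::], p.
by exists (rcons q t), r; rewrite cat_rcons last_rcons.
Qed.

(** Changing from one path to the other at [t] gives a path from [A] to [B], which must meet [w'];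
    as [w'] can only be the end of the first path or the start of the second, [t] is that vertex. *)
Lemma pieces_meet g A B w' a p z q t :
  separates g A B w' -> a \in A -> path g a p -> path g z q -> last z q \in B ->
  (w' \in a :: p -> last a p = w' /\ uniq (a :: p)) ->
  (w' \in z :: q -> z = w' /\ uniq (z :: q)) ->
  t \in a :: p -> t \in z :: q -> t = w'.
Proof.
move=> sep aA pp pq qB endp startq /split_mem[p' [p'' [Ep Lp]]].
move=> /split_mem[q' [q'' [Eq Lq]]].
have : w' \in a :: p' ++ q''.
  apply: sep => //; last by move: qB; rewrite Eq !last_cat Lp Lq.
  move: pp pq; rewrite Ep Eq !cat_path Lp Lq => /andP[-> _] /andP[_ ->] //.
rewrite -cat_cons mem_cat => /orP[w'p|w'q].
  have [|Lw' Up] := endp; first by rewrite Ep -cat_cons mem_cat w'p.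
  rewrite -Lp; case/lastP: p'' => [|p'' u] in Ep *; first by rewrite -Lw' Ep cats0.
  move: Up; rewrite Ep -cat_cons cat_uniq => /and3P[_ /hasPn/(_ w') H _].
  suff /H/negP[] : w' \in rcons p'' u by [].
  by rewrite -Lw' Ep last_cat last_rcons mem_rcons mem_head.
have [|Lw' Up] := startq; first by rewrite Eq -cat_cons mem_cat w'q orbT.
move: Up; rewrite Eq -cat_cons cat_uniq => /and3P[_ /hasPn/(_ w') H _].
by case/negP: (H w'q); rewrite /= Lw' mem_head.
Qed.

Lemma two_linked_to g C w' z : two_linked g C [set w'; z] ->
  exists a1 p1 a2 p2,
    [/\ a1 \in C, a2 \in C, path g a1 p1, path g a2 p2 &
        [/\ last a1 p1 = w', last a2 p2 = z, uniq (a1 :: p1) &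
            [disjoint a1 :: p1 & a2 :: p2]]].
Proof.
move=> [a1 [p1 [a2 [p2 [A1 A2 P1 P2 [L1 L2 D]]]]]].
have short b q b' q' : path g b q -> [disjoint b :: q & b' :: q'] ->
    exists q0, [/\ path g b q0, last b q0 = last b q, uniq (b :: q0) &
                   [disjoint b :: q0 & b' :: q']].
  move=> pq D'; have [q0 pq0 Uq0 sub] := shortenP pq; exists q0; split => //.
  apply/pred0P => t /=; apply/negP => /andP[tq0 tq'].
  have: t \in b :: q by move: tq0; rewrite !inE => /orP[->//|/sub->]; rewrite orbT.
  by move=> /(disjointFr D'); rewrite tq'.
move: L1 L2; rewrite !inE => /orP[/eqP L1|/eqP L1] /orP[/eqP L2|/eqP L2].
- by move: (disjointFr D (mem_last a1 p1)); rewrite L1 -L2 mem_last.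
- have [q [? ? ? ?]] := short _ _ _ _ P1 D.
  by exists a1, q, a2, p2; split => //; split => //; congruence.
- rewrite disjoint_sym in D; have [q [? ? ? ?]] := short _ _ _ _ P2 D.
  by exists a2, q, a1, p1; split => //; split => //; congruence.
- by move: (disjointFr D (mem_last a1 p1)); rewrite L1 -L2 mem_last.
Qed.

Lemma two_linked_from g C w' z : two_linked g [set w'; z] C ->
  exists p1 p2,
    [/\ last w' p1 \in C, last z p2 \in C, path g w' p1, path g z p2 &
        uniq (w' :: p1) /\ [disjoint w' :: p1 & z :: p2]].
Proof.
move=> [a1 [p1 [a2 [p2 [A1 A2 P1 P2 [L1 L2 D]]]]]].
have short b q b' q' : path g b q -> [disjoint b :: q & b' :: q'] ->
    exists q0, [/\ path g b q0, last b q0 = last b q, uniq (b :: q0) &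
                   [disjoint b :: q0 & b' :: q']].
  move=> pq D'; have [q0 pq0 Uq0 sub] := shortenP pq; exists q0; split => //.
  apply/pred0P => t /=; apply/negP => /andP[tq0 tq'].
  have: t \in b :: q by move: tq0; rewrite !inE => /orP[->//|/sub->]; rewrite orbT.
  by move=> /(disjointFr D'); rewrite tq'.
move: A1 A2; rewrite !inE => /orP[/eqP E1|/eqP E1] /orP[/eqP E2|/eqP E2];
  move: P1 P2 L1 L2 D; rewrite E1 E2 => P1 P2 L1 L2 D.
- by move: (disjointFr D (mem_head w' p1)); rewrite mem_head.
- have [q [? L ? ?]] := short _ _ _ _ P1 D.
  by exists q, p2; split => //; rewrite L.
- rewrite disjoint_sym in D; have [q [? L ? ?]] := short _ _ _ _ P2 D.
  by exists q, p1; split => //; rewrite L.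
- by move: (disjointFr D (mem_head z p1)); rewrite mem_head.
Qed.

(* Göring's induction: an edge [xy] is deleted; a vertex [w'] separating in the
   smaller graph is completed by [x] on one side and by [y] on the other. *)
Lemma menger2 g A B : V -> (exists w, separates g A B w) \/ two_linked g A B.
Proof.
move=> v0; have [n] := ubnP (edge_count g); elim: n g A B => // n IH g A B.
rewrite ltnS => len.
case: (pickP [pred d : V * V | g d.1 d.2]) => [[x y] /= gxy | nog]; last first.
  have nopath a p : path g a p -> p = [::].
    by case: p => //= b p; have /= -> := nog (a, b).
  case: (leqP #|A :&: B| 1) => [le1|]; last first.
    move=> /card_gt1P[a [b [/setIP[aA aB] /setIP[bA bB] ab]]]; right.
    exists a, [::], b, [::]; split => //; split => //.
    by rewrite disjoint_sym disjoint_has /= orbF inE eq_sym.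
  left; case: (pickP (mem (A :&: B))) => [w wAB | noAB]; last first.
    exists v0 => a p aA /nopath-> /= aB.
    by have := noAB a; rewrite !inE aA aB.
  exists w => a p aA /nopath-> /= aB; rewrite inE.
  by apply/eqP/(card_le1_eqP le1) => //; rewrite inE aA.
have {}IH : forall A B, (exists w, separates (del_edge g x y) A B w) \/
                   two_linked (del_edge g x y) A B.
  by move=> A' B'; apply: IH; apply: leq_trans (edge_count_del gxy) len.
have sub := @del_edge_sub g x y.
case: (IH A B) => [[w' sep_w']|[a1 [p1 [a2 [p2 [A1 A2 P1 P2 [L1 L2 D]]]]]]]; last first.
  by right; exists a1, p1, a2, p2; split=> //; apply: sub_path sub _ _ _.
case: (IH A [set w'; x]) => [[s /(separates_sources gxy sep_w')]|]; first by left; exists s.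
case: (IH [set w'; y] B) => [[s /(separates_targets gxy sep_w')]|]; first by left; exists s.
move=> /two_linked_from[q1 [q2 [M1 M2 Q1 Q2 [UQ DQ]]]].
move=> /two_linked_to[a1 [p1 [a2 [p2 [A1 A2 P1 P2 [L1 L2 UP DP]]]]]].
have w'p2 : w' \notin a2 :: p2 by rewrite (disjointFr DP) // -L1 mem_last.
have w'q2 : w' \notin y :: q2 by rewrite (disjointFr DQ) // mem_head.
(* One pair of pieces is glued at [w'], the other across the deleted edge [xy]. *)
right; exists a1, (p1 ++ q1), a2, (p2 ++ y :: q2); split => //.
- by rewrite cat_path (sub_path sub P1) L1 (sub_path sub Q1).
- by rewrite cat_path (sub_path sub P2) L2 /= gxy (sub_path sub Q2).
split; rewrite ?last_cat ?L1 //.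
have P1w : w' \in a1 :: p1 -> last a1 p1 = w' /\ uniq (a1 :: p1) by [].
have P2w : w' \in a2 :: p2 -> last a2 p2 = w' /\ uniq (a2 :: p2) by rewrite (negPf w'p2).
have Q1w : w' \in w' :: q1 -> w' = w' /\ uniq (w' :: q1) by [].
have Q2w : w' \in y :: q2 -> y = w' /\ uniq (y :: q2) by rewrite (negPf w'q2).
apply/pred0P => t /=; apply/negP => /andP[].
rewrite -!cat_cons !mem_cat => /orP[tp1|tq1] /orP[tp2|tq2].
- by rewrite (disjointFr DP) in tp2.
- have E := pieces_meet sep_w' A1 P1 Q2 M2 P1w Q2w tp1 tq2.
  by rewrite E (negPf w'q2) in tq2.
- have tq1' : t \in w' :: q1 by rewrite inE tq1 orbT.
  have E := pieces_meet sep_w' A2 P2 Q1 M1 P2w Q1w tp2 tq1'.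
  by rewrite E (negPf w'p2) in tp2.
- by rewrite (disjointFr DQ) // inE tq1 orbT in tq2.
Qed.
End Menger.

(** * Dominators with respect to an exit set *)

Section Dominators.
Variables (V : finType) (g : rel V) (B : {set V}).
Implicit Types (v w a b : V) (p q : seq V).

Definition live v := exists2 p, path g v p & last v p \in B.

(** Domination as for flow graphs, with [B] as the exit, phrased by deletion of [w] to be decidable;
    [domP] gives the form with paths. A vertex that is not [live] is dominated by everything, whence
    the liveness hypotheses below. *)
Definition dom w v :=
  (v == w) || ~~ [exists b in B, connect (fun x y => [&& g x y, x != w & y != w]) v b].

Lemma domP w v :
  reflect (forall p, path g v p -> last v p \in B -> w \in v :: p) (dom w v).
Proof.
apply: (iffP idP) => [/orP[/eqP-> p _ _|/exists_inP nob p pp lB]|H].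
- by rewrite mem_head.
- apply: contraT => wp; case: nob; exists (last v p) => //; apply/connectP.
  exists p => //; elim: p v pp wp {lB} => //= u p IH v /andP[gvu pp].
  rewrite inE negb_or => /andP[wv wp]; rewrite IH // andbT gvu eq_sym wv /=.
  by move: wp; rewrite inE negb_or eq_sym => /andP[].
- rewrite /dom; case: eqP => //= /eqP vw; apply/exists_inP => -[b bB /connectP[p pp E]].
  suff wp: w \notin v :: p.
    case/negP: wp; apply: H; rewrite -?E //.
    by apply: sub_path pp => x y /andP[].
  elim: p v vw pp {E H} => [|u p IH] v vw /=; first by rewrite inE eq_sym vw.
  by case/andP=> /and3P[_ _ uw] pp; rewrite inE negb_or eq_sym vw /= IH.
Qed.

Lemma dom_refl w : dom w w. Proof. by rewrite /dom eqxx. Qed.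

Lemma dom_trans w1 w2 a : dom w1 w2 -> dom w2 a -> dom w1 a.
Proof.
move=> /domP d12 /domP d2a; apply/domP => p pp pB.
have /split_mem[q [r [E L]]] := d2a _ pp pB.
move: pp pB; rewrite E cat_path last_cat L => /andP[_ pr] rB.
move: (d12 _ pr rB); rewrite inE -cat_cons mem_cat => /orP[/eqP->|->].
  by rewrite -L mem_last.
by rewrite orbT.
Qed.

Lemma dom_step w v v' : g v v' -> dom w v -> v != w -> dom w v'.
Proof.
move=> gvv' /domP dv vw; apply/domP => p pp pB.
by have := dv (v' :: p); rewrite /= gvv' pp inE eq_sym (negPf vw); apply.
Qed.

Lemma dom_path w v p : path g v p -> dom w v -> w \notin belast v p ->
  dom w (last v p).
Proof.
elim: p v => //= u p IH v /andP[gvu pp] dv; rewrite inE negb_or eq_sym => /andP[vw wp].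
by apply: IH => //; apply: dom_step dv vw.
Qed.

Lemma dom_target w b : b \in B -> dom w b -> w = b.
Proof. by move=> bB /domP/(_ [::] isT bB); rewrite inE => /eqP. Qed.

Lemma avoiding_path w v : ~~ dom w v ->
  exists2 q, path g v q & last v q \in B /\ w \notin v :: q.
Proof.
rewrite negb_or negbK => /andP[vw /exists_inP[b bB /connectP[q pq E]]].
exists q; first by apply: sub_path pq => x y /andP[].
rewrite -E; split=> //; elim: q v vw pq {E} => [|u q IH] v vw /=.
  by rewrite inE eq_sym.
by case/andP=> /and3P[_ _ uw] pq; rewrite inE negb_or eq_sym vw /= IH.
Qed.

(** On a path from [a] to [B] let [w1], say, come first. If [w2] did not dominate [w1], the path
    could continue from [w1] to [B] without [w2]. *)
Lemma dom_comparable a w1 w2 :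
  live a -> dom w1 a -> dom w2 a -> dom w1 w2 \/ dom w2 w1.
Proof.
move=> [p pp pB] d1 d2.
case d12 : (dom w1 w2); first by left.
case d21 : (dom w2 w1); first by right.
have [q2 pq2 [q2B nq2]] := avoiding_path (negbT d12).
have [q1 pq1 [q1B nq1]] := avoiding_path (negbT d21).
have neq : w1 != w2 by apply: contraFneq d12 => ->; exact: dom_refl.
have hasP : has (pred2 w1 w2) (a :: p).
  by apply/hasP; exists w1; rewrite /= ?eqxx //; move/domP: d1; apply.
have [q [r [E Lq allq]]] := split_first hasP.
move: pp; rewrite E cat_path => /andP[pq _].
have nbel w : w \in pred2 w1 w2 -> w \notin belast a q.
  by move=> Pw; apply/negP => /(allP allq) /=; rewrite -[_ || _]/(w \in pred2 w1 w2) Pw.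
have bad w' w q' : pred2 w1 w2 w -> dom w a -> last a q = w' -> w \notin w' :: q' ->
    path g w' q' -> last w' q' \in B -> False.
  move=> Pw /domP dw Lw' nw pq' q'B.
  have := dw (q ++ q'); rewrite cat_path pq Lw' pq' last_cat Lw' q'B => /(_ isT isT).
  rewrite -cat_cons mem_cat lastI mem_rcons inE (negPf (nbel _ Pw)) orbF Lw'.
  by rewrite -in_cons (negPf nw).
case/orP: Lq => /eqP Lq.
  by case: (bad w1 w2 q1); rewrite /= ?eqxx ?orbT.
by case: (bad w2 w1 q2); rewrite /= ?eqxx.
Qed.

Definition codominated a b := exists w, dom w a && dom w b.

Lemma codom_sym a b : codominated a b -> codominated b a.
Proof. by case=> w; rewrite andbC; exists w. Qed.

Lemma codom_trans b a c : live b -> codominated a b -> codominated b c -> codominated a c.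
Proof.
move=> lb [w1 /andP[d1a d1b]] [w2 /andP[d2b d2c]].
have [d|d] := dom_comparable lb d1b d2b.
  by exists w1; rewrite d1a (dom_trans d).
by exists w2; rewrite d2c (dom_trans d).
Qed.

(** Take a dominator of [a] that dominates as many vertices as possible. A vertex dominating both
    [a] and [b] is comparable with it, and if it lies beyond it, maximality makes both dominate the
    same vertices. *)
Lemma common_dominator (S : {pred V}) a :
  live a -> (forall b, b \in S -> codominated a b) ->
  exists w, dom w a /\ forall b, b \in S -> dom w b.
Proof.
move=> la H; pose beta w := #|[set v | dom w v]|.
have [w da wmax] := @arg_maxnP V a (dom^~ a) beta (dom_refl a).
exists w; split=> // b /H[w2 /andP[d2a d2b]].
have [d|d] := dom_comparable la da d2a; first exact: dom_trans d2b.
have sub : [set v | dom w v] \subset [set v | dom w2 v].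
  by apply/subsetP => v; rewrite !inE; exact: dom_trans.
have /setP/(_ b) : [set v | dom w v] = [set v | dom w2 v].
  by apply/eqP; rewrite eqEcard sub; exact: wmax.
by rewrite !inE d2b.
Qed.

(** Menger for [{a, b}] and [B]: a separating vertex dominates both. *)
Lemma codom_or_linked a b : a != b ->
  codominated a b \/ exists p q,
    [/\ path g a p, path g b q, last a p \in B, last b q \in B &
        [disjoint a :: p & b :: q]].
Proof.
move=> ab; have [[w sep]|] := menger2 g [set a; b] B a.
  left; exists w; apply/andP; split; apply/domP => p.
    by apply: sep; rewrite !inE eqxx.
  by apply: sep; rewrite !inE eqxx orbT.
move=> [a1 [p1 [a2 [p2 [A1 A2 P1 P2 [L1 L2 D]]]]]]; right; move: A1 A2; rewrite !inE.
move=> /orP[/eqP E1|/eqP E1] /orP[/eqP E2|/eqP E2]; subst a1 a2.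
- by move: (disjointFr D (mem_head a p1)); rewrite mem_head.
- by exists p1, p2.
- by exists p2, p1; rewrite disjoint_sym.
- by move: (disjointFr D (mem_head b p1)); rewrite mem_head.
Qed.

End Dominators.

(** * Vertex boundaries, and reachability inside a set *)

Definition boundary (T : finType) (e : rel T) (S : {set T}) : {set T} :=
  [set y | (y \notin S) && [exists x in S, e x y]].

Lemma boundaryP (T : finType) (e : rel T) (S : {set T}) y :
  reflect (y \notin S /\ exists2 x, x \in S & e x y) (y \in boundary e S).
Proof.
by rewrite in_set; apply: (iffP andP) => -[yS /exists_inP H].
Qed.

Definition within (T : finType) (e : rel T) (D : {set T}) : rel T :=
  fun x y => [&& x \in D, y \in D & e x y].

Section Reach.
Variables (T : finType) (e : rel T) (P : pred T).
Implicit Types (D : {set T}) (x y : T).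

Lemma within_sym D : symmetric e -> symmetric (within e D).
Proof. by move=> se x y; rewrite /within se andbCA. Qed.

Lemma within_path D x p : path (within e D) x p -> path e x p && all (mem D) p.
Proof.
elim: p x => //= y p IH x /andP[/and3P[_ yD exy] /IH/andP[pp ap]].
by rewrite exy pp yD.
Qed.

Definition reach D : {set T} :=
  [set x in D | [exists y in D, P y && connect (within e D) x y]].

Lemma in_reach D x : (x \in reach D) =
  (x \in D) && [exists y in D, P y && connect (within e D) x y].
Proof. by rewrite in_set. Qed.

Lemma reach_in D x : x \in reach D -> x \in D.
Proof. by rewrite in_reach => /andP[]. Qed.

Lemma reach_step D x y : x \in D -> y \in reach D -> e x y -> x \in reach D.
Proof.
move=> xo ye exy; have yo := reach_in ye.
move: ye; rewrite !in_reach xo yo /= => /exists_inP[w wo /andP[ew cyw]].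
apply/exists_inP; exists w; rewrite // ew /=; apply: connect_trans cyw.
by apply: connect1; rewrite /within xo yo.
Qed.

Lemma reach_base D x : x \in D -> P x -> x \in reach D.
Proof.
by move=> xo xe; rewrite in_reach xo; apply/exists_inP; exists x; rewrite // xe /=.
Qed.

Lemma reach_ind D (Q : T -> Prop) :
  (forall x, x \in D -> P x -> Q x) ->
  (forall x y, x \in D -> y \in reach D -> Q y -> e x y -> Q x) ->
  forall x, x \in reach D -> Q x.
Proof.
move=> H0 H1 x; rewrite in_reach => /andP[xo /exists_inP[y yo /andP[ye /connectP[p]]]].
elim: p x xo => [|z p IH] x xo /= pp E; first by apply: H0; rewrite // -E.
move: pp => /andP[/and3P[_ zo exz] pp]; apply: H1 (exz) => //; last exact: IH.
rewrite in_reach zo; apply/exists_inP; exists y; rewrite // ye /=.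
by apply/connectP; exists p.
Qed.

(** The paths in question stay inside [reach D], so [D'] may lose any other vertex of [D]. Both
    growth arguments, for cycles and for ears, rest on this. *)
Lemma reach_sub D D' : reach D \subset D' -> reach D \subset reach D'.
Proof.
move=> sub; apply/subsetP => x xe.
suff /implyP/(_ xe) : (x \in reach D) ==> (x \in reach D') by [].
apply: (@reach_ind D (fun x => (x \in reach D) ==> (x \in reach D')) _ _ x xe).
- move=> y yo ye; apply/implyP => yex; apply: reach_base => //.
  exact: (subsetP sub).
- move=> y z yo ze /implyP/(_ ze) ze' eyz; apply/implyP => yex.
  by apply: reach_step ze' eyz; exact: (subsetP sub).
Qed.

Lemma reach_path D x : x \in reach D -> exists p,
  [/\ path e x p, all (mem D) (x :: p), uniq (x :: p), all (mem (reach D)) p & P (last x p)].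
Proof.
rewrite in_reach => /andP[xD /exists_inP[y yD /andP[Py /connectP[p pp E]]]].
move: E; have [q pq uq _] := shortenP pp => E; exists q.
have /andP[pe pD] := within_path pq.
rewrite -E; split; rewrite //= ?xD //; apply/allP => v vq.
case/splitPr: vq pq E {uq pe pD} => q1 q2 pq E; move: pq; rewrite -cat_rcons cat_path last_rcons => /andP[pq1 pq2].
have vD : v \in D.
  by have /andP[_ /allP H] := within_path pq1; apply: H; rewrite mem_rcons mem_head.
rewrite /= in_reach vD; apply/exists_inP; exists y; rewrite // Py /=.
by apply/connectP; exists q2; rewrite // E last_cat.
Qed.

End Reach.

(* [X] is the vertex set of a block, [F] the set of vertices outside the theta
   graph [Th] which [X^+] adds to it, [ex x i] says that [x] has a neighbour on
   leg [i], and [c] is the only vertex of [X] which may have a neighbour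
   elsewhere (or any vertex off [X] when there is none). *)
Record local_hyp (T : finType) (e : rel T) (X F Th : {set T})
    (ex : T -> 'I_3 -> bool) (c : T) : Prop := LocalHyp {
  lh_sym : symmetric e;
  lh_irr : irreflexive e;
  lh_deg : forall x, x \in X :|: F -> #|[set y | e x y]| = 3;
  lh_XF : [disjoint X & F];
  lh_OT : [disjoint X :|: F & Th];
  lh_nbX : forall x y, x \in X -> x != c -> e x y -> y \in X :|: F :|: Th;
  lh_nbc : c \in X -> exists2 y, e c y & y \notin X :|: F :|: Th;
  lh_nbF : forall f y, f \in F -> e f y -> y \in X :|: Th;
  lh_FX : forall f, f \in F -> exists2 x, x \in X & e f x;
  lh_F1 : forall f x y, f \in F -> x \in X -> y \in X -> e f x -> e f y -> x = y;
  lh_exF : forall f, f \in F -> exists i j, [/\ i != j, ex f i & ex f j];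
  lh_exT : forall x y, x \in X :|: F -> y \in Th -> e x y -> exists i, ex x i;
  lh_Tex : forall x i, x \in X :|: F -> ex x i -> exists2 y, y \in Th & e x y;
  lh_conn : forall i, exists2 x, x \in X :|: F & exists2 j, j != i & ex x j;
  lh_X2 : forall S : {set T}, S \subset X -> S != set0 -> 1 < #|X :\: S| ->
    1 < #|boundary e S :&: X|;
  lh_G3 : forall S : {set T}, S \subset X :|: F -> S != set0 -> 2 < #|boundary e S|;
  lh_X3 : 2 < #|X| }.

(** * A cycle of the block with a largest exiting part *)

Section GoodCycle.
Variables (T : finType) (e : rel T) (X F Th : {set T})
  (ex : T -> 'I_3 -> bool) (c : T).
Hypothesis lh : local_hyp e X F Th ex c.
Let O := X :|: F.
Implicit Types (cs d : seq T) (x y z m n : T).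

Lemma X_O x : x \in X -> x \in O. Proof. by rewrite inE => ->. Qed.
Lemma F_O x : x \in F -> x \in O. Proof. by rewrite inE orbC => ->. Qed.

Lemma nbr_bound x s : x \in O -> uniq s -> all (e x) s -> size s <= 3.
Proof.
move=> xO us als; rewrite -(lh_deg lh xO) -(card_uniqP us); apply: subset_leq_card.
by apply/subsetP => y /(allP als); rewrite inE.
Qed.

Definition exits x := [exists i, ex x i].

Lemma exitsP x : x \in O -> exits x -> exists2 y, y \in Th & e x y.
Proof. by move=> xO /existsP[i]; exact: (lh_Tex lh). Qed.

Lemma exits_Th x y : x \in O -> y \in Th -> e x y -> exits x.
Proof. by move=> xO yT exy; have [i xi] := lh_exT lh xO yT exy; apply/existsP; exists i. Qed.

Lemma F_exits f : f \in F -> exits f.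
Proof. by case/(lh_exF lh) => i [j [_ fi _]]; apply/existsP; exists i. Qed.

Definition is_cyc cs := [&& 2 < size cs, uniq cs, cycle e cs & all (mem X) cs].

Definition off cs : {set T} := O :\: [set z in cs].
Definition off_adj cs : rel T := within e (off cs).
Definition exiting cs : {set T} := reach e exits (off cs).
(** Such a cycle vertex joins the exiting part once it is taken off the cycle. *)
Definition attached cs z := exits z || [exists y in exiting cs, e z y].

Lemma in_off cs x : (x \in off cs) = (x \in O) && (x \notin cs).
Proof. by rewrite !inE andbC. Qed.

Lemma exiting_off cs x : x \in exiting cs -> x \in off cs.
Proof. exact: reach_in. Qed.

Lemma eq_exiting cs cs' : cs =i cs' -> exiting cs = exiting cs'.
Proof.
move=> E; have Eo : off cs = off cs' by apply/setP => x; rewrite !in_off E.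
by apply/eqP; rewrite eqEsubset !reach_sub // 1?Eo; 
   apply/subsetP => x /exiting_off; rewrite ?Eo // -Eo.
Qed.

Lemma is_cyc_rot k cs : is_cyc (rot k cs) = is_cyc cs.
Proof. by rewrite /is_cyc size_rot rot_uniq rot_cycle (eq_all_r (mem_rot k cs)). Qed.

(** Two of the three edges at [z] belong to the cycle. *)
Lemma cyc_off1 cs z y y' : is_cyc cs -> z \in cs ->
  e z y -> e z y' -> y \notin cs -> y' \notin cs -> y = y'.
Proof.
move=> cyc zcs; have [k s E] := rot_to zcs; move: cyc; rewrite -(is_cyc_rot k) E.
move=> /and4P[sz us cyc /= /andP[zX _]] ezy ezy' ny ny'.
have mem u : (u \in cs) = (u \in z :: s) by rewrite -E mem_rot.
case: s => [|a s] // in E sz us cyc mem *; case/lastP: s => // s b in E sz us cyc mem *.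
move: cyc; rewrite /= rcons_path last_rcons => /and3P[eza _ ebz].
apply/eqP; apply: contraT => nyy; rewrite mem in ny; rewrite mem in ny'.
have := @nbr_bound z [:: a; b; y; y'] (X_O zX); apply.
  move: us ny ny'; rewrite /= !inE !mem_rcons !inE !negb_or => /and3P[_ /andP[ab _] _].
  by do 2![case/and4P=> _ ? ? _]; rewrite ab nyy; do !(apply/andP; split); rewrite // eq_sym.
by rewrite /= eza ezy ezy' (lh_sym lh) ebz.
Qed.

Lemma cyc_shape cs z : is_cyc cs -> z \in cs ->
  exists k a s b, rot k cs = z :: a :: rcons s b.
Proof.
move=> cyc zcs; have [k s E] := rot_to zcs; exists k.
move: cyc; rewrite -(is_cyc_rot k) E => /and3P[sz _ _].
case: s sz {E} => [|a s] //; case/lastP: s => // s b _; by exists a, s, b.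
Qed.

Lemma cyc_split n1 A1 n2 A2 : cycle e (n1 :: A1 ++ n2 :: A2) =
  path e n1 (rcons A1 n2) && path e n2 (rcons A2 n1).
Proof. by rewrite [cycle _ _]/= rcons_cat cat_path /= [path e n1 (rcons A1 n2)]rcons_path andbA. Qed.

(** The new arc [d] avoids the exiting part, which therefore survives, and the attached vertex [m]
    on the old arc is added to it. The last condition keeps at least three vertices on the cycle. *)
Lemma reroute n1 A1 n2 A2 d m :
  let cs := n1 :: A1 ++ n2 :: A2 in let cs' := n1 :: d ++ n2 :: A2 in
  is_cyc cs -> m \in A1 -> attached cs m -> path e n1 (rcons d n2) -> uniq d ->
  (forall x, x \in d -> [/\ x \in X, x \notin cs & x \notin exiting cs]) ->
  0 < size d + size A2 -> is_cyc cs' /\ #|exiting cs| < #|exiting cs'|.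
Proof.
move=> cs cs' /and4P[_ ucs cyc Xcs] mA am pd ud dP sz.
have mcs : m \in cs by rewrite inE mem_cat mA orbT.
have dcs x : x \in d -> x \notin cs by case/dP.
have ncs' : m \notin cs'.
  move: ucs; rewrite /cs -cat_cons cat_uniq cons_uniq => /and3P[/andP[n1A _] hA _].
  rewrite inE mem_cat 2!negb_or; apply/and3P; split.
  - by apply: contraNneq n1A => <-.
  - by apply/negP => /dcs; rewrite mcs.
  - apply: contra hA => mA2; apply/hasP; exists m => //=.
    by rewrite inE mA orbT.
have sub x : x \in cs' -> x \in cs \/ x \in d.
  rewrite /cs' inE mem_cat => /or3P[/eqP->|->|xA]; first by left; rewrite mem_head.
    by right.
  by left; rewrite inE mem_cat xA !orbT.
have cyc' : is_cyc cs'.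
  apply/and4P; split.
  - by rewrite /= size_cat /= addnS !ltnS.
  - move: ucs; rewrite /cs /cs' !cons_uniq !cat_uniq !mem_cat !(negb_or (n1 \in _)).
    case/andP=> /andP[_ ->] /and3P[_ _ ->]; rewrite ud !andbT; apply/andP; split.
      by apply/negP => /dcs; rewrite mem_head.
    apply/hasPn => x xA; apply/negP => /dcs.
    by rewrite inE mem_cat xA !orbT.
  - by move: cyc; rewrite !cyc_split pd => /andP[].
  - by apply/allP => x /sub[/(allP Xcs)|/dP[]].
split=> //.
have sub' : exiting cs \subset off cs'.
  apply/subsetP => x xe; move: (exiting_off xe); rewrite !in_off => /andP[-> ncs].
  by apply/negP => /sub[xcs|/dP[_ _]]; [rewrite xcs in ncs | rewrite xe].
apply: proper_card; apply/properP; split; first exact: reach_sub.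
have mO : m \in off cs' by rewrite in_off ncs' X_O //; exact: (allP Xcs).
exists m; last by apply/negP => /exiting_off; rewrite in_off mcs andbF.
case/orP: am => [me|/exists_inP[y ye emy]]; first exact: reach_base.
by apply: reach_step emy; rewrite ?(subsetP (reach_sub sub')).
Qed.

(* An ear of [cs] avoiding the exiting part can replace the arc that carries an
   attached vertex. *)
Lemma ear_growth cs n1 n2 d m :
  is_cyc cs -> n1 \in cs -> n2 \in cs -> n1 != n2 -> m \in cs ->
  m != n1 -> m != n2 -> attached cs m -> path e n1 (rcons d n2) -> uniq d ->
  (forall x, x \in d -> [/\ x \in X, x \notin cs & x \notin exiting cs]) ->
  (d = [::] -> forall k s, rot k cs <> n1 :: n2 :: s /\ rot k cs <> n1 :: rcons s n2) ->
  exists2 cs', is_cyc cs' & #|exiting cs| < #|exiting cs'|.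
Proof.
move=> cyc n1cs n2cs n12 mcs mn1 mn2 am pd ud dP nonadj.
have [k s E] := rot_to n1cs.
have n2s : n2 \in s by move: n2cs; rewrite -(mem_rot k) E inE eq_sym (negPf n12).
case/splitPr: n2s => A1 A2 in E.
have mem : rot k cs =i cs by exact: mem_rot.
have eexi : exiting (rot k cs) = exiting cs by apply: eq_exiting mem.
have dP' x : x \in d -> [/\ x \in X, x \notin rot k cs & x \notin exiting (rot k cs)].
  by rewrite mem eexi; exact: dP.
have am' : attached (rot k cs) m by rewrite /attached eexi.
rewrite -eexi; have : m \in n1 :: A1 ++ n2 :: A2 by rewrite -E mem.
rewrite inE (negPf mn1) mem_cat inE (negPf mn2) /=.
have cyc' : is_cyc (rot k cs) by rewrite is_cyc_rot.
case/orP=> mA.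
  have H := @reroute n1 A1 n2 A2 d m; cbv zeta in H; rewrite -E in H.
  case: (H cyc' mA am' pd ud dP') => [|c1 c2]; last by exists (n1 :: d ++ n2 :: A2).
  rewrite lt0n; apply/negP => /eqP/eqP; rewrite addn_eq0 !size_eq0 => /andP[/eqP dnil /eqP A0].
  by have [_] := nonadj dnil k A1; rewrite E A0 cats1.
(* Here [m] lies on the arc from [n2] back to [n1]: rotate the cycle and reverse the ear. *)
pose cs1 := n2 :: A2 ++ n1 :: A1.
have E1 : cs1 = rot (size A1).+1 (rot k cs) by rewrite E -cat_cons -[(size A1).+1]/(size (n1 :: A1)) rot_size_cat.
have mem1 : cs1 =i rot k cs by move=> x; rewrite E1 mem_rot.
have eexi1 : exiting cs1 = exiting (rot k cs) by apply: eq_exiting mem1.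
rewrite -eexi1.
have H := @reroute n2 A2 n1 A1 (rev d) m; cbv zeta in H; rewrite -/cs1 in H.
case: H; last by move=> c1 c2; exists (n2 :: rev d ++ n1 :: A1).
- by rewrite E1 is_cyc_rot.
- exact: mA.
- by rewrite /attached eexi1.
- rewrite -rev_cons -[n2 in path _ n2](last_rcons n1 d) -(belast_rcons n1 d n2).
  by rewrite rev_path; under eq_path do rewrite (lh_sym lh).
- by rewrite rev_uniq.
- by move=> x; rewrite mem_rev mem1 eexi1; exact: dP'.
- rewrite size_rev lt0n; apply/negP => /eqP/eqP; rewrite addn_eq0 !size_eq0 => /andP[/eqP dnil /eqP A0].
  by have [] := nonadj dnil k A2; rewrite E A0.
Qed.

Lemma connect_path_all (r : rel T) (P : pred T) x y :
  (forall u v, r u v -> P v) -> P x -> connect r x y ->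
  exists p, [/\ path r x p, last x p = y, uniq (x :: p) & all P (x :: p)].
Proof.
move=> rP Px /connectP[p pp ->]; have [q pq uq _] := shortenP pp.
exists q; split=> //; rewrite /= Px /=; elim: q x pq {uq pp Px} => //= v q IH u /andP[ruv pq].
by rewrite (rP _ _ ruv) (IH v).
Qed.

(** Otherwise the component of [y] in [X - x] would have only [x] as boundary in [X]. *)
Lemma X_connect_avoid x y y' : x \in X -> y \in X :\ x -> y' \in X :\ x ->
  connect (fun u v => [&& u \in X :\ x, v \in X :\ x & e u v]) y y'.
Proof.
move=> xX yX y'X; set r := (fun u v => _); apply: contraT => ncon.
have [yx y'x] : y != x /\ y' != x by move: yX y'X; rewrite !inE => /andP[-> _] /andP[-> _].
pose S := [set z in X :\ x | connect r y z].
have SX : S \subset X by apply/subsetP => z; rewrite !inE => /andP[/andP[]].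
have S0 : S != set0 by apply/set0Pn; exists y; rewrite inE yX /=.
have XS : 1 < #|X :\: S|.
  apply/card_gt1P; exists x, y'; split; last by rewrite eq_sym.
    by rewrite !inE eqxx xX.
  rewrite inE inE y'X (negPf ncon) /=; by case/setD1P: y'X.
have := lh_X2 lh SX S0 XS.
suff sub : boundary e S :&: X \subset [set x].
  by rewrite ltnNge (leq_trans (subset_leq_card sub)) ?cards1.
apply/subsetP => z /setIP[/boundaryP[nzS [u uS euz]] zX].
rewrite inE; apply: contraR nzS => zx.
move: uS; rewrite inE => /andP[uX cu].
have zX' : z \in X :\ x by rewrite !inE zx.
rewrite inE zX' /=; apply: connect_trans cu _; apply: connect1.
by rewrite /r uX zX'.
Qed.

Lemma exists_cyc : exists cs, is_cyc cs.
Proof.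
have /card_gt0P[x xX] : 0 < #|X| by apply: leq_trans (lh_X3 lh).
have XS : 1 < #|X :\: [set x]|.
  by move: (lh_X3 lh); rewrite (cardsD1 x) xX.
have /card_gt1P[y [y' [yb y'b yy]]] : 1 < #|boundary e [set x] :&: X|.
  by apply: (lh_X2 lh) XS; rewrite ?sub1set //; apply/set0Pn; exists x; rewrite inE.
have bd z : z \in boundary e [set x] :&: X -> z \in X :\ x /\ e x z.
  case/setIP=> /boundaryP[nz [u]].
  by rewrite inE => /eqP-> exz zX; move: nz; rewrite !inE => ->.
have [[yX exy] [y'X exy']] := (bd _ yb, bd _ y'b).
have [p [pp lp up /= /andP[_ ap]]] : exists p, [/\ path (fun u v => [&& u \in X :\ x, v \in X :\ x & e u v]) y p,
    last y p = y', uniq (y :: p) & all (mem (X :\ x)) (y :: p)].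
  by apply: connect_path_all (X_connect_avoid xX yX y'X) => // u v /and3P[].
exists (x :: y :: p); apply/and4P; split.
- case: p lp {pp up ap} => [|//] /= E; by rewrite E eqxx in yy.
- rewrite cons_uniq up andbT inE negb_or; case/setD1P: yX => [yx _].
  by rewrite eq_sym yx; apply/negP => /(allP ap) /=; rewrite !inE eqxx.
- rewrite /= exy rcons_path lp (lh_sym lh) exy' andbT.
  by apply: sub_path pp => u v /and3P[].
- apply/allP => z; rewrite !inE => /or3P[/eqP->|/eqP->|/(allP ap)] //.
    by case/setD1P: yX.
  by case/setD1P.
Qed.

Lemma cyc_X cs z : is_cyc cs -> z \in cs -> z \in X.
Proof. by case/and4P=> _ _ _ /allP H /H. Qed.

Lemma cyc_big cs (S : {set T}) : is_cyc cs -> S \subset X ->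
  (forall z, z \in S -> z \notin cs) -> 1 < #|X :\: S|.
Proof.
move=> cyc SX Scs; have [sz ucs _ Xcs] := and4P cyc.
apply: leq_trans (ltnW sz) _; rewrite -(card_uniqP ucs); apply: subset_leq_card.
apply/subsetP => z zcs; rewrite inE (cyc_X cyc zcs) andbT.
by apply/negP => /Scs; rewrite zcs.
Qed.

(** Some vertex of [O] exits. If it is off the cycle, the exiting part within [X] has a neighbour in
    [X] by 2-connectivity, and a neighbour off the cycle would be exiting itself. *)
Lemma exists_attached cs : is_cyc cs -> exists2 m, m \in cs & attached cs m.
Proof.
move=> cyc; have [o oO [i _ oi]] := lh_conn lh ord0.
have oe : exits o by apply/existsP; exists i.
case ocs : (o \in cs); first by exists o; rewrite // /attached oe.
have oex : o \in exiting cs by apply: reach_base; rewrite // in_off oO ocs.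
(* A fringe vertex has a neighbour in [X], which is attached or exiting. *)
wlog oX : o {oO ocs oe oi} oex / o \in X.
  move=> H; case/setUP: (oO) => [/(H _ oex)//|oF].
  have [x xX eox] := lh_FX lh oF; case xcs : (x \in cs).
    exists x; rewrite // /attached; apply/orP; right; apply/exists_inP; exists o => //.
    by rewrite (lh_sym lh).
  apply: (H x) => //; apply: reach_step oex _; first by rewrite in_off X_O ?xcs.
  by rewrite (lh_sym lh).
pose S := exiting cs :&: X.
have SX : S \subset X by apply: subsetIr.
have S0 : S != set0 by apply/set0Pn; exists o; rewrite inE oex.
have Scs z : z \in S -> z \notin cs.
  by case/setIP=> /exiting_off; rewrite in_off => /andP[].
have /card_gt1P[y [_ [/setIP[yb yX] _ _]]] := lh_X2 lh SX S0 (cyc_big cyc SX Scs).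
case/boundaryP: yb => nyS [x /setIP[xex xX] exy].
have eyx : e y x by rewrite (lh_sym lh).
case ycs : (y \in cs).
  by exists y; rewrite // /attached; apply/orP; right; apply/exists_inP; exists x.
case/negP: nyS; rewrite inE yX andbT; apply: reach_step xex eyx.
by rewrite in_off X_O ?ycs.
Qed.

Lemma attached_nbr cs m : is_cyc cs -> m \in cs -> attached cs m ->
  exists2 y, e m y & (y \in Th) || (y \in exiting cs).
Proof.
move=> cyc mcs; have mO := X_O (cyc_X cyc mcs).
case/orP=> [/(exitsP mO)[y yT emy]|/exists_inP[y ye emy]].
  by exists y; rewrite ?yT.
by exists y; rewrite ?ye ?orbT.
Qed.

Lemma Th_ncs cs y : is_cyc cs -> y \in Th -> y \notin cs.
Proof.
move=> cyc yT; apply/negP => /(cyc_X cyc)/X_O/(disjointFr (lh_OT lh)).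
by rewrite yT.
Qed.

Lemma exiting_ncs cs y : y \in exiting cs -> y \notin cs.
Proof. by move/exiting_off; rewrite in_off => /andP[]. Qed.

Lemma rot_next cs k x y s : uniq cs -> rot k cs = x :: y :: s -> next cs x = y.
Proof. by move=> u E; rewrite -(next_rot k) // E /= eqxx. Qed.

Lemma rot_prev cs k x y s : uniq cs -> rot k cs = x :: rcons s y -> prev cs x = y.
Proof.
move=> u E; have u' : uniq (x :: rcons s y) by rewrite -E rot_uniq.
by rewrite -(prev_rot k) // E -(prev_rotr 1 u') -rcons_cons rotr1_rcons /= eqxx.
Qed.

Lemma cyc_nbrs cs z : is_cyc cs -> z \in cs ->
  [/\ e z (next cs z), e z (prev cs z), next cs z != prev cs z,
      next cs z \in cs & prev cs z \in cs].
Proof.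
move=> cyc zcs; have [_ u c' _] := and4P cyc.
split; rewrite ?mem_next ?mem_prev //.
- exact: next_cycle.
- by rewrite (lh_sym lh) prev_cycle.
have [k [a [s [b E]]]] := cyc_shape cyc zcs.
rewrite (rot_next u E) (rot_prev u (E : _ = _ :: rcons (a :: s) b)).
move: u; rewrite -(rot_uniq k) E /= mem_rcons inE negb_or.
by case/and3P=> _ /andP[].
Qed.

Lemma cyc_third cs z : is_cyc cs -> z \in cs ->
  exists y, [/\ e z y, y != next cs z & y != prev cs z].
Proof.
move=> cyc zcs.
have : ~~ ([set y | e z y] \subset [set next cs z; prev cs z]).
  apply/negP => /subset_leq_card; rewrite (lh_deg lh) ?X_O ?(cyc_X cyc) // cards2.
  by case: (_ != _).
case/subsetPn => y; rewrite !inE negb_or => ezy /andP[ya yb].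
by exists y.
Qed.

Lemma attached_unique cs m y : is_cyc cs -> m \in cs -> attached cs m ->
  e m y -> y \notin cs -> (y \in Th) || (y \in exiting cs).
Proof.
move=> cyc mcs am emy ycs; have [y' emy' Hy'] := attached_nbr cyc mcs am.
rewrite (cyc_off1 cyc mcs emy emy') //.
by case/orP: Hy' => [/(Th_ncs cyc)|/exiting_ncs].
Qed.

(** The third edge of an attached vertex goes to [Th] or to the exiting part, hence is no chord. *)
Lemma attached_chord cs m y : is_cyc cs -> m \in cs -> attached cs m ->
  e m y -> y != next cs m -> y != prev cs m -> y \notin cs.
Proof.
move=> cyc mcs am emy ya yb; apply/negP => ycs.
have [ema emb ab acs bcs] := cyc_nbrs cyc mcs.
have [y' emy' Hy'] := attached_nbr cyc mcs am.
have ny' : y' \notin cs by case/orP: Hy' => [/(Th_ncs cyc)|/exiting_ncs].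
have := @nbr_bound m [:: next cs m; prev cs m; y; y'] (X_O (cyc_X cyc mcs)).
rewrite /= ema emb emy emy' /= !inE !negb_or ab ![_ == y]eq_sym ya yb /=.
have neq x : x \in cs -> x != y' by apply: contraTneq => ->.
by rewrite !neq //= => /(_ isT isT).
Qed.

(** The component of [x] off the cycle contains no exiting vertex, in particular no fringe vertex,
    so it lies in [X]. By 2-connectivity it has two neighbours in [X], both on the cycle. *)
Lemma non_exiting_ear cs x : is_cyc cs -> x \in off cs -> x \notin exiting cs ->
  exists n1 n2 h d,
  [/\ n1 \in cs, n2 \in cs, n1 != n2, path e n1 (rcons (h :: d) n2) &
      uniq (h :: d) /\ forall z, z \in h :: d -> [/\ z \in X, z \notin cs & z \notin exiting cs]].
Proof.
move=> cyc xoff nxe; pose S := [set z | connect (off_adj cs) x z].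
have Soff z : z \in S -> z \in off cs /\ z \notin exiting cs.
  rewrite inE => /connectP[p pp ->]; elim: p (x) xoff nxe pp => //= u p IH v voff nve.
  case/andP=> /and3P[_ uoff evu] pp; apply: IH => //; apply: contra nve => ue.
  exact: reach_step evu.
have SX : S \subset X.
  apply/subsetP => z /Soff[zoff nze]; move: (zoff).
  rewrite in_off => /andP[/setUP[//|zF] _].
  by case/negP: nze; apply: reach_base => //; exact: F_exits.
have Scs z : z \in S -> z \notin cs by case/Soff; rewrite in_off => /andP[].
have S0 : S != set0 by apply/set0Pn; exists x; rewrite inE connect0.
have bcs n : n \in boundary e S :&: X -> n \in cs /\ exists2 s, s \in S & e s n.
  case/setIP=> /boundaryP[nS [s sS esn]] nX; split; last by exists s.
  apply: contraR nS => ncs; have [soff _] := Soff _ sS; move: sS; rewrite !inE => cxs.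
  apply: connect_trans cxs (connect1 _); rewrite /off_adj /within soff esn in_off ncs.
  by rewrite X_O.
have /card_gt1P[n1 [n2 [/bcs[n1cs [s1 s1S e1]] /bcs[n2cs [s2 s2S e2]] n12]]] :=
  lh_X2 lh SX S0 (cyc_big cyc SX Scs).
have con12 : connect (off_adj cs) s1 s2.
  move: s1S s2S; rewrite !inE => c1; apply: connect_trans.
  by rewrite (sym_connect_sym (within_sym (off cs) (lh_sym lh))).
have [p [pp lp up ap]] : exists p, [/\ path (off_adj cs) s1 p, last s1 p = s2, uniq (s1 :: p)
    & all (connect (off_adj cs) x) (s1 :: p)].
  have /connectP[p pp lp] := con12; move: lp; have [q pq uq _] := shortenP pp => lp.
  exists q; split => //.
  apply/allP => z /(path_connect pq); apply: connect_trans.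
  by move: s1S; rewrite inE.
exists n1, n2, s1, p; split=> //.
  rewrite /= rcons_path lp e2 andbT (lh_sym lh) e1 /=.
  by apply: sub_path pp => u v /and3P[].
split=> // z /(allP ap) cz; have zS : z \in S by rewrite inE.
by split; [exact: (subsetP SX) | exact: Scs | case: (Soff z zS)].
Qed.

(* For [cs] with the largest exiting part. *)
Lemma good_cycle : exists cs,
  [/\ is_cyc cs, off cs \subset exiting cs &
      forall z, z \in cs -> z != c ->
        exists2 y, e z y & (y \in Th) || (y \in off cs)].
Proof.
have [cs0 cyc0] := exists_cyc.
have [n] := ubnP (#|O| - #|exiting cs0|).
elim: n cs0 cyc0 => // n IH cs cyc lt.
have grow cs' : is_cyc cs' -> #|exiting cs| < #|exiting cs'| -> exists cs,
  [/\ is_cyc cs, off cs \subset exiting cs &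
      forall z, z \in cs -> z != c -> exists2 y, e z y & (y \in Th) || (y \in off cs)].
  move=> cyc' lt'; apply: (IH cs') => //.
  have : #|exiting cs'| <= #|O|.
    by apply: subset_leq_card; apply/subsetP => x /exiting_off; rewrite in_off => /andP[].
  by move: lt; rewrite ltnS; lia.
have [m mcs am] := exists_attached cyc.
case: (boolP (off cs \subset exiting cs)) => [sub|/subsetPn[x xoff nxe]].
  case: (pickP [pred z in cs | (z != c) &&
           ~~ [exists y, e z y && ((y \in Th) || (y \in off cs))]]) => [z|H].
    case/and3P=> zcs zc /existsPn nz.
    (* If [z] has no edge leaving the cycle, its third edge is a chord [zy]. The attached vertex [m]
       is neither end of a chord, so [zy] serves as an ear without inner vertices. *)
    have [y [ezy yn yp]] := cyc_third cyc zcs.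
    have [_ ucs _ _] := and4P cyc.
    have ycs : y \in cs.
      have := lh_nbX lh (cyc_X cyc zcs) zc ezy; rewrite -/O inE => yOT.
      have := nz y; rewrite ezy negb_or in_off negb_and negbK /=.
      by case/andP=> /negPf yT; rewrite yT orbF in yOT; rewrite yOT.
    have zy : z != y.
      by apply: contraTneq ezy => <-; rewrite (lh_irr lh).
    have mz : m != z.
      apply/negP => /eqP mz; rewrite mz in am.
      by move: (attached_chord cyc zcs am ezy yn yp); rewrite ycs.
    have my : m != y.
      apply/negP => /eqP my; rewrite my in am.
      have := @attached_chord cs y z cyc ycs am; rewrite (lh_sym lh) zcs => H.
      suff: false by []; apply: H => //.
        by apply: contra yp => /eqP->; rewrite prev_next.
      by apply: contra yn => /eqP->; rewrite next_prev.
    have [|||cs'] := @ear_growth cs z y [::] m cyc zcs ycs zy mcs mz my am _ isT _ _; last exact: grow.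
    - by rewrite /= ezy.
    - by [].
    - by move=> _ k s; split=> E; [case/negP: yn | case/negP: yp];
        rewrite ?(rot_next ucs E) ?(rot_prev ucs E).
  exists cs; split=> // z zcs zc; have /= := H z; rewrite zcs zc /= => /negbFE.
  by case/existsP=> y /andP[ezy Hy]; exists y.
have [n1 [n2 [h [d [n1cs n2cs n12 pd [ud dP]]]]]] := non_exiting_ear cyc xoff nxe.
(* The third edge at an end of the ear enters the non-exiting part, so that end is not attached. *)
have mn n' y : n' \in cs -> e n' y -> y \in h :: d -> m != n'.
  move=> n'cs en'y yd; apply/negP => /eqP mn; rewrite mn in am.
  have [yX ycs yne] := dP y yd.
  have := attached_unique cyc n'cs am en'y ycs; rewrite (negPf yne) orbF => yT.
  by move: (disjointFr (lh_OT lh) (X_O yX)); rewrite yT.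
have [|||cs'] := @ear_growth cs n1 n2 (h :: d) m cyc n1cs n2cs n12 mcs _ _ am pd ud dP; last exact: grow.
- by apply: (mn _ h) => //; [case/andP: pd | rewrite mem_head].
- apply: (mn _ (last h d)) => //; last exact: mem_last.
  by move: pd; rewrite /= rcons_path => /and3P[_ _]; rewrite (lh_sym lh).
- by [].
Qed.

End GoodCycle.

(** * Index relations generated by half-turns *)

Section Rotation.
Variables (s l : nat) (R : nat -> nat -> Prop).
Let D n := 0 < n < l.
Hypothesis R_refl : forall n, D n -> R n n.
Hypothesis R_sym : forall n m, D n -> D m -> R n m -> R m n.
Hypothesis R_trans : forall m n p, D m -> D n -> D p -> R n m -> R m p -> R n p.
Hypothesis step_up : forall n, 0 < n -> n + s < l -> R n (n + s).
Hypothesis step_wrap : forall n, 0 < n < s -> R n (n + (l - s)).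

(** With [l - s = s + 1], a wrapping step up by [s + 1] and a step down by [s] move the index by 1.
    Index 0 never occurs in a chain: it may carry [c], through which codomination need not be
    transitive. *)
Lemma rotation_odd n : l = 2 * s + 1 -> D n -> R 1 n.
Proof.
move=> El Dn; move: (Dn); rewrite /D => Dn'; have lo m : 0 < m <= s -> R 1 m.
  elim: m => // m IH; case: (posnP m) => [->|m0] ms; first by apply: R_refl; rewrite /D; lia.
  have R1m : R 1 m by apply: IH; lia.
  apply: (@R_trans m) => //; rewrite /D; try lia.
  have -> : m.+1 = m + 1 by lia.
  apply: (@R_trans (m + s + 1)); rewrite /D; try lia.
    by rewrite -addnA; rewrite (_ : s + 1 = l - s); [apply: step_wrap; lia | lia].
  apply: R_sym; rewrite /D; try lia.
  by rewrite addnAC; apply: step_up; lia.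
case: (leqP n s) => ns; first by apply: lo; lia.
rewrite -(subnK (ltnW ns)); apply: (@R_trans (n - s)); rewrite /D; try lia.
- by apply: lo; lia.
- by apply: step_up; lia.
Qed.

(** With [l - s = s + 2] the same two steps move the index by 2. *)
Lemma rotation_even_lo r m : l = 2 * s + 2 -> 0 < r <= 2 ->
  r + 2 * m <= s + 1 -> R r (r + 2 * m).
Proof.
move=> El r12; elim: m => [|m IH] ms; first by rewrite addn0; apply: R_refl; rewrite /D; lia.
set k := r + 2 * m in IH *; have Rrk : R r k by apply: IH; lia.
have -> : r + 2 * m.+1 = k + 2 by lia.
apply: (@R_trans k) => //; rewrite /D; try lia.
apply: (@R_trans (k + s + 2)); rewrite /D; try lia.
  by rewrite -addnA; rewrite (_ : s + 2 = l - s); [apply: step_wrap; lia | lia].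
apply: R_sym; rewrite /D; try lia.
by rewrite addnAC; apply: step_up; lia.
Qed.

Lemma rotation_even r n : l = 2 * s + 2 -> ~~ odd s -> 0 < r <= 2 -> 0 < s ->
  D n -> odd n = odd r -> R r n.
Proof.
move=> El so r12 s0 Dn par; move: (Dn); rewrite /D => Dn'.
have lo m : 0 < m <= s + 1 -> odd m = odd r -> R r m.
  move=> ms mr; have -> : m = r + 2 * ((m - r)./2) by lia.
  by apply: rotation_even_lo; lia.
case: (leqP n (s + 1)) => ns; first by apply: lo; lia.
have ns' : s <= n by lia.
rewrite -(subnK ns'); apply: (@R_trans (n - s)); rewrite /D; try lia.
- by apply: lo; lia.
- by apply: step_up; lia.
Qed.

(** The step from 1 to [1 + s] changes parity, which merges the two classes. *)
Lemma rotation_even_odd n : l = 2 * s + 2 -> odd s -> D n -> R 1 n.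
Proof.
move=> El so Dn; move: (Dn); rewrite /D => Dn'.
have lo r m : 0 < r <= 2 -> 0 < m <= s + 1 -> odd m = odd r -> R r m.
  move=> r12 ms mr; have -> : m = r + 2 * ((m - r)./2) by lia.
  by apply: rotation_even_lo; lia.
have R12 : R 1 2.
  apply: (@R_trans (1 + s)); rewrite /D; try lia.
    by apply: step_up; lia.
  by apply: R_sym; rewrite /D; try lia; apply: lo; lia.
have lo1 m : 0 < m <= s + 1 -> R 1 m.
  move=> ms; case mo : (odd m); first by apply: lo; lia.
  by apply: (@R_trans 2); rewrite /D; try lia; [| apply: lo; lia].
case: (leqP n (s + 1)) => ns; first by apply: lo1; lia.
have ns' : s <= n by lia.
rewrite -(subnK ns'); apply: (@R_trans (n - s)); rewrite /D; try lia.
- by apply: lo1; lia.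
- by apply: step_up; lia.
Qed.

End Rotation.

(** * Beads with tails, and cyclic indexing *)

Definition near m n := [|| n == m.+1, n == m.+2, m == n.+1 | m == n.+2].

(** [A] and [A'] are the interiors of the two arcs between the marked vertices [x] and [y], so
    [near] compares the arc lengths. The tails [l1] and [l2], possibly empty, will become parts of
    the paths joining the beads of the necklace. *)
Definition bead (T : eqType) (e : rel T) x A l1 y A' l2 :=
  [&& uniq (x :: l1 ++ A ++ y :: l2 ++ A'), cycle e (x :: A ++ y :: A'),
      path e x l1, path e y l2 & near (size A) (size A')].

Definition cnth (T : Type) (x0 : T) cs n := nth x0 cs (n %% size cs).

Lemma nth_rot_cnth (T : Type) (x0 : T) cs n i : i < size cs ->
  nth x0 (rot (n %% size cs) cs) i = cnth x0 cs (n + i).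
Proof.
move=> il; rewrite /cnth /rot nth_cat size_drop nth_drop.
have l0 : 0 < size cs by lia.
have nl : n %% size cs < size cs by rewrite ltn_mod.
rewrite -(modnDml n i); set r := n %% size cs in nl *; case: ltnP => H.
  by rewrite [(r + i) %% _]modn_small //; lia.
rewrite nth_take; last by lia.
have -> : r + i = (i - (size cs - r)) + size cs by lia.
by rewrite modnDr modn_small //; lia.
Qed.

Lemma cnth_period (T : Type) (x0 : T) cs n : cnth x0 cs (n + size cs) = cnth x0 cs n.
Proof. by rewrite /cnth modnDr. Qed.

Lemma cnth_mod (T : Type) (x0 : T) cs n : cnth x0 cs (n %% size cs) = cnth x0 cs n.
Proof. by rewrite /cnth modn_mod. Qed.

Lemma cnth_mem (T : eqType) (x0 : T) cs n : 0 < size cs -> cnth x0 cs n \in cs.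
Proof. by move=> l0; rewrite mem_nth // ltn_mod. Qed.

Lemma rot_split (T : eqType) (x0 : T) cs n s : 0 < s < size cs -> exists A A',
  [/\ rot (n %% size cs) cs = cnth x0 cs n :: A ++ cnth x0 cs (n + s) :: A',
      size A = s.-1 & size A' = size cs - s - 1].
Proof.
move=> /andP[s0 sl]; pose c1 := rot (n %% size cs) cs.
have l0 : 0 < size cs by lia.
have Ec1 := cat_take_drop s c1.
have sc1 : size c1 = size cs by rewrite size_rot.
have h0 : cnth x0 cs n = nth x0 c1 0 by rewrite /c1 nth_rot_cnth // addn0.
have hs : cnth x0 cs (n + s) = nth x0 c1 s by rewrite /c1 nth_rot_cnth.
exists (behead (take s c1)), (drop s.+1 c1); split.
- rewrite h0 hs -/c1 -drop_nth ?sc1 // -{1}Ec1.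
  case: (c1) sc1 => [|a c2] /= sc1; first by lia.
  by case: s s0 {sl Ec1 hs}.
- by rewrite size_behead size_takel ?sc1 // ltnW.
- by rewrite size_drop sc1; lia.
Qed.

Lemma uniq_bead_parts (T : eqType) (x : T) l1 A y l2 A' : uniq (x :: A ++ y :: A') -> uniq (l1 ++ l2) ->
  (forall z, z \in l1 ++ l2 -> z \notin x :: A ++ y :: A') ->
  uniq (x :: l1 ++ A ++ y :: l2 ++ A').
Proof.
move=> u1 u2 H; have -> : uniq (x :: l1 ++ A ++ y :: l2 ++ A') =
    uniq ((l1 ++ l2) ++ (x :: A ++ y :: A')).
  by apply: perm_uniq; apply/permP => P; rewrite /= !count_cat /= !count_cat /=; lia.
rewrite cat_uniq u1 u2 andbT; apply/hasPn => z zcs.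
by apply/negP => /H; rewrite zcs.
Qed.

(** * Nearly opposite cycle vertices: linked or codominated *)

Section Linked.
Variables (T : finType) (e : rel T) (X F Th : {set T})
  (ex : T -> 'I_3 -> bool) (c : T).
Hypothesis lh : local_hyp e X F Th ex c.
Local Notation O := (X :|: F).
Local Notation off := (off X F).
Local Notation exiting := (exiting e X F ex).
Local Notation is_cyc := (is_cyc e X).

Definition leg_bead := exists x A l1 y A' l2 i j,
  [/\ bead e x A l1 y A' l2, all (mem O) (x :: l1 ++ A ++ y :: l2 ++ A'),
      i != j, ex (last x l1) i & ex (last y l2) j].

Variable cs : seq T.
Hypotheses (cyc : is_cyc cs) (off_exiting : off cs \subset exiting cs)
  (third : forall z, z \in cs -> z != c ->
     exists2 y, e z y & (y \in Th) || (y \in off cs)).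

(* The exits to a leg are contracted to a single vertex, so that disjoint paths
   end on different legs; no edge enters the cycle. *)
Definition outward : rel (T + 'I_3) := fun u v =>
  match u, v with
  | inl x, inl y => [&& x \in O, y \in off cs & e x y]
  | inl x, inr i => (x \in O) && ex x i
  | _, _ => false
  end.

Definition legs_set : {set T + 'I_3} := [set inr i | i in 'I_3].

Lemma mem_legs u : (u \in legs_set) = if u is inr _ then true else false.
Proof.
by apply/imsetP/idP => [[i _ ->]//|]; case: u => // i _; exists i.
Qed.

Lemma outward_path a p : path outward (inl a) p -> last (inl a) p \in legs_set ->
  exists l i, [/\ p = rcons (map inl l) (inr i), path e a l, all (mem (off cs)) l &
                  ex (last a l) i].
Proof.
elim: p a => [|[b|i] p IH] a; rewrite ?mem_legs //=.
- move=> /andP[/and3P[aO boff eab] pp]; rewrite -mem_legs => pB.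
  have [l [i [-> pl al exi]]] := IH b pp pB.
  by exists (b :: l), i; rewrite /= eab pl boff al.
- move=> /andP[/andP[aO exi] pp] _; exists [::], i; split=> //.
  by case: p pp {IH}.
Qed.

Lemma path_outward a l i : a \in O -> path e a l -> all (mem (off cs)) l ->
  ex (last a l) i -> path outward (inl a) (rcons (map inl l) (inr i)).
Proof.
elim: l a => [|b l IH] a aO /=; first by rewrite aO => _ _ ->.
move=> /andP[eab pl] /andP[boff al] exi; rewrite aO boff eab IH //.
by move: boff; rewrite in_off => /andP[].
Qed.

Definition linked a b := exists l1 l2 i j,
  [/\ i != j, path e a l1, path e b l2,
      uniq (l1 ++ l2) /\ all (mem (off cs)) (l1 ++ l2) & ex (last a l1) i /\ ex (last b l2) j].

Lemma cyc_O z : z \in cs -> z \in O.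
Proof. by move=> zcs; rewrite inE (cyc_X cyc zcs). Qed.

Local Notation domi := (dom outward legs_set).
Local Notation codomi := (codominated outward legs_set).
Local Notation livei v := (live outward legs_set v).

Lemma live_off x : x \in off cs -> livei (inl x).
Proof.
move/(subsetP off_exiting); move: x; apply: reach_ind => [x xo /existsP[i exi]|x y xo yex [p pp pB] exy].
  exists [:: inr i]; rewrite /= ?mem_legs // exi !andbT.
  by move: xo; rewrite in_off => /andP[].
exists (inl y :: p) => //=; rewrite pp exy (exiting_off yex) !andbT.
by move: xo; rewrite in_off => /andP[].
Qed.

Lemma live_cyc z : z \in cs -> z != c -> livei (inl z).
Proof.
move=> zcs zc; have zO := cyc_O zcs; have [y ezy] := third zcs zc.
case/orP=> [yT|yoff].
  have [i exi] := lh_exT lh zO yT ezy; exists [:: inr i]; rewrite /= ?mem_legs //.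
  by rewrite zO exi.
have [p pp pB] := live_off yoff; exists (inl y :: p) => //=.
by rewrite zO yoff ezy.
Qed.

Lemma codom_linked a b : a \in cs -> b \in cs -> a != b ->
  codomi (inl a) (inl b) \/ linked a b.
Proof.
move=> acs bcs ab; have [||[p [q [pp pq pB qB D]]]] := @codom_or_linked _ outward legs_set (inl a) (inl b) _.
- by apply: contra ab => /eqP[->].
- by left.
move: pB qB D; have [p1 pp1 up1 sub1] := shortenP pp; have [q1 pq1 uq1 sub2] := shortenP pq.
move=> pB qB D.
have [l1 [i [Ep pl1 al1 exi]]] := outward_path pp1 pB.
have [l2 [j [Eq pl2 al2 exj]]] := outward_path pq1 qB.
have D1 u : u \in p1 -> u \in q1 -> False.
  move=> /sub1 up /sub2 uq; have up' : u \in inl a :: p by rewrite inE up orbT.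
  by move: (disjointFr D up'); rewrite inE uq orbT.
right; exists l1, l2, i, j; split=> //.
- apply/negP => /eqP ij; apply: (D1 (inr i)); rewrite ?Ep ?Eq mem_rcons inE ?ij eqxx //.
- split; last by rewrite all_cat al1.
  have inlI : injective (@inl T 'I_3) by move=> u v [].
  move: up1 uq1; rewrite Ep Eq !cons_uniq !rcons_uniq !(map_inj_uniq inlI).
  case/and3P=> _ _ u1 /and3P[_ _ u2]; rewrite cat_uniq u1 u2 andbT /=.
  apply/hasPn => x xl2; apply/negP => xl1; apply: (D1 (inl x)).
    by rewrite Ep mem_rcons inE map_f ?orbT.
  by rewrite Eq mem_rcons inE map_f ?orbT.
Qed.

Lemma cycle_bead n x A y A' : rot n cs = x :: A ++ y :: A' -> near (size A) (size A') ->
  linked x y -> leg_bead.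
Proof.
move=> E nr [l1 [l2 [i [j [ij p1 p2 [u al] [ei ej]]]]]].
have mem z : (z \in x :: A ++ y :: A') = (z \in cs) by rewrite -E mem_rot.
have [_ ucs ccs Xcs] := and4P cyc.
have lcs z : z \in l1 ++ l2 -> z \in O /\ z \notin x :: A ++ y :: A'.
  by rewrite mem; move/(allP al) => /=; rewrite in_off => /andP[].
exists x, A, l1, y, A', l2, i, j; split=> //.
  apply/and5P; split=> //; last by rewrite -E rot_cycle.
  apply: uniq_bead_parts => //; first by rewrite -E rot_uniq.
  by move=> z /lcs[].
apply/allP => z zb; have : (z \in l1 ++ l2) || (z \in x :: A ++ y :: A').
  by move: zb; rewrite !(inE, mem_cat); do !case: (_ \in _); rewrite ?orbT //; case: (_ == _); rewrite ?orbT.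
case/orP=> [/lcs[]//|]; rewrite mem; exact: cyc_O.
Qed.

Definition codomb u v := [exists w, domi w u && domi w v].
Lemma codombP u v : reflect (codomi u v) (codomb u v).
Proof. exact: existsP. Qed.

Local Notation l := (size cs).
Local Notation z := (cnth c cs).

Lemma codom_step s n : 0 < s < l -> near s.-1 (l - s - 1) ->
  ~ leg_bead -> codomi (inl (z n)) (inl (z (n + s))).
Proof.
move=> sl nr nb; have [A [A' [E s1 s2]]] := rot_split c n sl.
have [_ ucs _ _] := and4P cyc.
have zcs m : z m \in cs.
  by apply: cnth_mem; case/andP: sl => s0; apply: leq_trans.
have neq : z n != z (n + s).
  move: ucs; rewrite -(rot_uniq (n %% l)) E /= mem_cat negb_or => /andP[/andP[_]].
  by rewrite inE negb_or => /andP[].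
have [//|lk] := codom_linked (zcs n) (zcs (n + s)) neq.
by case: nb; apply: cycle_bead E _ lk; rewrite s1 s2.
Qed.

(* [c], when it is on the cycle, is assumed to be at index 0. *)
Hypothesis c_first : forall n, 0 < n < l -> z n != c.

(** Two vertices [s] apart cut the cycle into arcs with [s - 1] and with [s] or [s + 1] inner
    vertices; if they were linked to different legs there would be a bead. So half-turns preserve
    codomination, and the rotation lemmas apply. *)
Lemma codom_indices : ~ leg_bead -> exists s,
  [/\ 0 < s, l = 2 * s + 1 \/ l = 2 * s + 2,
      forall n, codomi (inl (z n)) (inl (z (n + s))),
      l = 2 * s + 1 \/ odd s -> forall n, 0 < n < l -> codomi (inl (z 1)) (inl (z n)) &
      l = 2 * s + 2 -> ~~ odd s -> forall r n, 0 < r <= 2 -> 0 < n < l -> odd n = odd r ->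
        codomi (inl (z r)) (inl (z n))].
Proof.
move=> nb; have [sz _ _ _] := and4P cyc.
have zcs m : z m \in cs by apply: cnth_mem; apply: leq_trans sz.
have [s [s0 El]] : exists s, 0 < s /\ (l = 2 * s + 1 \/ l = 2 * s + 2).
  exists (l.-1)./2; lia.
have step n : codomi (inl (z n)) (inl (z (n + s))).
  by apply: codom_step => //; rewrite /near; lia.
pose R n m := codomi (inl (z n)) (inl (z m)).
have Rrefl n : 0 < n < l -> R n n.
  by move=> _; exists (inl (z n)); rewrite dom_refl.
have Rsym n m : 0 < n < l -> 0 < m < l -> R n m -> R m n by move=> _ _; exact: codom_sym.
(* The middle vertex has to be live, hence different from [c]. *)
have Rtrans m n p : 0 < m < l -> 0 < n < l -> 0 < p < l -> R n m -> R m p -> R n p.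
  move=> ml _ _; apply: codom_trans; apply: live_cyc => //; exact: c_first.
have up n : 0 < n -> n + s < l -> R n (n + s) by move=> _ _; exact: step.
have wrap n : 0 < n < s -> R n (n + (l - s)).
  move=> ns; apply: codom_sym; have := step (n + (l - s)).
  have -> : n + (l - s) + s = n + l by lia.
  by rewrite cnth_period.
exists s; split=> // [H n ln|El2 so r n r12 ln par].
  case: El => El; first exact: (rotation_odd Rrefl Rsym Rtrans up wrap El ln).
  case: H => [|so]; first by lia.
  exact: (rotation_even_odd Rrefl Rsym Rtrans up wrap El so ln).
exact: (rotation_even Rrefl Rsym Rtrans up wrap El2 so r12 s0 ln par).
Qed.

End Linked.

(** * Alternating domination around the cycle *)

Section Bad.
Variables (T : finType) (e : rel T) (X F Th : {set T})
  (ex : T -> 'I_3 -> bool) (c : T).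
Hypothesis lh : local_hyp e X F Th ex c.
Local Notation O := (X :|: F).
Local Notation off := (off X F).
Local Notation exiting := (exiting e X F ex).
Local Notation is_cyc := (is_cyc e X).
Local Notation legs_set := (legs_set T).
Local Notation z cs := (cnth c cs).

Definition good_cyc cs :=
  [/\ is_cyc cs, off cs \subset exiting cs &
      forall z, z \in cs -> z != c ->
        exists2 y, e z y & (y \in Th) || (y \in off cs)].

Lemma off_rot k cs : off (rot k cs) = off cs.
Proof. by apply/setP => x; rewrite !in_off mem_rot. Qed.

Lemma outward_rot k cs : outward e X F ex (rot k cs) = outward e X F ex cs.
Proof. by rewrite /outward off_rot. Qed.

Local Notation outward := (outward e X F ex).
Local Notation domi cs := (dom (outward cs) legs_set).

Lemma good_cyc_rot k cs : good_cyc cs -> good_cyc (rot k cs).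
Proof.
case=> cyc sub third; split.
- by rewrite is_cyc_rot.
- by rewrite off_rot (eq_exiting _ _ _ _ (mem_rot k cs)).
- by move=> x; rewrite mem_rot off_rot; exact: third.
Qed.

Section Fixed.
Variable cs : seq T.
Hypothesis good : good_cyc cs.

Let cyc : is_cyc cs. Proof. by case: good. Qed.
Let sub : off cs \subset exiting cs. Proof. by case: good. Qed.
Let third : forall z, z \in cs -> z != c ->
        exists2 y, e z y & (y \in Th) || (y \in off cs).
Proof. by case: good. Qed.

(** On the cycle, [c] has only one further edge, namely the one that leaves the block, its fringe
    and the theta graph. *)
Lemma c_no_off y : c \in cs -> e c y -> y \notin cs -> y \notin O :|: Th.
Proof.
move=> ccs ecy ycs; have [y' ecy' Hy'] := lh_nbc lh (cyc_X cyc ccs).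
rewrite (cyc_off1 lh cyc ccs ecy ecy') //; apply: contra Hy' => /(cyc_X cyc) y'X.
by rewrite !inE y'X.
Qed.

Lemma dom_exit w x i : domi cs w (inl x) -> w != inl x -> x \in O -> ex x i -> w = inr i.
Proof.
move=> d wx xO exi; apply: dom_target (_ : inr i \in legs_set) _; first by rewrite mem_legs.
by apply: dom_step d _; rewrite 1?eq_sym //= xO.
Qed.

Lemma dom_Th w x y : domi cs w (inl x) -> w != inl x -> x \in O -> e x y -> y \in Th ->
  exists2 i, w = inr i & ex x i.
Proof.
move=> d wx xO exy yT; have [i exi] := lh_exT lh xO yT exy.
by exists i => //; exact: dom_exit d wx xO exi.
Qed.

Lemma dom_off w x y : domi cs w (inl x) -> w != inl x -> x \in O -> e x y -> y \in off cs ->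
  domi cs w (inl y).
Proof. by move=> d wx xO exy yoff; apply: dom_step d _; rewrite 1?eq_sym //= xO yoff. Qed.

(** The component of [x] off the cycle has a neighbour on it: either by 2-connectivity of the block,
    or because it is a fringe vertex with its neighbour in [X] on the cycle. By [c_no_off] that
    neighbour is not [c]. *)
Lemma off_touches_cyc x : x \in off cs -> exists z s,
  [/\ z \in cs, z != c, e z s, s \in off cs & connect (off_adj e X F cs) s x].
Proof.
move=> xoff; suff [z [s [zcs ezs soff con]]] : exists z s,
    [/\ z \in cs, e z s, s \in off cs & connect (off_adj e X F cs) s x].
  exists z, s; split=> //; apply/negP => /eqP zc; rewrite zc in zcs ezs.
  have := c_no_off zcs ezs; move: soff; rewrite in_off => /andP[sO scs].
  by rewrite inE sO => /(_ scs).
pose S := [set s in off cs | connect (off_adj e X F cs) s x].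
have Sx : x \in S by rewrite inE xoff /=.
have Scl s y : s \in S -> e s y -> y \in O -> y \notin cs -> y \in S.
  rewrite inE => /andP[soff con] esy yO ycs; rewrite inE in_off yO ycs; apply: connect_trans con; apply: connect1.
  by rewrite /off_adj /within soff in_off ycs yO (lh_sym lh).
have eoff y s : y \in cs -> s \in S -> e s y -> exists z s,
    [/\ z \in cs, e z s, s \in off cs & connect (off_adj e X F cs) s x].
  by rewrite inE => ycs /andP[soff con] esy; exists y, s; rewrite (lh_sym lh).
case: (set_0Vmem (S :&: X)) => [S0|[s0 s0S]].
  have xF : x \in F.
    move: (xoff); rewrite in_off => /andP[/setUP[xX|//] _].
    by have := in_set0 x; rewrite -S0 inE Sx xX.
  have [y yX exy] := lh_FX lh xF; case ycs : (y \in cs); first exact: eoff exy.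
  have yS : y \in S by apply: Scl exy _ _; rewrite ?X_O ?ycs.
  by have := in_set0 y; rewrite -S0 inE yS yX.
have SX : S :&: X \subset X by apply: subsetIr.
have Scs u : u \in S :&: X -> u \notin cs.
  by case/setIP; rewrite inE in_off => /andP[/andP[]].
have S0 : S :&: X != set0 by apply/set0Pn; exists s0.
have /ltnW/card_gt0P[y /setIP[/boundaryP[nyS [s /setIP[sS sX] esy]] yX]] := lh_X2 lh SX S0 (cyc_big cyc SX Scs).
case ycs : (y \in cs); first exact: eoff esy.
by case/negP: nyS; rewrite inE yX andbT; apply: Scl esy _ _; rewrite ?X_O ?ycs.
Qed.

(** If [w] is a vertex [y], then [{y, c}] would contain the whole boundary of a nonempty part of
    [O], against 3-connectivity. If [w] is a leg, some vertex of [O] exits to another leg and is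
    still reached from the cycle. *)
Lemma no_common_dom w :
  (forall z, z \in cs -> z != c -> domi cs w (inl z)) -> False.
Proof.
move=> dw; case: w => [y|i] in dw *.
  have [sz ucs _ Xcs] := and4P cyc.
  (* Outward paths never return to the cycle, so a vertex not in [off cs] dominates no cycle vertex
     other than [c] and itself. *)
  case yoff : (y \in off cs); last first.
    have [z1 [z1cs z1c z1y]] : exists z1, [/\ z1 \in cs, z1 != c & z1 != y].
      have : ~~ ([set x in cs] \subset [set c; y]).
        apply/negP => /subset_leq_card; rewrite cardsE (card_uniqP ucs) cards2.
        by case: (_ != _) => /= H; move: (leq_trans sz H).
      case/subsetPn => z1; rewrite !inE negb_or => z1cs /andP[z1c z1y].
      by exists z1.
    have [p pp pB] := live_cyc lh cyc sub third z1cs z1c.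
    have /domP/(_ p pp pB) := dw _ z1cs z1c.
    rewrite inE => /orP[/eqP[] E|]; first by rewrite E eqxx in z1y.
    have [l [i [-> _ al _]]] := outward_path pp pB.
    rewrite mem_rcons inE /= => /mapP[u ul [E]].
    by move: (allP al u ul) => /=; rewrite -E yoff.
  have yO : y \in O by move: yoff; rewrite in_off => /andP[].
  (* The cycle and all that lies strictly behind [y], without [c]. Domination by [y] passes along
     edges, so [S] can only be left towards [y] or [c]. *)
  pose S := [set z in cs | z != c] :|: [set x in off cs | [&& domi cs (inl y) (inl x), x != y & x != c]].
  have SO : S \subset O.
    apply/subsetP => x /setUP[|]; rewrite inE => /andP[]; last by rewrite in_off => /andP[].
    by move=> /(cyc_X cyc)/X_O.
  have S0 : S != set0.
    have : ~~ ([set x in cs] \subset [set c]).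
      apply/negP => /subset_leq_card; rewrite cardsE (card_uniqP ucs) cards1.
      by move/(leq_trans (ltnW sz)).
    case/subsetPn => x; rewrite !inE => xcs xc.
    by apply/set0Pn; exists x; rewrite !inE xcs xc.
  have := lh_G3 lh SO S0.
  suff /subset_leq_card H : boundary e S \subset [set y; c].
    move/leq_trans/(_ H); rewrite cards2; by case: (_ != _).
  apply/subsetP => n /boundaryP[nS [s sS esn]]; rewrite !inE.
  have [sO sc sy ds] : [/\ s \in O, s != c, s != y & domi cs (inl y) (inl s)].
    split; first exact: (subsetP SO).
    - by case/setUP: sS; rewrite inE => /andP[_] // /and3P[].
    - case/setUP: sS; rewrite inE => /andP[H]; last by case/and3P.
      by move=> _; apply: contraTneq yoff => <-; rewrite in_off H andbF.
    - by case/setUP: sS; rewrite inE => /andP[H]; [exact: dw | case/and3P].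
  have ys : inl y != inl s :> T + 'I_3 by apply: contra sy => /eqP[->].
  have nOT : n \in O :|: Th.
    case/setUP: (sO) => [sX|sF]; first exact: (lh_nbX lh) esn.
    by have := lh_nbF lh sF esn; rewrite !inE => /orP[->|->]; rewrite ?orbT.
  case/setUP: nOT => [nO|nT]; last by have [] := dom_Th ds ys sO esn nT.
  case: eqP => //= ny; apply: contraR nS => nc.
  case ncs : (n \in cs); apply/setUP; [left|right]; first by rewrite inE ncs.
  have noff : n \in off cs by rewrite in_off nO ncs.
  by rewrite inE noff nc (dom_off ds ys sO esn noff); case: eqP.
have [x xO [j ji exj]] := lh_conn lh i.
have dx_false : ~ domi cs (inr i) (inl x).
  move=> d; have [E] : inr i = inr j :> T + 'I_3 by apply: dom_exit d _ xO exj.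
  by rewrite E eqxx in ji.
case xcs : (x \in cs).
  have xc : x != c.
    apply/negP => /eqP xc; rewrite xc in xcs exj xO.
    have [t tT ect] := lh_Tex lh xO exj.
    have := c_no_off xcs ect (Th_ncs lh cyc tT); by rewrite inE tT orbT.
  exact: dx_false (dw x xcs xc).
have xoff : x \in off cs by rewrite in_off xO xcs.
have [z1 [s [zcs zc ezs soff /connectP[p pp Ex]]]] := off_touches_cyc xoff.
have ds : domi cs (inr i) (inl s) by apply: dom_off ezs soff => //; [exact: dw | rewrite X_O // (cyc_X cyc)].
apply: dx_false; rewrite Ex; elim: p s ds pp {Ex soff ezs} => //= u p IH s ds /andP[/and3P[soff uoff esu] pp].
apply: IH => //; apply: dom_off ds _ _ esu uoff => //.
by move: soff; rewrite in_off => /andP[].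
Qed.

(** The obstruction left by the half-turn argument; for any other length modulo 4 the two parity
    classes would merge. *)
Definition alternating w w' :=
  [/\ 5 < size cs, size cs = 2 %[mod 4],
      forall n, odd n -> z cs n != c,
      forall n, odd n -> domi cs w (inl (z cs n)) &
      forall n, ~~ odd n -> z cs n != c -> domi cs w' (inl (z cs n))].

Lemma size_cyc_gt0 : 0 < size cs.
Proof. by have [sz _ _ _] := and4P cyc; apply: leq_trans sz. Qed.

Lemma cnthP x : x \in cs -> exists2 n, n < size cs & z cs n = x.
Proof. by move=> xcs; exists (index x cs); rewrite ?index_mem // /cnth modn_small ?index_mem // nth_index. Qed.

Lemma alternating_no_dom w w' v : alternating w w' ->
  domi cs v w -> domi cs v w' -> False.
Proof.
move=> [_ _ _ dodd deven] d d'; apply: (@no_common_dom v) => x /cnthP[n _ <-] nc.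
case no : (odd n); first exact: dom_trans d (dodd _ no).
by apply: dom_trans d' (deven _ _ nc); rewrite no.
Qed.

(** Dominators of a live vertex are comparable, and the outer one of [w] and [w'] would dominate the
    whole cycle. *)
Lemma alternating_excl w w' v : alternating w w' -> live (outward cs) legs_set v ->
  domi cs w v -> domi cs w' v -> False.
Proof.
move=> alt lv dw dw'; have [d|d] := dom_comparable lv dw dw'.
  exact: alternating_no_dom alt (dom_refl _ _ _) d.
exact: alternating_no_dom alt d (dom_refl _ _ _).
Qed.

(** If the length is odd or divisible by 4, half-turns connect all indices, and [common_dominator]
    contradicts [no_common_dom]. Otherwise it gives one dominator for each parity. *)
Lemma alternating_exists : (forall n, 0 < n < size cs -> z cs n != c) ->
  ~ leg_bead e X F ex -> exists w w', alternating w w'.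
Proof.
move=> cfirst nb.
have [s [s0 El step H1 H2]] := codom_indices lh cyc sub third cfirst nb.
have [sz ucs _ _] := and4P cyc.
have zcs m : z cs m \in cs by apply: cnth_mem; exact: size_cyc_gt0.
have lz n : 0 < n < size cs -> live (outward cs) legs_set (inl (z cs n)).
  by move=> nl; apply: (live_cyc lh cyc sub third) => //; exact: cfirst.
have bad : size cs = 2 * s + 1 \/ odd s -> False.
  move=> Hs; pose P := [pred v : T + 'I_3 | if v is inl x then (x \in cs) && (x != c) else false].
  have [|v|w [_ dw]] := @common_dominator _ (outward cs) legs_set P (inl (z cs 1)).
  - by apply: lz; rewrite (ltnW sz).
  - case: v => // x /andP[/cnthP[n nl <-] nc]; case: (posnP n) => [n0|n0].
      (* Index 0, left out of the rotation lemmas, is tied to index [s] by a single step. *)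
      rewrite n0; apply: (@codom_trans _ _ _ (inl (z cs s))).
      + by apply: lz; lia.
      + by apply: H1; lia.
      + by apply: codom_sym; exact: (step 0).
    by apply: H1; rewrite ?n0.
  - by apply: (@no_common_dom w) => x xcs xc; apply: dw; rewrite inE xcs.
have El2 : size cs = 2 * s + 2 by case: El => // E; case: bad; left.
have so : ~~ odd s by apply/negP => so; apply: bad; right.
have par n : odd (n %% size cs) = odd n.
  rewrite [in RHS](divn_eq n (size cs)) oddD oddM El2.
  by rewrite (_ : odd (2 * s + 2) = false) ?andbF //; lia.
have dom_class r : 0 < r <= 2 -> exists w, forall n, odd n = odd r -> z cs n != c ->
    domi cs w (inl (z cs n)).
  move=> r12; pose P := [pred v : T + 'I_3 | if v is inl x then [exists n : 'I_(size cs), (odd n == odd r) && (z cs n == x) && (x != c)] else false].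
  have [|v|w [_ dw]] := @common_dominator _ (outward cs) legs_set P (inl (z cs r)).
  - by apply: lz; lia.
  - case: v => // x /existsP[n /andP[/andP[/eqP nr /eqP <-] nc]].
    case: (posnP n) => [n0|n0]; last by apply: (H2 El2 so) => //; rewrite n0 /=.
    rewrite n0 in nr nc *; apply: (@codom_trans _ _ _ (inl (z cs s))).
    + by apply: lz; lia.
    + by apply: (H2 El2 so) => //; [lia | rewrite -nr; apply/negbTE].
    + by apply: codom_sym; exact: (step 0).
  - exists w => n nr nc; apply: dw; rewrite inE; apply/existsP.
    have nl : n %% size cs < size cs by rewrite ltn_mod size_cyc_gt0.
    exists (Ordinal nl); rewrite /= cnth_mod eqxx nc !andbT -nr.
    by rewrite par eqxx.
have [w dw] := dom_class 1 isT; have [w' dw'] := dom_class 2 isT.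
have oddc n : odd n -> z cs n != c.
  move=> no; have := cfirst (n %% size cs); rewrite cnth_mod; apply.
  by rewrite ltn_mod size_cyc_gt0 andbT; move: (par n); lia.
exists w, w'; split.
- by lia.
- by lia.
- exact: oddc.
- by move=> n no; apply: dw; rewrite ?no //; exact: oddc.
- by move=> n no nc; apply: dw' => //; rewrite (negPf no).
Qed.

End Fixed.
End Bad.

Lemma split_tail (T : Type) (P : pred T) s : exists L r,
  [/\ s = L ++ r, all (predC P) r & L = [::] \/ exists L' l, L = rcons L' l /\ P l].
Proof.
elim/last_ind: s => [|s x [L [r [-> ar HL]]]]; first by exists [::], [::]; split=> //; left.
case Px: (P x).
  by exists (rcons (L ++ r) x), [::]; rewrite cats0; split=> //; right; exists (L ++ r), x.
by exists L, (rcons r x); rewrite rcons_cat all_rcons /= Px.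
Qed.

Lemma split_head (T : Type) (P : pred T) s : exists r R,
  [/\ s = r ++ R, all (predC P) r & R = [::] \/ exists h R', R = h :: R' /\ P h].
Proof.
elim: s => [|x s [r [R [-> ar HR]]]]; first by exists [::], [::]; split=> //; left.
case Px: (P x).
  by exists [::], (x :: r ++ R); split=> //; right; exists x, (r ++ R).
by exists (x :: r), R; rewrite /= Px.
Qed.

Lemma perm_move_arc (T : eqType) (A B1 B2 : seq T) x t :
  perm_eq (A ++ x :: B1 ++ t :: B2) ((A ++ [:: x] ++ t :: B2) ++ B1).
Proof. by rewrite -[x :: B1 ++ _]cat1s -!catA !perm_cat2l perm_catC. Qed.

(** * Ears behind the dominator of the odd vertices *)

Section Ears.
Variables (T : finType) (e : rel T) (X F Th : {set T})
  (ex : T -> 'I_3 -> bool) (c : T).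
Hypothesis lh : local_hyp e X F Th ex c.
Local Notation O := (X :|: F).
Local Notation off := (off X F).
Local Notation outward := (outward e X F ex).
Local Notation legs_set := (legs_set T).
Local Notation domi cs := (dom (outward cs) legs_set).
Local Notation z cs := (cnth c cs).
Variables (cs : seq T) (w w' : T + 'I_3).
Hypotheses (good : good_cyc e X F Th ex c cs)
  (alt : alternating e X F ex c cs w w')
  (c_free : c \in off cs -> ~~ domi cs w (inl c)).

Let cyc : is_cyc e X cs. Proof. by case: good. Qed.
Let sub : off cs \subset exiting e X F ex cs. Proof. by case: good. Qed.
Let third : forall z, z \in cs -> z != c ->
        exists2 y, e z y & (y \in Th) || (y \in off cs).
Proof. by case: good. Qed.

(** The vertices off the cycle that lie strictly behind [w], seen from the legs. They belong to [X],
    and [c_free] keeps [c] out, so their edges end in [O] or [Th]. *)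
Definition behind : {set T} := [set x in off cs | domi cs w (inl x) && (inl x != w)].
Local Notation U := behind.

(** By [odd_endE] these are the cycle vertices of odd index. *)
Definition odd_end x := [&& x \in cs, x != c & domi cs w (inl x)].

Lemma behindP x : reflect [/\ x \in off cs, domi cs w (inl x) & w != inl x] (x \in U).
Proof.
rewrite [x \in U]in_set; apply: (iffP andP) => [[-> /andP[-> H]]|[-> -> H]];
  by split=> //=; rewrite eq_sym.
Qed.

(** A fringe vertex exits to two legs, hence only itself dominates it. *)
Lemma behind_X x : x \in U -> x \in X.
Proof.
case/behindP=> xoff dx wx; move: (xoff); rewrite in_off => /andP[xO _].
case/setUP: (xO) => // xF; have [i [j [ij exi exj]]] := lh_exF lh xF.
have := dom_exit dx wx xO exi; rewrite (dom_exit dx wx xO exj) => -[E].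
by rewrite E eqxx in ij.
Qed.

Lemma behind_c x : x \in U -> x != c.
Proof.
by case/behindP=> xoff dx _; apply/negP => /eqP xc; move: (c_free); rewrite -xc => /(_ xoff); rewrite dx.
Qed.

Lemma behind_ncs x : x \in U -> x \notin cs.
Proof. by case/behindP; rewrite in_off => /andP[]. Qed.

(** The vertex [x] is live, and outward paths from it do not return to the cycle. *)
Lemma dom_cs y x : y \in cs -> x \in cs -> x != c -> domi cs (inl y) (inl x) -> x = y.
Proof.
move=> ycs xcs xc d; have [p pp pB] := live_cyc lh cyc sub third xcs xc.
have := domP _ _ _ _ d p pp pB; rewrite inE => /orP[/eqP[]//|].
have [l [i [-> _ al _]]] := outward_path pp pB.
rewrite mem_rcons inE /= => /mapP[u ul [E]].
by move: (allP al u ul) => /=; rewrite -E in_off ycs andbF.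
Qed.

Lemma cnth_inj n m : n < size cs -> m < size cs -> z cs n = z cs m -> n = m.
Proof.
move=> nl ml; have [_ ucs _ _] := and4P cyc.
by rewrite /cnth !modn_small // => /eqP; rewrite nth_uniq // => /eqP.
Qed.

Lemma cnth_cs n : z cs n \in cs.
Proof. by apply: cnth_mem; apply: size_cyc_gt0 good. Qed.

Lemma w_ncs y : y \in cs -> w != inl y.
Proof.
case: alt => sz _ oc od _ ycs; apply/negP => /eqP E.
have H n : odd n -> z cs n = y.
  by move=> no; apply: dom_cs ycs (cnth_cs n) (oc _ no) _; rewrite -E; exact: od.
by have : 1 = 3 by apply: cnth_inj; rewrite ?H //; lia.
Qed.

(** At most one of the indices 0, 2 and 4 carries [c]; the other two would carry the same vertex
    [y]. *)
Lemma w'_ncs y : y \in cs -> w' != inl y.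
Proof.
case: alt => sz _ oc _ od ycs; apply/negP => /eqP E.
have H n : ~~ odd n -> z cs n != c -> z cs n = y.
  by move=> no nc; apply: (dom_cs ycs (cnth_cs n) nc); rewrite -E; exact: od.
have H2 n : z cs n = c -> forall m, m < size cs -> n < size cs -> m != n -> ~~ odd m -> z cs m = y.
  move=> nc m ml nl mn mo; apply: H => //; apply: contra mn => /eqP mc.
  by apply/eqP; apply: cnth_inj; rewrite // mc nc.
case c0 : (z cs 0 == c).
  have y2 : z cs 2 = y by apply: (H2 0) => //; [exact/eqP | lia | lia].
  have y4 : z cs 4 = y by apply: (H2 0) => //; [exact/eqP | lia | lia].
  have : 2 = 4 by apply: cnth_inj; rewrite ?y2 ?y4 //; lia.
  by [].
have y0 : z cs 0 = y by apply: H; rewrite ?c0.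
case c2 : (z cs 2 == c).
  have y4 : z cs 4 = y by apply: (H2 2) => //; [exact/eqP | lia | lia].
  have : 0 = 4 by apply: cnth_inj; rewrite ?y0 ?y4 //; lia.
  by [].
have y2 : z cs 2 = y by apply: H; rewrite ?c2.
have : 0 = 2 by apply: cnth_inj; rewrite ?y0 ?y2 //; lia.
by [].
Qed.

Lemma odd_endE n : odd_end (z cs n) = odd n.
Proof.
case: (alt) => _ _ oc od ed; rewrite /odd_end cnth_cs /=.
case no : (odd n); first by rewrite oc ?od.
apply/negbTE; rewrite negb_and negbK; case: eqP => //= /eqP nc.
apply/negP => d; apply: (alternating_excl lh good alt) d (ed _ _ nc); last by rewrite no.
exact: (live_cyc lh cyc sub third (cnth_cs n) nc).
Qed.

(** Domination by [w] passes to neighbours off the cycle and to legs. A neighbour at an even index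
    is not possible: its dominator [w'] would also dominate [x], against [alternating_excl]. *)
Lemma behind_nbr x y : x \in U -> e x y ->
  [\/ y \in U, inl y = w /\ y \in off cs, odd_end y | y \in Th /\ exists2 i, w = inr i & ex x i].
Proof.
move=> xU exy; have xX := behind_X xU; have xc := behind_c xU.
have /behindP[xoff dx wx] := xU; have xO : x \in O by rewrite X_O.
have := lh_nbX lh xX xc exy => /setUP[yO|yT]; last first.
  by constructor 4; split=> //; exact: (dom_Th lh dx wx xO exy yT).
case ycs : (y \in cs); last first.
  have yoff : y \in off cs by rewrite in_off yO ycs.
  case: (w =P inl y) => [->|/eqP wy]; first by constructor 2.
  by constructor 1; apply/behindP; split=> //; exact: dom_off dx wx xO exy yoff.
constructor 3; have yc : y != c.
  apply/negP => /eqP yc; rewrite yc (lh_sym lh) in exy ycs.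
  by have := c_no_off lh good ycs exy (behind_ncs xU); rewrite inE xO.
have [n nl En] := cnthP c ycs; rewrite -En odd_endE; apply: contraT => no.
have [_ _ _ _ ed] := alt; exfalso.
have lx := live_off sub xoff.
apply: (alternating_excl lh good alt lx dx).
have dy := ed n no; rewrite En in dy.
by apply: dom_off (dy yc) (w'_ncs ycs) (X_O _ (cyc_X cyc ycs)) _ xoff; rewrite (lh_sym lh).
Qed.

Implicit Types rs : seq T.

(** Direct access to the dominator; when [w] is a leg, this is an exit to it. *)
Definition hub x := outward cs (inl x) w.
Definition hub_side rs : {set T} := reach e hub (U :\: [set x in rs]).
Definition hubbed rs (r : T) := hub r || [exists y in hub_side rs, e r y].

Definition ear zi rs zj :=
  [/\ odd_end zi, odd_end zj, zi != zj, path e zi (rcons rs zj) &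
      [/\ uniq rs, {subset rs <= U} & rs != [::]]].

Lemma in_freshU rs x : (x \in U :\: [set x in rs]) = (x \in U) && (x \notin rs).
Proof. by rewrite in_setD [x \in [set _ in _]]in_set andbC. Qed.

Lemma hub_side_rev rs : hub_side (rev rs) = hub_side rs.
Proof.
by rewrite /hub_side; congr (reach e hub (U :\: _)); apply/setP => x; rewrite !inE mem_rev.
Qed.

Lemma hubbed_rev rs r : hubbed (rev rs) r = hubbed rs r.
Proof. by rewrite /hubbed hub_side_rev. Qed.

Lemma ear_rev zi rs zj : ear zi rs zj -> ear zj (rev rs) zi.
Proof.
case=> oi oj ij pr [u su n0]; split=> //; first by rewrite eq_sym.
  by rewrite (path_rev_sym (lh_sym lh)).
split; first by rewrite rev_uniq.
  by move=> x; rewrite mem_rev; exact: su.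
by rewrite -size_eq0 size_rev size_eq0.
Qed.

(** An outward path from [x] to the legs meets [w], and up to then it stays strictly behind [w]. *)
Lemma behind_reach x : x \in U -> x \in reach e hub U.
Proof.
move=> xU; have /behindP[xoff _ _] := xU.
have [p] := live_off sub xoff; elim: p x xU {xoff} => [|v p IH] x xU.
  by rewrite mem_legs.
have /behindP[xoff dx wx] := xU.
move=> /= /andP[gxv pp] lB; have [wv|wv] := eqVneq v w.
  by apply: reach_base => //; rewrite /hub -wv.
have dv : domi cs w v by apply: dom_step gxv dx _; rewrite eq_sym.
case: v => [y|i] in gxv pp lB wv dv *.
  have yU : y \in U.
    by apply/behindP; split; rewrite 1?eq_sym //; case/and3P: gxv.
  by apply: reach_step (IH _ yU pp lB) _ => //; case/and3P: gxv.
have E : w = inr i by apply: dom_target dv; rewrite mem_legs.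
by rewrite E eqxx in wv.
Qed.

Lemma ear_hubbed zi rs zj : ear zi rs zj -> exists2 m, m \in rs & hubbed rs m.
Proof.
case=> _ _ _ _ [_ su]; case: rs su => // r rs su _.
have rU : r \in U by apply: su; rewrite mem_head.
pose Q x := x \in hub_side (r :: rs) \/ exists2 m, m \in r :: rs & hubbed (r :: rs) m.
suff: Q r.
  by case=> // /reach_in; rewrite in_freshU mem_head andbF.
apply: (@reach_ind _ e hub U Q _ _ r (behind_reach rU)) => [x xU hx|x y xU _ [yN|Hm] exy]; last by right.
  case xr : (x \in r :: rs); first by right; exists x; rewrite // /hubbed hx.
  by left; apply: reach_base => //; rewrite in_freshU xU xr.
case xr : (x \in r :: rs).
  right; exists x; rewrite // /hubbed; apply/orP; right; apply/exists_inP.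
  by exists y.
by left; apply: reach_step yN exy; rewrite in_freshU xU xr.
Qed.

(** As for cycles: the hub side survives because the new ear avoids it, and the freed vertex [m]
    joins it. *)
Lemma ear_grow zi rs zj zi' rs' zj' m : ear zi rs zj -> ear zi' rs' zj' ->
  {in rs', forall x, x \notin hub_side rs} -> m \in rs -> m \notin rs' ->
  hubbed rs m -> #|hub_side rs| < #|hub_side rs'|.
Proof.
move=> [_ _ _ _ [_ su _]] [_ _ _ _ [_ su' _]] fresh mrs mrs' hm.
have sub' : hub_side rs \subset U :\: [set x in rs'].
  apply/subsetP => x xN; have := reach_in xN; rewrite !in_freshU => /andP[-> _].
  by apply/negP => /fresh; rewrite xN.
have mf : m \in U :\: [set x in rs'] by rewrite in_freshU mrs' su.
apply: proper_card; apply/properP; split; first exact: reach_sub.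
exists m; last by apply/negP => /reach_in; rewrite in_freshU mrs andbF.
case/orP: hm => [hm|/exists_inP[y yN emy]]; first exact: reach_base.
by apply: reach_step emy; rewrite ?(subsetP (reach_sub sub')).
Qed.

Definition growing rs := exists zi' rs' zj', ear zi' rs' zj' /\ #|hub_side rs| < #|hub_side rs'|.

Definition fresh_path rs (r : seq T) :=
  [/\ uniq r, {subset r <= U}, {in r, forall x, x \notin rs} & {in r, forall x, x \notin hub_side rs}].

Lemma fresh_uniq (rs S1 r S2 : seq T) : uniq rs -> subseq (S1 ++ S2) rs -> fresh_path rs r ->
  {subset rs <= U} ->
  [/\ uniq (S1 ++ r ++ S2), {subset S1 ++ r ++ S2 <= U} &
      {in S1 ++ r ++ S2, forall x, x \notin hub_side rs}].
Proof.
move=> urs ss [ur rU rrs rN] su.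
have H x : x \in S1 ++ r ++ S2 -> x \in r \/ x \in rs.
  rewrite !mem_cat orbCA => /orP[->|xS]; first by left.
  by right; apply: (mem_subseq ss); rewrite mem_cat.
split.
- rewrite (perm_uniq (s2 := r ++ (S1 ++ S2))); last first.
    by apply/permP => P; rewrite !count_cat; lia.
  rewrite cat_uniq ur (subseq_uniq ss urs) andbT; apply/hasPn => x /(mem_subseq ss) xrs.
  by apply/negP => /rrs; rewrite xrs.
- by move=> x /H[/rU|/su].
- move=> x /H[/rN//|xrs]; apply/negP => /reach_in.
  by rewrite in_freshU xrs andbF.
Qed.

(** The detour [r] bypasses [B1], which frees [m]. *)
Lemma reroute_skip zi zj A re B1 t B2 r m :
  let rs := A ++ re :: B1 ++ t :: B2 in
  ear zi rs zj -> fresh_path rs r -> path e re (rcons r t) ->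
  m \in B1 -> hubbed rs m -> growing rs.
Proof.
move=> rs er fr pr mB hm; have [oi oj ij p [u su n0]] := er.
pose rs' := (A ++ [:: re]) ++ r ++ t :: B2.
have ss : subseq ((A ++ [:: re]) ++ t :: B2) rs.
  by rewrite -catA; apply: cat_subseq => //=; rewrite eqxx; exact: suffix_subseq.
have [u' su' N'] := fresh_uniq u ss fr su.
have er' : ear zi rs' zj.
  split=> //; last by split=> //; rewrite /rs'; case: (A).
  move: p pr; rewrite /rs /rs' -catA /= !rcons_cat !cat_path /= !rcons_cat !cat_path /=.
  rewrite !rcons_path => /and5P[-> -> _ _ ->] /andP[-> ->] //.
exists zi, rs', zj; split=> //; apply: ear_grow er er' N' _ _ hm.
  by rewrite mem_cat inE mem_cat mB !orbT.
move: u; rewrite /rs (perm_uniq (perm_move_arc _ _ _ _ _)).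
rewrite cat_uniq => /and3P[_ /hasPn/(_ _ mB) /= H _].
apply/negP; rewrite /rs' !mem_cat orbCA => /orP[mr|mS]; last first.
  by case/negP: H; move: mS; rewrite !mem_cat -!orbA.
by case: fr => _ _ /(_ _ mr); rewrite mem_cat inE mem_cat mB !orbT.
Qed.

(** The ear is cut after [re] and led to another odd vertex [t]; the abandoned end contains [m]. *)
Lemma reroute_end zi zj A re B t r m :
  let rs := A ++ re :: B in
  ear zi rs zj -> fresh_path rs r -> path e re (rcons r t) -> odd_end t -> t != zi ->
  m \in B -> hubbed rs m -> growing rs.
Proof.
move=> rs er fr pr ot tzi mB hm; have [oi oj ij p [u su n0]] := er.
pose rs' := (A ++ [:: re]) ++ r ++ [::].
have ss : subseq ((A ++ [:: re]) ++ [::]) rs.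
  by rewrite cats0; apply: cat_subseq => //=; rewrite eqxx sub0seq.
have [u' su' N'] := fresh_uniq u ss fr su.
have er' : ear zi rs' t.
  split=> //; first by rewrite eq_sym.
    move: p pr; rewrite /rs /rs' cats0 -catA /= !rcons_cat !cat_path /=.
    by case/and3P=> -> -> _ ->.
  by split=> //; rewrite /rs'; case: (A).
exists zi, rs', t; split=> //; apply: ear_grow er er' N' _ _ hm.
  by rewrite mem_cat inE mB !orbT.
move: u; rewrite /rs -cat_rcons -cats1.
rewrite cat_uniq => /and3P[_ /hasPn/(_ _ mB) /= H _].
apply/negP; rewrite /rs' cats0 mem_cat => /orP[mS|mr]; first by rewrite mS in H.
by case: fr => _ _ /(_ _ mr); rewrite mem_cat inE mB !orbT.
Qed.

Lemma fresh_rev rs r : fresh_path rs r -> fresh_path (rev rs) r.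
Proof.
case=> ur rU rrs rN; split=> // x xr; first by rewrite mem_rev rrs.
by rewrite hub_side_rev rN.
Qed.

Lemma growing_rev rs : growing (rev rs) -> growing rs.
Proof. by case=> zi [rs' [zj []]]; rewrite hub_side_rev; exists zi, rs', zj. Qed.

Lemma odd_end_off1 t x y : odd_end t -> e t x -> e t y -> x \notin cs -> y \notin cs -> x = y.
Proof. by case/and3P=> tcs _ _; exact: (cyc_off1 lh cyc tcs). Qed.

(* By 3-connectivity a maximal run of vertices of the ear without access to the
   hub, together with what hangs from it, has a third neighbour [t]; rerouting
   through [t] frees a vertex with access. *)
Lemma unhubbed_growing zi rs zj r0 : ear zi rs zj -> r0 \in rs -> ~~ hubbed rs r0 ->
  growing rs.
Proof.
move=> er r0rs nh; have [oi oj ij pr [u su _]] := er.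
have {r0rs} [s1 [s2 Es]] : exists s1 s2, rs = s1 ++ r0 :: s2.
  by case/splitPr: r0rs => s1 s2; exists s1, s2.
have [L [run1 [E1 a1 HL]]] := split_tail (hubbed rs) s1.
have [run2 [Rt [E2 a2 HR]]] := split_head (hubbed rs) s2.
pose run := run1 ++ r0 :: run2.
have Ers : rs = L ++ run ++ Rt by rewrite Es E1 E2 /run -!catA.
have r0run : r0 \in run by rewrite mem_cat mem_head orbT.
have arun x : x \in run -> ~~ hubbed rs x.
  by rewrite mem_cat inE => /or3P[/(allP a1)|/eqP->|/(allP a2)].
clearbody run.
(* The two vertices that enclose the run on the ear, possibly the ends of the ear. *)
pose ra := last zi L; pose rb := head zj Rt.
(* The run and everything behind [w] that is neither on the ear nor on the hub side; [Y] below is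
   the component of [r0] in it. *)
pose zone := [set x in U | (x \in run) || (x \notin rs) && (x \notin hub_side rs)].
have runrs x : x \in run -> x \in rs by rewrite Ers !mem_cat => ->; rewrite orbT.
have zoneP x : reflect (x \in U /\ (x \in run \/ x \notin rs /\ x \notin hub_side rs)) (x \in zone).
  rewrite [x \in zone]in_set; apply: (iffP andP) => -[xU H]; split=> //.
    by case/orP: H => [|/andP[]]; [left | right].
  by case: H => [->//|[-> ->]]; rewrite orbT.
pose Y := [set y | connect (within e zone) r0 y].
have r0z : r0 \in zone by apply/zoneP; split; [apply: su; exact: runrs | left].
have Yz y : y \in Y -> y \in zone.
  rewrite inE => /connectP[p pp ->]; case/lastP: p pp => // p v pp.
  by have /andP[_ /allP H] := within_path pp; rewrite last_rcons; apply: H; rewrite mem_rcons mem_head.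
have YO : Y \subset O.
  by apply/subsetP => y /Yz/zoneP[/behind_X yX _]; rewrite X_O.
have Y0 : Y != set0 by apply/set0Pn; exists r0; rewrite inE.
(* [Y] has three boundary vertices, so one of them is neither [ra] nor [rb]. *)
have [t tb tab] : exists2 t, t \in boundary e Y & t \notin [set ra; rb].
  apply/subsetPn/negP => /subset_leq_card /(leq_trans (lh_G3 lh YO Y0)).
  by rewrite cards2; case: (_ != _).
have {tb} /boundaryP[tY [y yY eyt]] := tb.
move: tab; rewrite !inE negb_or => /andP[ta tb].
have tz : t \notin zone.
  have yz := Yz _ yY; apply: contra tY => tz; move: yY; rewrite !inE => c0.
  by apply: connect_trans c0 (connect1 _); rewrite /within yz tz.
have noN x v : x \in zone -> v \in hub_side rs -> e x v -> False.
  case/zoneP=> xU [xr|[xrs xN]] vN exv.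
    case/negP: (arun _ xr); rewrite /hubbed; apply/orP; right; apply/exists_inP.
    by exists v.
  by case/negP: xN; apply: reach_step vN exv; rewrite in_freshU xU xrs.
have nohub x : x \in zone -> hub x -> False.
  case/zoneP=> xU [xr|[xrs xN]] hx.
    by case/negP: (arun _ xr); rewrite /hubbed hx.
  by case/negP: xN; apply: reach_base => //; rewrite in_freshU xU xrs.
have [yU _] := zoneP _ (Yz _ yY).
have {tz tY} Ht : (t \in rs /\ t \notin run) \/ odd_end t.
  have yO : y \in O by rewrite X_O // behind_X.
  have [tU|[tw toff]|ot|[_ [i wi exi]]] := behind_nbr yU eyt; [left| |by right|].
  - have trun : t \notin run by apply: contra tz => tr; apply/zoneP; split=> //; left.
    split=> //; apply: contraR tz => trs; apply/zoneP; split=> //; right; split=> //.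
    by apply/negP => tN; exact: noN (Yz _ yY) tN eyt.
  - by case: (nohub _ (Yz _ yY)); rewrite /hub -tw /= yO eyt toff.
  - by case: (nohub _ (Yz _ yY)); rewrite /hub wi /= yO.
have [re [r [rerun fr prt]]] : exists re r, [/\ re \in run, fresh_path rs r &
    path e re (rcons r t)].
  move: (yY); rewrite inE => /connectP[p0 pp0 Ey]; move: Ey.
  have [p pp up _] := shortenP pp0 => Ey.
  have [q [r [Ep Lq ar]]] : exists q r, [/\ p = q ++ r, last r0 q \in run & all (predC (mem run)) r].
    by apply: (@split_last _ (mem run)); apply/hasP; exists r0; rewrite ?mem_head.
  exists (last r0 q), r; split=> //.
    move: up pp; rewrite Ep cons_uniq cat_uniq cat_path => /and3P[_ _ /andP[_ ur]] /andP[_ pr'].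
    have rz x : x \in r -> x \in zone /\ x \notin run.
      by move=> xr; split; [have /andP[_ /allP H] := within_path pr'; exact: H | exact: (allP ar)].
    split=> // x /rz[/zoneP[xU H] xn] //; first by case: H => [H|[]] //; rewrite H in xn.
    by case: H => [H|[]] //; rewrite H in xn.
  rewrite rcons_path; move: Ey pp; rewrite Ep last_cat cat_path => <- /andP[_ /within_path/andP[-> _]].
  by [].
have [c1 [c2 Erun]] : exists c1 c2, run = c1 ++ re :: c2.
  by case/splitPr: rerun => c1 c2; exists c1, c2.
have Ers' : rs = (L ++ c1) ++ re :: c2 ++ Rt by rewrite Ers Erun -!catA.
have Erev : rev rs = (rev Rt ++ rev c2) ++ re :: rev c1 ++ rev L.
  by rewrite Ers' !(rev_cat, rev_cons) -!cats1 -!catA.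
(* If [t] is on the ear, the run does not extend to it: by maximality the vertex next to the run on
   that side is hubbed, and it lies strictly between the run and [t]. *)
case: Ht => [[trs trun]|ot].
  have : t \in L ++ run ++ Rt by rewrite -Ers.
  rewrite !mem_cat (negPf trun) /= => /orP[tL|tR].
  - case: HL => [L0|[L' [l [EL hl]]]]; first by rewrite L0 in tL.
    have tL' : t \in rev L'.
      by move: tL ta; rewrite /ra EL mem_rcons inE last_rcons mem_rev => /orP[->|->].
    have [B' [B2 EB]] : exists B' B2, rev L' = B' ++ t :: B2.
      by case/splitPr: tL' => B' B2; exists B', B2.
    have Erev' : rev rs = (rev Rt ++ rev c2) ++ re :: (rev c1 ++ l :: B') ++ t :: B2.
      by rewrite Erev EL rev_rcons EB -[(rev c1 ++ _) ++ _]catA.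
    apply: growing_rev; rewrite Erev'; apply: (@reroute_skip zj zi _ _ _ _ _ r l).
    + by rewrite -Erev'; exact: ear_rev er.
    + by rewrite -Erev'; exact: fresh_rev.
    + exact: prt.
    + by rewrite mem_cat mem_head orbT.
    + by rewrite -Erev' hubbed_rev.
  - case: HR => [R0|[h [R' [ER hh]]]]; first by rewrite R0 in tR.
    have tR' : t \in R' by move: tR tb; rewrite /rb ER inE /= => /orP[->|->].
    have [B' [B2 EB]] : exists B' B2, R' = B' ++ t :: B2.
      by case/splitPr: tR' => B' B2; exists B', B2.
    have Ers2 : rs = (L ++ c1) ++ re :: (c2 ++ h :: B') ++ t :: B2.
      by rewrite Ers' ER EB -[(c2 ++ _) ++ _]catA.
    rewrite Ers2; apply: (@reroute_skip zi zj _ _ _ _ _ r h); rewrite -?Ers2 //.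
    by rewrite mem_cat mem_head orbT.
have ety : e t y by rewrite (lh_sym lh).
have yrun : y \in rs -> y \in run.
  by move=> yrs; have [_ [//|[]]] := zoneP _ (Yz _ yY); rewrite yrs.
(* The only edge of [t] off the cycle goes to [y]. Were [t] an end of the ear, the ear vertex next
   to it would be [y], which lies in the run, and so [t] would be [ra] or [rb]. *)
have tzi : t != zi.
  apply: contraNneq ta => tzi; rewrite /ra.
  case: (L) Ers => [|f L0] Ers0 /=; first by rewrite tzi.
  have frs : f \in rs by rewrite Ers0 mem_head.
  have ezf : e t f by move: pr; rewrite Ers0 tzi /= => /andP[].
  have yf := odd_end_off1 ot ety ezf (behind_ncs yU) (behind_ncs (su _ frs)).
  move: u (yrun); rewrite yf frs Ers0 /= !mem_cat => /andP[/norP[_ /norP[fr' _]] _].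
  by move=> /(_ isT); rewrite (negPf fr').
have tzj : t != zj.
  apply: contraNneq tb => tzj; rewrite /rb.
  case: (Rt) Ers => [|h R0] Ers0 /=; first by rewrite tzj.
  have [R1 [f Ef]] : exists R1 f, h :: R0 = rcons R1 f.
    by exists (belast h R0), (last h R0); rewrite -lastI.
  have frs : f \in rs by rewrite Ers0 Ef !mem_cat mem_rcons mem_head !orbT.
  have ezf : e t f.
    by move: pr; rewrite Ers0 Ef tzj !rcons_path !last_cat last_rcons (lh_sym lh) => /andP[].
  have yf := odd_end_off1 ot ety ezf (behind_ncs yU) (behind_ncs (su _ frs)).
  move: u (yrun); rewrite yf frs Ers0 Ef !cat_uniq => /and3P[_ _ /and3P[_ /hasPn H _]].
  move=> /(_ isT) frun; have := H f; rewrite mem_rcons mem_head => /(_ isT) /=.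
  by rewrite frun.
(* Some ear vertex is hubbed. It lies on one side of the run, and that side is given up for the way
   to [t]. *)
have [m mrs hm] := ear_hubbed er.
have mrun : m \notin run by apply: contraL hm => /arun.
have : m \in L ++ run ++ Rt by rewrite -Ers.
rewrite !mem_cat (negPf mrun) /= => /orP[mL|mR]; last first.
  rewrite Ers'; apply: (@reroute_end zi zj _ _ _ t r m); rewrite -?Ers' //.
  by rewrite mem_cat mR orbT.
apply: growing_rev; rewrite Erev; apply: (@reroute_end zj zi _ _ _ t r m); rewrite -?Erev ?hubbed_rev //.
- exact: ear_rev er.
- exact: fresh_rev.
- by rewrite mem_cat !mem_rev mL orbT.
Qed.

Lemma max_ear zi rs zj : ear zi rs zj ->
  exists zi rs zj, ear zi rs zj /\ {in rs, forall r, hubbed rs r}.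
Proof.
have [n] := ubnP (#|U| - #|hub_side rs|); elim: n zi rs zj => // n IH zi rs zj lt er.
case: (boolP (all (hubbed rs) rs)) => [/allP al|/allPn[r0 r0rs nh]].
  by exists zi, rs, zj.
have [zi' [rs' [zj' [er' lt']]]] := unhubbed_growing er r0rs nh.
apply: (IH zi' rs' zj') => //.
have : #|hub_side rs'| <= #|U|.
  by apply: subset_leq_card; apply/subsetP => x /reach_in; rewrite in_freshU => /andP[].
by move: lt; rewrite ltnS; lia.
Qed.

Lemma ear_exists_from (S : {set T}) : S \subset U ->
  (forall x y, x \in S -> y \in S -> connect (within e S) x y) ->
  1 < #|[set t in boundary e S | odd_end t]| -> exists zi rs zj, ear zi rs zj.
Proof.
move=> SU Scon /card_gt1P[n1 [n2 []]]; rewrite !in_set.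
move=> /andP[/andP[n1S /exists_inP[s1 s1S e1]] o1] /andP[/andP[n2S /exists_inP[s2 s2S e2]] o2] n12.
have /connectP[p0 pp0 E0] := Scon _ _ s1S s2S; move: E0.
have [p pp up _] := shortenP pp0 => E; have /andP[pe /allP pS] := within_path pp.
exists n1, (s1 :: p), n2; split=> //.
  by rewrite /= rcons_path (lh_sym lh) e1 pe -E.
split=> // x; rewrite inE => /orP[/eqP->|/pS]; exact: (subsetP SU).
Qed.

(** If an odd vertex has a neighbour behind [w], the component of that neighbour behind [w] has two
    odd vertices on its boundary, which gives an ear. Otherwise the third edge of each odd vertex
    leads to [w] itself, and [w] cannot be a vertex for reasons of degree. *)
Lemma ear_or_direct : (exists zi rs zj, ear zi rs zj) \/
  exists2 i, w = inr i & forall n, odd n -> ex (z cs n) i.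
Proof.
have [sz _ oc od _] := alt.
case: (boolP [exists x in U, exists t, odd_end t && e t x]) => [/exists_inP[u uU /existsP[t0 /andP[ot0 etu]]]|none].
- left; pose S := [set s | connect (within e U) u s].
  have SU : S \subset U.
    apply/subsetP => y; rewrite inE => /connectP[p pp ->]; case/lastP: p pp => // p v pp.
    by have /andP[_ /allP H] := within_path pp; rewrite last_rcons; apply: H; rewrite mem_rcons mem_head.
  have Scl x y : x \in S -> y \in U -> e x y -> y \in S.
    move=> xS yU exy; move: (xS); rewrite !inE => c1; apply: connect_trans c1 (connect1 _).
    by rewrite /within (subsetP SU _ xS) yU.
  have con x y : x \in S -> y \in S -> connect (within e S) x y.
    have cu v : v \in S -> connect (within e S) u v.
      rewrite inE => /connectP[p]; elim/last_ind: p v => [|p v' IH] v; first by move=> _ ->.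
      rewrite rcons_path last_rcons => /andP[pp /and3P[lU vU elv]] ->.
      have ls : last u p \in S by rewrite inE; apply/connectP; exists p.
      apply: connect_trans (IH _ pp erefl) (connect1 _).
      by rewrite /within ls elv (Scl _ _ ls vU elv).
    move=> /cu c1 /cu; apply: connect_trans.
    by rewrite (sym_connect_sym (within_sym S (lh_sym lh))).
  have S0 : S != set0 by apply/set0Pn; exists u; rewrite inE.
  have SX : S \subset X by apply/subsetP => y /(subsetP SU)/behind_X.
  apply: (ear_exists_from SU con).
  have bd y : y \in boundary e S -> [\/ odd_end y, inl y = w | y \in Th /\ exists i, w = inr i].
    case/boundaryP=> yS [x xS exy]; have xU := subsetP SU _ xS.
    have [yU|[yw _]|oy|[yT [i wi exi]]] := behind_nbr xU exy.
    - by case/negP: yS; exact: Scl exy.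
    - by constructor 2.
    - by constructor 1.
    - by constructor 3; split=> //; exists i.
  (* A vertex [w] accounts for one of three boundary vertices. If [w] is a leg, 2-connectivity of
     the block provides two boundary vertices in [X], none of them on the theta graph. *)
  move: bd; case: w => [v|i] bd.
    apply: leq_trans (_ : 1 < #|boundary e S :\ v|) (subset_leq_card _).
      by have := lh_G3 lh (subset_trans SX (subsetUl X F)) S0; rewrite (cardsD1 v); case: (v \in _) => //= /ltnW.
    apply/subsetP => y; rewrite !in_setD1 => /andP[yv yb]; rewrite inE yb.
    have [//|[E]|[_ [i]] //] := bd y yb; by rewrite E eqxx in yv.
  have Scs y : y \in S -> y \notin cs by move/(subsetP SU)/behind_ncs.
  apply: leq_trans (lh_X2 lh SX S0 (cyc_big cyc SX Scs)) (subset_leq_card _).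
  apply/subsetP => y /setIP[yb yX]; rewrite inE yb.
  have [//|//|[yT _]] := bd y yb.
  by move: (disjointFr (lh_OT lh) (X_O F yX)); rewrite yT.
- have third_odd n : odd n -> (exists2 i, w = inr i & ex (z cs n) i) \/ exists2 y, w = inl y & e (z cs n) y /\ y \in off cs.
    move=> no; have zcs := cnth_cs n; have nc := oc _ no.
    have dz := od _ no; have zO : z cs n \in O by rewrite X_O // (cyc_X cyc zcs).
    have [y ezy /orP[yT|yoff]] := third zcs nc.
      by left; exact: (dom_Th lh dz (w_ncs zcs) zO ezy yT).
    have dy := dom_off dz (w_ncs zcs) zO ezy yoff.
    case: (eqVneq w (inl y)) => wy; first by right; exists y.
    case/negP: none; apply/exists_inP; exists y; first by apply/behindP.
    by apply/existsP; exists (z cs n); rewrite odd_endE no.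
  case: (third_odd 1 isT) => [[i wi _]|[y wy [e1 yoff]]].
    right; exists i => // n no; case: (third_odd n no) => [[j]|[y]]; last by rewrite wi.
    by rewrite wi => -[->].
  have all_y n : odd n -> e y (z cs n).
    move=> no; rewrite (lh_sym lh); case: (third_odd n no) => [[j]|[y']]; first by rewrite wy.
    by rewrite wy => -[->] [].
  have yO : y \in O by move: yoff; rewrite in_off => /andP[].
  have zX n : z cs n \in X by exact: (cyc_X cyc (cnth_cs n)).
  have neq n m : n < 6 -> m < 6 -> n != m -> z cs n != z cs m.
    move=> n6 m6; apply: contra => /eqP E; apply/eqP; apply: cnth_inj E; lia.
  case/setUP: (yO) => [yX|yF]; last first.
    have := lh_F1 lh yF (zX 1) (zX 3) (all_y 1 isT) (all_y 3 isT).
    by move/eqP; rewrite (negPf (neq 1 3 isT isT isT)).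
  have [[|v p]] := live_off sub yoff; first by rewrite mem_legs.
  move=> /= /andP[gyv _] _.
  have [t eyt tcs] : exists2 t, e y t & t \notin cs.
    case: v gyv => [t|i] /=.
      by case/and3P=> _; rewrite in_off => /andP[_ tcs] eyt; exists t.
    move=> /andP[_ exi]; have [t tT eyt] := lh_Tex lh yO exi.
    by exists t => //; exact: (Th_ncs lh cyc tT).
  (* Besides three odd cycle vertices, [y] has a neighbour [t] on its way to the legs: degree at
     least four. *)
  have := @nbr_bound _ _ _ _ _ _ _ lh y [:: t; z cs 1; z cs 3; z cs 5] yO.
  have nt n : t != z cs n by apply: contraNneq tcs => ->; exact: cnth_cs.
  rewrite /= !inE !negb_or !nt !neq // eyt !all_y // => /(_ isT isT) //.
Qed.

End Ears.

(** * Disjoint exits from an ear vertex and an even vertex *)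

Section EarLinked.
Variables (T : finType) (e : rel T) (X F Th : {set T})
  (ex : T -> 'I_3 -> bool) (c : T).
Hypothesis lh : local_hyp e X F Th ex c.
Local Notation O := (X :|: F).
Local Notation off := (off X F).
Local Notation outward := (outward e X F ex).
Local Notation legs_set := (legs_set T).
Local Notation domi cs := (dom (outward cs) legs_set).
Local Notation z cs := (cnth c cs).
Variables (cs : seq T) (w w' : T + 'I_3).
Hypotheses (good : good_cyc e X F Th ex c cs)
  (alt : alternating e X F ex c cs w w')
  (c_free : c \in off cs -> ~~ domi cs w (inl c)).

Let cyc : is_cyc e X cs. Proof. by case: good. Qed.
Let sub : off cs \subset exiting e X F ex cs. Proof. by case: good. Qed.
Let third : forall z, z \in cs -> z != c ->
        exists2 y, e z y & (y \in Th) || (y \in off cs).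
Proof. by case: good. Qed.

Local Notation U := (behind e X F ex cs w).
Local Notation hub_side := (hub_side e X F ex cs w).
Local Notation hub := (hub e X F ex cs w).

Lemma path_outward_off a l : a \in O -> path e a l -> all (mem (off cs)) l ->
  path (outward cs) (inl a) (map inl l).
Proof.
elim: l a => //= b l IH a aO /andP[eab pl] /andP[boff al].
by rewrite aO boff eab IH //; move: boff; rewrite in_off => /andP[].
Qed.

(** A common dominator is comparable with both [w] and [w']. It cannot lie behind either of them by
    [alternating_excl], nor beyond both by [alternating_no_dom]. *)
Lemma not_codom_even n m : odd n -> ~~ odd m -> z cs m != c ->
  ~ codominated (outward cs) legs_set (inl (z cs n)) (inl (z cs m)).
Proof.
case: (alt) => _ _ oc dodd deven no mo mc [v /andP[dn dm]].
have ln := live_cyc lh cyc sub third (cnth_cs good n) (oc _ no).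
have lm := live_cyc lh cyc sub third (cnth_cs good m) mc.
have [d|d] := dom_comparable ln (dodd _ no) dn.
  exact: (alternating_excl lh good alt lm (dom_trans d dm) (deven _ mo mc)).
have [d'|d'] := dom_comparable lm (deven _ mo mc) dm.
  exact: (alternating_excl lh good alt ln (dodd _ no) (dom_trans d' dn)).
exact: (alternating_no_dom lh good alt d d').
Qed.

Lemma hub_path rs q : {subset rs <= U} -> q \in rs -> hubbed e X F ex cs w rs q ->
  exists l, [/\ path e q l, uniq l, {subset l <= U}, {in l, forall x, x \notin rs} & hub (last q l)].
Proof.
move=> su qrs; case/orP => [hq|/exists_inP[y yN eqy]]; first by exists [::].
have [p [pp /= /andP[yf pf] up _ hl]] := reach_path yN.
have H x : x \in y :: p -> x \in U /\ x \notin rs.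
  by move=> xp; apply/andP; rewrite -in_freshU; move: xp; rewrite inE => /orP[/eqP->//|/(allP pf)].
by exists (y :: p); split; rewrite //= ?eqy // => x /H[].
Qed.

(** Vertex 1 and the even vertex are not codominated, so they have disjoint outward paths. The one
    from vertex 1 passes [w], and [q] can join it there by a path behind [w]; the other path
    contains nothing dominated by [w], so it stays disjoint. *)
Lemma ear_linked rs q n : {subset rs <= U} -> q \in rs -> hubbed e X F ex cs w rs q ->
  ~~ odd n -> z cs n != c -> exists l1 l2 i j,
  [/\ i != j, path e q l1, path e (z cs n) l2,
      uniq (l1 ++ l2) /\ {in l1 ++ l2, forall x, x \in off cs /\ x \notin rs} &
      ex (last q l1) i /\ ex (last (z cs n) l2) j].
Proof.
move=> su qrs hq no nc; have [sz _ oc dodd deven] := alt.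
have neq : inl (z cs 1) != inl (z cs n) :> T + 'I_3.
  apply/negP => /eqP[E]; have := odd_endE lh good alt 1; rewrite E.
  by rewrite (odd_endE lh good alt) (negPf no).
have [/(@not_codom_even 1 n isT no nc)//|[p [p2 [pp pp2 pB p2B D]]]] :=
  @codom_or_linked _ (outward cs) legs_set _ _ neq.
have wp : w \in inl (z cs 1) :: p by apply: (domP _ _ _ _ (dodd 1 isT)).
(* After its last visit to [w] the path reaches a leg without meeting anything dominated by [w]. *)
have [q0 [r0' [Ep /eqP Lq wr]]] : exists q0 r0, [/\ p = q0 ++ r0, last (inl (z cs 1)) q0 == w & all (predC (pred1 w)) r0].
  by apply: split_last; apply/hasP; exists w => /=.
move: pp pB; rewrite Ep cat_path last_cat Lq => /andP[pq0 pr0'].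
have [r0 pr0 ur0 subr0] := shortenP pr0' => r0B.
move: p2B; have [p3 pp3 up3 sub3] := shortenP pp2 => p3B.
have p3p2 x : x \in inl (z cs n) :: p3 -> x \in inl (z cs n) :: p2.
  by rewrite !inE => /orP[->//|/sub3->]; rewrite orbT.
have D' x : x \in w :: r0 -> x \notin inl (z cs n) :: p3.
  move=> xr; apply/negP => /p3p2 xp3; have : x \in inl (z cs 1) :: p.
    move: xr; rewrite inE => /orP[/eqP->//|/subr0 xr].
    by rewrite Ep inE mem_cat xr !orbT.
  by move/(disjointFr D); rewrite xp3.
have nd_suffix v s : path (outward cs) v s -> last v s \in legs_set -> w \notin v :: s ->
    forall x, x \in v :: s -> ~~ domi cs w x.
  move=> ps sB ws x xs; apply/negP => /domP dx.
  have [s1 [s2 [Es Ls]]] := split_mem xs.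
  have ws2 : w \in x :: s2.
    by apply: dx; move: ps sB; rewrite Es cat_path last_cat Ls // => /andP[].
  case/negP: ws; rewrite Es -cat_cons mem_cat; move: ws2; rewrite inE => /orP[/eqP->|->].
    by rewrite -Ls mem_last.
  by rewrite orbT.
have nd3 x : x \in inl (z cs n) :: p3 -> ~~ domi cs w x.
  by apply: nd_suffix => //; apply/negP => /p3p2; rewrite (disjointFr D).
have nd0 x : x \in r0 -> ~~ domi cs w x.
  case: (r0) ur0 pr0 r0B => // v s /= /andP[ws _] /andP[_ ps] sB; exact: nd_suffix.
have [lq [plq ulq suq lqrs hlq]] := hub_path su qrs hq.
have qU : q \in U by exact: su.
have Uoff x : x \in U -> x \in off cs by case/behindP.
have UO x : x \in U -> x \in O by move/Uoff; rewrite in_off => /andP[].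
pose P := map inl lq ++ w :: r0.
have pP : path (outward cs) (inl q) P.
  rewrite /P cat_path path_outward_off ?UO //; last by apply/allP => x /suq/Uoff.
  by rewrite last_map /= pr0 andbT; exact: hlq.
have lP : last (inl q) P \in legs_set by rewrite last_cat.
have [l1 [i [E1 pl1 al1 exi]]] := outward_path pP lP.
have [l2 [j [E2 pl2 al2 exj]]] := outward_path pp3 p3B.
have inlI : injective (@inl T 'I_3) by move=> u v [].
have l1P x : x \in l1 -> x \in lq \/ inl x \in w :: r0.
  move=> xl; have : inl x \in P by rewrite E1 mem_rcons inE (mem_map inlI) xl orbT.
  by rewrite mem_cat (mem_map inlI) => /orP[->|->]; [left|right].
have l2P x : x \in l2 -> inl x \in p3 by rewrite E2 mem_rcons inE (mem_map inlI) => ->; rewrite orbT.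
have wU x : x \in U -> inl x != w by case/behindP=> _ _; rewrite eq_sym.
have dU x : x \in U -> domi cs w (inl x) by case/behindP.
have wr0 : w \notin r0 by case/andP: ur0.
have uP : uniq P.
  rewrite cat_uniq (map_inj_uniq inlI) ulq ur0 andbT; apply/hasPn => v vr.
  apply/negP => /mapP[x /suq xU Ev]; move: vr; rewrite Ev inE (negPf (wU _ xU)) /=.
  by move/nd0; rewrite dU.
exists l1, l2, i, j; split=> //.
- apply/negP => /eqP ij; have iP : inr i \in w :: r0.
    have : last (inl q) P = inr i by rewrite E1 last_rcons.
    by rewrite last_cat /= => <-; exact: mem_last.
  by have := D' _ iP; rewrite inE E2 mem_rcons inE ij eqxx.
- split.
    move: uP up3; rewrite E1 E2 cons_uniq !rcons_uniq !(map_inj_uniq inlI).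
    case/andP=> _ u1 /and3P[_ _ u2]; rewrite cat_uniq u1 u2 andbT.
    apply/hasPn => x xl2; apply/negP => /l1P[xq|xr].
      by have := nd3 (inl x); rewrite inE (l2P _ xl2) orbT dU ?suq // => /(_ isT).
    by have := D' _ xr; rewrite inE l2P ?orbT.
  move=> x; rewrite mem_cat => /orP[xl|xl]; split; [exact: (allP al1)| |exact: (allP al2)|].
    case: (l1P _ xl) => [/lqrs//|xr]; apply/negP => /su xU.
    move: xr; rewrite inE (negPf (wU _ xU)) /= => /nd0; by rewrite dU.
  apply/negP => /su xU; have := nd3 (inl x); rewrite inE l2P ?orbT // dU // => /(_ isT) //.
Qed.

End EarLinked.

(** Reduces distinctness of rearranged pieces to counting, which [lia] settles. *)
Lemma uniq_count_le (T : eqType) (L B : seq T) :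
  (forall a, count_mem a L <= count_mem a B) -> uniq B -> uniq L.
Proof.
move=> le uB; apply: count_mem_uniq => a; have := le a; rewrite (count_uniq_mem _ uB).
have := has_count (pred1 a) L; rewrite has_pred1 => ->.
by case: (a \in B); case: (count_mem a L) => // -[].
Qed.

Lemma uniq_chord_end (T : eqType) (lq lp rs1 rs2 A A0 : seq T) q x y p :
  uniq ((lq ++ lp) ++ rs1 ++ q :: rs2 ++ (x :: A ++ y :: rcons A0 p)) ->
  uniq (x :: (p :: lp) ++ rs1 ++ q :: lq ++ (rs2 ++ y :: rev A)).
Proof.
apply: uniq_count_le => a; rewrite /= !count_cat /= !count_cat /= -cats1 !count_cat /= count_rev.
rewrite !count_cat /= ?count_cat /=.
move: (x == a) (y == a) (q == a) (p == a) => b1 b2 b3 b4.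
move: (count _ lq) (count _ lp) (count _ rs1) (count _ rs2) (count _ A) (count _ A0).
clear; lia.
Qed.

Lemma uniq_chord_arc (T : eqType) (lq lp rs A1 A2 A' : seq T) q x y p :
  uniq ((lq ++ lp) ++ (q :: rs) ++ (x :: (A1 ++ p :: A2) ++ y :: A')) ->
  uniq (p :: lp ++ (rev A1 ++ [:: x]) ++ q :: lq ++ (rs ++ y :: rev A2)).
Proof.
apply: uniq_count_le => a; rewrite /= !count_cat /= !count_cat /= !count_cat /= !count_rev.
move: (x == a) (y == a) (q == a) (p == a) => b1 b2 b3 b4.
move: (count _ lq) (count _ lp) (count _ rs) (count _ A1) (count _ A2) (count _ A').
clear; lia.
Qed.

(** * Parity count: a bead in a cycle with an ear *)

Section ArcBeads.
Variables (T : finType) (e : rel T) (X F Th : {set T})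
  (ex : T -> 'I_3 -> bool) (c : T).
Hypothesis e_sym : symmetric e.
Local Notation O := (X :|: F).
Variable ev : pred T.

Definition chord_link (q p : T) (avoid : seq T) := exists l1 l2 i j,
  [/\ i != j, path e q l1, path e p l2,
      uniq (l1 ++ l2) /\ {in l1 ++ l2, forall x, x \in O /\ x \notin avoid} &
      ex (last q l1) i /\ ex (last p l2) j].

(** An arc begins next to an odd vertex, so its even offsets are even vertices of the cycle. *)
Definition even_ev (A : seq T) := forall x0 m, m < size A -> ~~ odd m ->
  nth x0 A m != c -> ev (nth x0 A m).

(** The cycle has length 2 modulo 4 and the ear [rs] joins two of its odd vertices; [ev] will mark
    the even vertices other than [c]. *)
Record config x A y A' rs : Prop := Config {
  cf_uniq : uniq (rs ++ x :: A ++ y :: A');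
  cf_cyc : cycle e (x :: A ++ y :: A');
  cf_path : path e x (rcons rs y);
  cf_O : {subset rs ++ x :: A ++ y :: A' <= O};
  cf_A : even_ev A;
  cf_A' : even_ev A';
  cf_odd : odd (size A);
  cf_odd' : odd (size A');
  cf_mod : (size A + size A') %% 4 = 0;
  cf_size : 3 < size A + size A';
  cf_link : forall q p, q \in rs -> ev p -> chord_link q p (rs ++ x :: A ++ y :: A') }.

Lemma even_ev_rev A : odd (size A) -> even_ev A -> even_ev (rev A).
Proof.
move=> oA evA x0 m; rewrite size_rev => ml mo; rewrite nth_rev //; apply: evA; first by lia.
by rewrite oddB // oA /= mo.
Qed.

Lemma cycle_two x A y A' :
  cycle e (x :: A ++ y :: A') = path e x (rcons A y) && path e y (rcons A' x).
Proof. by rewrite [cycle _ _]/= rcons_cat cat_path /= [path e x (rcons A y)]rcons_path andbA. Qed.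

Lemma config_perm x A y A' rs x' B y' B' rs' :
  perm_eq (rs ++ x :: A ++ y :: A') (rs' ++ x' :: B ++ y' :: B') ->
  rs =i rs' -> cycle e (x' :: B ++ y' :: B') -> path e x' (rcons rs' y') ->
  even_ev B -> even_ev B' -> odd (size B) -> odd (size B') ->
  (size B + size B') %% 4 = 0 -> 3 < size B + size B' ->
  config x A y A' rs -> config x' B y' B' rs'.
Proof.
move=> pe ers cy pa eB eB' oB oB' m4 sz cf; split=> //.
- by rewrite -(perm_uniq pe); exact: cf_uniq cf.
- by move=> v; rewrite -(perm_mem pe); exact: cf_O.
- move=> q p; rewrite -ers => qrs evp; have [l1 [l2 [i [j [ij p1 p2 [u H] E]]]]] := cf_link cf qrs evp.
  exists l1, l2, i, j; split=> //; split=> // v /H; by rewrite (perm_mem pe).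
Qed.

Lemma config_flip x A y A' rs : config x A y A' rs -> config y (rev A) x (rev A') (rev rs).
Proof.
move=> cf; apply: (config_perm _ _ _ _ _ _ _ _ _ _ cf); rewrite ?size_rev //; try exact: (cf_odd cf);
  try exact: (cf_odd' cf); try exact: (cf_mod cf); try exact: (cf_size cf).
- apply/permP => P; rewrite /= !count_cat /= !count_cat /= !count_rev.
  by move: (count P rs) (count P A) (count P A') (P x) (P y); clear; lia.
- by move=> v; rewrite mem_rev.
- by move: (cf_cyc cf); rewrite !cycle_two !(path_rev_sym e_sym).
- by rewrite (path_rev_sym e_sym); exact: cf_path cf.
- exact: (even_ev_rev (cf_odd cf) (cf_A cf)).
- exact: (even_ev_rev (cf_odd' cf) (cf_A' cf)).
Qed.

Lemma config_swap x A y A' rs : config x A y A' rs -> config y A' x A (rev rs).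
Proof.
move=> cf; apply: (config_perm _ _ _ _ _ _ _ _ _ _ cf); try exact: (cf_odd cf);
  try exact: (cf_odd' cf); try exact: (cf_A cf); try exact: (cf_A' cf);
  try (rewrite addnC; first [exact: (cf_mod cf) | exact: (cf_size cf)]).
- apply/permP => P; rewrite /= !count_cat /= !count_cat /= !count_rev.
  by move: (count P rs) (count P A) (count P A') (P x) (P y); clear; lia.
- by move=> v; rewrite mem_rev.
- by move: (cf_cyc cf); rewrite !cycle_two andbC.
- by rewrite (path_rev_sym e_sym); exact: cf_path cf.
Qed.

Local Notation leg_bead := (leg_bead e X F ex).

(* The exit of [x] runs through its neighbour on the other arc. *)
Lemma chord_end_bead x A y A0 p rs s : config x A y (rcons A0 p) rs -> ev p ->
  0 < s <= size rs -> near s.-1 (size A + size rs - s + 1) -> leg_bead.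
Proof.
move=> cf evp sl nr.
have [rs1 [q [rs2 [Ers s1]]]] : exists rs1 q rs2, rs = rs1 ++ q :: rs2 /\ size rs1 = s.-1.
  case/andP: sl; case: (s) => // s' _ sl; exists (take s' rs), (nth x rs s'), (drop s'.+1 rs).
  by rewrite -drop_nth // cat_take_drop size_takel // ltnW.
have qrs : q \in rs by rewrite Ers mem_cat mem_head orbT.
have [lq [lp [i [j [ij pq pp [u H] [ei ej]]]]]] := cf_link cf qrs evp.
have uB : uniq ((lq ++ lp) ++ rs ++ x :: A ++ y :: rcons A0 p).
  rewrite cat_uniq u (cf_uniq cf) andbT; apply/hasPn => v vb; apply/negP => /H[_].
  by rewrite vb.
move: (cf_cyc cf) (cf_path cf); rewrite cycle_two => /andP[pA pA0].
rewrite Ers => pR.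
exists x, rs1, (p :: lp), q, (rs2 ++ y :: rev A), lq, j, i; split=> //; last by rewrite eq_sym.
  apply/and5P; split=> //.
  - by apply: (@uniq_chord_end _ lq lp rs1 rs2 A A0); move: uB; rewrite Ers -[(rs1 ++ _) ++ _]catA.
  - rewrite cycle_two; move: pR.
    rewrite rcons_cat rcons_cons -cat_rcons cat_path last_rcons => /andP[-> p2].
    by rewrite rcons_cat rcons_cons -cat_rcons cat_path p2 last_rcons (path_rev_sym e_sym).
  - rewrite /= pp andbT; move: pA0; rewrite rcons_path last_rcons => /andP[_].
    by rewrite e_sym.
  - rewrite s1 size_cat /= size_rev.
    have -> : size rs2 + (size A).+1 = size A + size rs - s + 1 by rewrite Ers size_cat /= s1; lia.
    exact: nr.
have Hb v : v \in rs ++ x :: A ++ y :: rcons A0 p -> v \in O by exact: (cf_O cf).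
apply/allP => v vb; have : (v \in lq ++ lp) || (v \in rs ++ x :: A ++ y :: rcons A0 p).
  move: vb; rewrite Ers !(mem_cat, inE, mem_rcons, mem_rev).
  by do !case: (_ \in _); rewrite ?orbT //; do !case: (_ == _); rewrite ?orbT.
by case/orP => [/H[]//|/Hb].
Qed.

(** On the cycle formed by the ear and one arc, the marked vertices are [p] and the ear vertex [q]
    next to [x]. Both ways from [p] to [q] pass an end of the ear. *)
Lemma chord_arc_bead x A1 p A2 y A' q rs : config x (A1 ++ p :: A2) y A' (q :: rs) -> ev p ->
  near (size A1).+1 (size rs + (size A2).+1) -> leg_bead.
Proof.
move=> cf evp nr.
have [lq [lp [i [j [ij pq pp [u H] [ei ej]]]]]] := cf_link cf (mem_head q rs) evp.
have uB : uniq ((lq ++ lp) ++ (q :: rs) ++ x :: (A1 ++ p :: A2) ++ y :: A').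
  rewrite cat_uniq u (cf_uniq cf) andbT; apply/hasPn => v vb; apply/negP => /H[_].
  by rewrite vb.
move: (cf_cyc cf) (cf_path cf); rewrite cycle_two => /andP[pA _] pR.
exists p, (rev A1 ++ [:: x]), lp, q, (rs ++ y :: rev A2), lq, j, i; split=> //; last by rewrite eq_sym.
  apply/and5P; split=> //.
  - exact: (@uniq_chord_arc _ lq lp rs A1 A2 A').
  - move: pA; rewrite rcons_cat rcons_cons -cat_rcons cat_path last_rcons => /andP[p1 p2].
    have [exq {}pR] : e x q /\ path e q (rcons rs y) by apply/andP.
    rewrite cycle_two cats1 rcons_path (path_rev_sym e_sym) p1 last_rcons exq.
    by rewrite rcons_cat rcons_cons -cat_rcons cat_path pR last_rcons (path_rev_sym e_sym).
  - by rewrite !size_cat /= !size_rev addn1.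
have Hb v : v \in (q :: rs) ++ x :: (A1 ++ p :: A2) ++ y :: A' -> v \in O by exact: (cf_O cf).
apply/allP => v vb.
have : (v \in lq ++ lp) || (v \in (q :: rs) ++ x :: (A1 ++ p :: A2) ++ y :: A').
  move: vb; rewrite !(mem_cat, inE, mem_rev).
  by do !case: (_ \in _); rewrite ?orbT //; do !case: (_ == _); rewrite ?orbT.
by case/orP => [/H[]//|/Hb].
Qed.

Lemma config_c x A y A' rs (B1 B2 : seq T) : config x A y A' rs ->
  subseq (B1 ++ B2) (A ++ A') -> c \in B1 -> c \notin B2.
Proof.
move=> cf ss cB1; have ss' : subseq (A ++ A') (rs ++ x :: A ++ y :: A').
  apply: subseq_trans (suffix_subseq _ _); apply: subseq_trans (subseq_cons _ _).
  by apply: cat_subseq => //; exact: subseq_cons.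
have := subseq_uniq (subseq_trans ss ss') (cf_uniq cf).
rewrite cat_uniq => /and3P[_ /hasPn H _]; apply/negP => /H /=.
by rewrite cB1.
Qed.

Lemma arc_at x A y A' rs m : config x A y A' rs -> 0 < size rs -> m < size A -> ~~ odd m ->
  nth x A m != c -> near m.+1 (size rs + size A - m.+1) -> leg_bead.
Proof.
move=> cf r0 ml mo nc nr; have evp := cf_A cf ml mo nc.
case: rs r0 cf nr => // q rs _ cf nr.
have EA : A = take m A ++ nth x A m :: drop m.+1 A by rewrite -drop_nth // cat_take_drop.
have sm : size (take m A) = m by rewrite size_takel // ltnW.
rewrite EA in cf; apply: (chord_arc_bead cf evp).
by rewrite sm size_drop; move: nr; rewrite /= /near; move: (size A) (size rs) ml; clear; lia.
Qed.

(** The ear is long enough to contain a vertex nearly opposite to [x] on the cycle through [A]. That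
    vertex and [x] are the marked ones, and [x] exits through its even neighbour on [A']. *)
Lemma config_bead_short x A y A' rs : config x A y A' rs -> size A <= size rs ->
  1 < size A' -> leg_bead.
Proof.
move=> cf le sA'; pose n := size A + size rs; pose s := (n.+1)./2.
have A0 : 0 < size A by have := cf_odd cf; case: (size A).
have sl : 0 < s <= size rs by rewrite /s /n; move: (size A) (size rs) le A0; clear; lia.
have nr : near s.-1 (size A + size rs - s + 1).
  by rewrite /near /s /n; move: (size A) (size rs) le A0; clear; lia.
have oA' := cf_odd' cf.
case/lastP: A' => [|A0' p] // in cf sA' oA' *.
case pc : (p == c); last first.
  apply: (chord_end_bead cf _ sl nr).
  have := cf_A' cf (x0 := x) (m := size A0'); rewrite nth_rcons ltnn eqxx size_rcons pc.
  by apply=> //; move: oA'; rewrite size_rcons.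
(* If the last vertex of [A'] is [c], the mirror image works with [y] and the first vertex of
   [A']. *)
case: A0' => [|a A0'] // in cf sA' oA' *.
have cf' := config_flip cf; rewrite rcons_cons rev_cons in cf'.
have cA : c \in [:: p] by rewrite inE eq_sym.
have ss : subseq ([:: a] ++ [:: p]) (A ++ rcons (a :: A0') p).
  apply: subseq_trans (suffix_subseq _ _); rewrite /= eqxx -cats1; exact: suffix_subseq.
apply: (chord_end_bead cf' _ (s := s)); rewrite ?size_rev //.
have := cf_A' cf (x0 := x) (m := 0); apply => //=.
apply/negP => /eqP ac; have := config_c cf ss; rewrite ac mem_head => /(_ isT).
by rewrite cA.
Qed.

(** Half of [size A + size rs] is an even number [h]. The even offsets [h] and [h - 2] in [A] both
    give arcs whose lengths differ by 2, and one of them avoids [c]. *)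
Lemma config_bead_long_odd x A y A' rs : config x A y A' rs -> odd (size rs) ->
  size rs < size A -> (size A + size rs) %% 4 = 0 -> leg_bead.
Proof.
move=> cf ors lt m4; pose h := (size A + size rs)./2.
have hP : [/\ 1 < h, h < size A, ~~ odd h, size A + size rs = h + h & 0 < size rs].
  rewrite /h; move: (size A) (size rs) ors lt m4; clear => a b ors lt m4.
  split; lia.
case: hP => h1 hA ho En r0.
case c1 : (nth x A h == c); last first.
  apply: (arc_at cf r0 hA ho); rewrite ?c1 // /near addnC En.
  by move: h h1 {hA ho En c1}; clear; lia.
apply: (arc_at cf r0 (m := h - 2)); first by move: h1 hA; clear; lia.
- by rewrite oddB // (negPf ho).
- apply/negP => /eqP c2; have uA : uniq A.
    by have := cf_uniq cf; rewrite cat_uniq /= cat_uniq => /and3P[_ _ /and3P[_ ? _]].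
  have : nth x A h == nth x A (h - 2) by rewrite c2.
  rewrite nth_uniq //; move: h1 hA; clear; lia.
- by rewrite /near addnC En; move: h1; clear; lia.
Qed.

(** Now [size A + size rs] is odd. Two consecutive offsets give arcs whose lengths differ by 1, and
    the even one of them is taken. *)
Lemma config_bead_long_even x A y A' rs : config x A y A' rs -> ~~ odd (size rs) -> 0 < size rs ->
  size rs < size A -> c \notin A -> leg_bead.
Proof.
move=> cf ers r0 lt cA; have oA := cf_odd cf.
have [m [ml mo nr]] : exists m, [/\ m < size A, ~~ odd m & near m.+1 (size rs + size A - m.+1)].
  pose h := (size A + size rs - 3)./2.
  exists (if odd h then h.+1 else h); rewrite /near /h.
  move: (size A) (size rs) ers r0 lt oA; clear => a b ers r0 lt oA.
  by case: ifP => ho; split; lia.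
apply: (arc_at cf r0 ml mo) nr; apply: contra cA => /eqP <-; exact: mem_nth.
Qed.

(** The odd numbers [size A] and [size A'] add up to 0 modulo 4, so they are 1 and 3 modulo 4; for
    an odd ear exactly one of them completes it to a multiple of 4. For an even ear, use an arc
    without [c]. *)
Lemma config_bead x A y A' rs : 0 < size rs -> config x A y A' rs -> leg_bead.
Proof.
move=> r0 cf; wlog le : x A y A' rs r0 cf / size A <= size A'.
  move=> H; case/orP: (leq_total (size A) (size A')) => le; first exact: (H _ _ _ _ _ r0 cf).
  by apply: (H _ _ _ _ _ _ (config_swap cf)); rewrite ?size_rev.
case: (leqP (size A) (size rs)) => lt.
  apply: (config_bead_short cf lt); have := cf_size cf.
  by move: (size A) (size A') le; clear; lia.
have lt' := leq_trans lt le; have cf' := config_swap cf.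
case ors : (odd (size rs)).
  have [m4|m4] : (size A + size rs) %% 4 = 0 \/ (size A' + size rs) %% 4 = 0.
    have := cf_mod cf; have := cf_odd cf; have := cf_odd' cf.
    by move: (size A) (size A') (size rs) ors; clear; lia.
  - exact: (config_bead_long_odd cf).
  - by apply: (config_bead_long_odd cf'); rewrite size_rev.
case cA : (c \in A).
  apply: (config_bead_long_even cf'); rewrite ?size_rev ?ors //.
  exact: (config_c cf (subseq_refl _)).
by apply: (config_bead_long_even cf); rewrite ?ors ?cA.
Qed.

End ArcBeads.

(** * From a hubbed ear to a bead *)

Section EarBead.
Variables (T : finType) (e : rel T) (X F Th : {set T})
  (ex : T -> 'I_3 -> bool) (c : T).
Hypothesis lh : local_hyp e X F Th ex c.
Local Notation O := (X :|: F).
Local Notation z cs := (cnth c cs).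
Variables (cs : seq T) (w w' : T + 'I_3).
Hypotheses (good : good_cyc e X F Th ex c cs)
  (alt : alternating e X F ex c cs w w')
  (c_free : c \in off X F cs -> ~~ dom (outward e X F ex cs) (legs_set T) w (inl c)).

Lemma ear_leg_bead zi rs zj : ear e X F ex c cs w zi rs zj ->
  {in rs, forall r, hubbed e X F ex cs w rs r} -> leg_bead e X F ex.
Proof.
move=> [oi oj ij pr [u su n0]] hub; have [cyc _ _] := good.
have [_ ucs ccs _] := and4P cyc.
have [_ m4 _ _ _] := alt.
have [n nl En] : exists2 n, n < size cs & z cs n = zi by apply: (cnthP c); case/and3P: oi.
have [m ml Em] : exists2 m, m < size cs & z cs m = zj by apply: (cnthP c); case/and3P: oj.
have no : odd n by rewrite -(odd_endE lh good alt) En.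
have mo : odd m by rewrite -(odd_endE lh good alt) Em.
have es : ~~ odd (size cs) by move: m4; move: (size cs); clear; lia.
have nm : n != m by apply: contra ij => /eqP E; rewrite -En -Em E.
(* The number of steps along the cycle from [zi] to [zj], even because both have odd index on an
   even cycle. *)
pose s := (m + size cs - n) %% size cs.
have l0 : 0 < size cs by apply: leq_ltn_trans nl.
have sP : [/\ 0 < s < size cs, ~~ odd s & (n + s) %% size cs = m %% size cs].
  rewrite /s; case: (ltnP m n) => mn.
    rewrite modn_small; last by move: (size cs) nl ml mn; clear; lia.
    rewrite addnBA; last by move: (size cs) nl ml mn; clear; lia.
    rewrite addKn modnDr; split=> //; move: (size cs) nl ml mn no mo es; clear; lia.
  have -> : m + size cs - n = (m - n) + size cs by move: (size cs) nl ml mn; clear; lia.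
  rewrite modnDr modn_small; last by move: (size cs) nl ml mn; clear; lia.
  rewrite addnC subnK //; split=> //; move: (size cs) nl ml mn no mo nm es; clear; lia.
case: sP => sl so Es.
have [A [A' [Erot sA sA']]] := rot_split c n sl.
have Zs : z cs (n + s) = zj by rewrite -Em /cnth Es.
rewrite En Zs in Erot.
have mem v : (v \in zi :: A ++ zj :: A') = (v \in cs) by rewrite -Erot mem_rot.
have rncs r : r \in rs -> r \notin cs by move/su/behind_ncs.
pose ev := [pred p | [exists k : 'I_(size cs), [&& ~~ odd k, z cs k == p & p != c]]].
have evz k : ~~ odd k -> z cs k != c -> ev (z cs k).
  move=> ko kc; apply/existsP; have kl : k %% size cs < size cs by rewrite ltn_mod.
  exists (Ordinal kl); rewrite /= cnth_mod eqxx kc !andbT.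
  move: ko; rewrite {1}(divn_eq k (size cs)) oddD oddM (negPf es) andbF //.
have nthrot i : i < size cs -> nth c (zi :: A ++ zj :: A') i = z cs (n + i).
  by move=> il; rewrite -Erot nth_rot_cnth.
apply: (@config_bead _ e X F ex c (lh_sym lh) ev zi A zj A' rs).
  by rewrite lt0n size_eq0.
split.
- rewrite cat_uniq u -Erot rot_uniq ucs andbT; apply/hasPn => v; rewrite mem_rot => vcs.
  by apply/negP => /rncs; rewrite vcs.
- by rewrite -Erot rot_cycle.
- exact: pr.
- move=> v; rewrite mem_cat mem => /orP[/su/(behind_X lh)/X_O//|]; exact: (cyc_O F cyc).
- move=> x0 k kl ko; rewrite (set_nth_default c) // => nc.
  have E : nth c A k = z cs (n + k.+1).
    rewrite -nthrot; last by move: kl sl; rewrite sA; move: (size cs); clear; lia.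
    by rewrite /= nth_cat kl.
  by rewrite E in nc *; apply: evz nc; rewrite oddD /= no ko.
- move=> x0 k kl ko; rewrite (set_nth_default c) // => nc.
  have E : nth c A' k = z cs (n + (s + k.+1)).
    rewrite -nthrot; last by move: kl sl; rewrite sA'; move: (size cs); clear; lia.
    have -> : s + k.+1 = (size A + k.+1).+1 by rewrite sA; move: sl; clear; lia.
    by rewrite /= nth_cat ltnNge leq_addr /= addKn.
  by rewrite E in nc *; apply: evz nc; rewrite !oddD /= no (negPf so) ko.
- by rewrite sA; move: so sl; clear; lia.
- by rewrite sA'; move: so sl es; move: (size cs); clear; lia.
- by rewrite sA sA'; move: so sl es m4; move: (size cs); clear; lia.
- have [sz _ _ _ _] := alt; by rewrite sA sA'; move: sl sz; move: (size cs); clear; lia.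
- move=> q p qrs /existsP[k /and3P[ko /eqP Ek pc]].
  rewrite -Ek in pc *; have [l1 [l2 [i [j [ij' p1 p2 [uu H] E]]]]] :=
    ear_linked lh good alt su qrs (hub q qrs) ko pc.
  exists l1, l2, i, j; split=> //; split=> // v /H[voff vrs].
  move: voff; rewrite in_off => /andP[vO vcs]; split=> //.
  by rewrite mem_cat mem negb_or vrs.
Qed.

End EarBead.

(** * The local lemma: a bead or a direct cycle *)

Section LocalLemma.
Variables (T : finType) (e : rel T) (X F Th : {set T})
  (ex : T -> 'I_3 -> bool) (c : T).
Hypothesis lh : local_hyp e X F Th ex c.
Local Notation z cs := (cnth c cs).

(* The only obstruction to a bead: every second vertex of the cycle has a
   neighbour on one and the same leg [i]. *)
Definition direct_cycle cs i :=
  [/\ is_cyc e X cs, 5 < size cs, size cs = 2 %[mod 4],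
      forall n, odd n -> ex (z cs n) i &
      forall n, ~~ odd n -> z cs n != c -> exists l j,
        [/\ j != i, path e (z cs n) l, uniq l, all (mem (off X F cs)) l &
            ex (last (z cs n) l) j]].

Lemma c_to_front cs : good_cyc e X F Th ex c cs -> exists2 cs',
  good_cyc e X F Th ex c cs' & forall n, 0 < n < size cs' -> z cs' n != c.
Proof.
move=> good; have [cyc _ _] := good; have [_ ucs _ _] := and4P cyc.
case ccs : (c \in cs); last first.
  exists cs => // n nl; apply: contraFneq ccs => <-.
  by rewrite cnth_mem //; apply: size_cyc_gt0 good.
have [k s E] := rot_to ccs; exists (rot k cs); first exact: good_cyc_rot.
move: ucs; rewrite -(rot_uniq k) E => /= /andP[cs' _] [//|n] nl.
rewrite /cnth modn_small //=; apply: contraNneq cs' => <-.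
by rewrite mem_nth.
Qed.

(** Rotation by one exchanges the parities; with [c] off the cycle both classes are complete. *)
Lemma alternating_rot1 cs w w' : good_cyc e X F Th ex c cs -> c \notin cs ->
  alternating e X F ex c cs w w' -> alternating e X F ex c (rot 1 cs) w' w.
Proof.
move=> good ccs [sz m4 _ dodd deven].
have l0 : 0 < size cs by apply: leq_trans sz.
have E n : z (rot 1 cs) n = z cs (1 + n).
  rewrite {1}/cnth size_rot -{1}(modn_small (leq_trans (isT : 1 < 6) sz)).
  by rewrite nth_rot_cnth ?ltn_mod // -[LHS]cnth_mod -[RHS]cnth_mod modnDmr.
have nc n : z cs n != c by apply: contraNneq ccs => <-; exact: cnth_mem.
split; rewrite ?size_rot // => n; rewrite ?outward_rot E ?nc // => no.
  by apply: deven; rewrite //= no.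
by move=> _; apply: dodd; rewrite /= no.
Qed.

(** If [c] is off the cycle and dominated by [w], it is not dominated by [w'], and exchanging the
    parities helps. *)
Lemma alternating_free : ~ leg_bead e X F ex -> exists cs w w',
  [/\ good_cyc e X F Th ex c cs, alternating e X F ex c cs w w' &
      c \in off X F cs -> ~~ dom (outward e X F ex cs) (legs_set T) w (inl c)].
Proof.
move=> nb; have [cs0 good0] := good_cycle lh.
have [cs good cfirst] := c_to_front (good0 : good_cyc e X F Th ex c cs0).
have [w [w' alt]] := alternating_exists lh good cfirst nb; have [cyc sub _] := good.
case: (boolP ((c \in off X F cs) && dom (outward e X F ex cs) (legs_set T) w (inl c))).
  case/andP=> coff dc; have ccs : c \notin cs by move: coff; rewrite in_off => /andP[].
  exists (rot 1 cs), w', w; split; [exact: good_cyc_rot|exact: alternating_rot1|].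
  move=> _; rewrite outward_rot; apply/negP.
  exact: (alternating_excl lh good alt (live_off sub coff) dc).
by move=> H; exists cs, w, w'; split=> // coff; move: H; rewrite coff.
Qed.

Lemma bead_or_direct : leg_bead e X F ex \/ exists cs i, direct_cycle cs i.
Proof.
have [|nb] := classic (leg_bead e X F ex); [by left | right].
have [cs [w [w' [good alt cfree]]]] := alternating_free nb.
have [[zi [rs [zj er]]]|[i wi dir]] := ear_or_direct lh good alt cfree.
  have [zi' [rs' [zj' [er' hub]]]] := max_ear lh good alt cfree er.
  by case: nb; exact: (ear_leg_bead lh good alt er' hub).
have [cyc sub third] := good; have [sz m4 _ _ _] := alt.
exists cs, i; split=> // n no nc.
(* An even vertex is not dominated by leg [i], so it reaches the legs without it, that is, it
   reaches another leg. *)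
have nd : ~~ dom (outward e X F ex cs) (legs_set T) (inr i) (inl (z cs n)).
  apply: contra no => d; rewrite -(odd_endE lh good alt) /odd_end nc wi d.
  by rewrite (cnth_cs good).
have [q0 pq0 [lB ni]] := avoiding_path nd.
move: lB; have [q pq uq subq] := shortenP pq0 => lB.
have [l [j [E pl al exj]]] := outward_path pq lB.
have inlI : injective (@inl T 'I_3) by move=> u v [].
exists l, j; split=> //.
  apply: contraNneq ni => ij; rewrite inE; apply/orP; right; apply: subq.
  by rewrite E mem_rcons inE ij eqxx.
by move: uq; rewrite E cons_uniq rcons_uniq (map_inj_uniq inlI) => /and3P[].
Qed.

End LocalLemma.

(** * Independent sets in sparse digraphs, and Erdős-Szekeres *)

Section Combinatorics.
Variable I : finType.
Implicit Types (S J : {set I}) (x y : I).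

Lemma small_indegree (r : rel I) S d : S != set0 ->
  (forall x, x \in S -> #|[set y in S | r x y]| <= d) ->
  exists2 y, y \in S & #|[set x in S | r x y]| <= d.
Proof.
move=> S0 out; apply/exists_inP; apply: contraT => /exists_inPn H.
have cardE (P : pred I) : #|[set y in S | P y]| = \sum_(y in S | P y) 1.
  by rewrite -sum1_card; apply: eq_bigl => y; rewrite !inE.
have : \sum_(y in S) #|[set x in S | r x y]| <= \sum_(x in S) d.
  under eq_bigr => y _ do rewrite cardE.
  rewrite (exchange_big_dep (mem S)) => [|i j _ /andP[]//] /=.
  apply: leq_sum => x xS; apply: leq_trans (out x xS); rewrite -cardE.
  by apply: subset_leq_card; apply/subsetP => y; rewrite !inE => /and3P[-> _ ->].
have : \sum_(x in S) d.+1 <= \sum_(y in S) #|[set x in S | r x y]|.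
  by apply: leq_sum => y /H; rewrite -ltnNge.
move=> h1 h2; have := leq_trans h1 h2; rewrite !sum_nat_const.
by rewrite leq_pmul2l ?ltnn // card_gt0.
Qed.

(** Greedy choice: a vertex of indegree at most [d], found by double counting, excludes itself and
    at most [2 * d] others. *)
Lemma sparse_independent (r : rel I) d S :
  (forall x, x \in S -> #|[set y in S | r x y]| <= d) ->
  exists J, [/\ J \subset S, #|S| <= (2 * d).+1 * #|J| &
                {in J &, forall x y, x != y -> ~~ r x y}].
Proof.
have [n] := ubnP #|S|; elim: n S => // n IH S lt out.
have [->|S0] := eqVneq S set0.
  by exists set0; rewrite sub0set cards0; split=> // x y; rewrite inE.
have [x xS inx] := small_indegree S0 out.
pose D := [set y in S | r x y] :|: [set y in S | r y x] :|: [set x].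
have DP y : y \in S -> y \notin D -> [/\ y != x, ~~ r x y & ~~ r y x].
  by move=> yS; rewrite !inE yS /= !negb_or => /andP[/andP[-> ->] ->].
have cD : #|D| <= (2 * d).+1.
  apply: leq_trans (leq_card_setU _ _) _; rewrite cards1 addn1 ltnS mul2n -addnn.
  by apply: leq_trans (leq_card_setU _ _) (leq_add (out x xS) inx).
have [|y yS|J [JS cJ Jr]] := IH (S :\: D).
- apply: leq_trans (_ : #|S| <= n); last by rewrite -ltnS.
  apply: proper_card; apply/properP; split; first exact: subsetDl.
  by exists x; rewrite // !inE eqxx !orbT.
- apply: leq_trans (out y _); last by case/setDP: yS.
  apply: subset_leq_card; apply/subsetP => v; rewrite !inE => /andP[/andP[_ ->] ->] //.
have xJ : x \notin J by apply/negP => /(subsetP JS); rewrite !inE eqxx !orbT.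
exists (x |: J); split.
- by apply/subsetP => y; rewrite inE => /orP[/set1P->//|/(subsetP JS)/setDP[]].
- rewrite cardsU1 xJ /= mulnDr muln1 -(cardsID D S) leq_add //.
  by apply: leq_trans cD; apply: subset_leq_card; exact: subsetIr.
move=> y v /setU1P[->|yJ] /setU1P[->|vJ]; rewrite ?eqxx // => yv; last exact: Jr.
- by case: (DP v) => //; case/setDP: (subsetP JS _ vJ).
- by case: (DP y) => //; case/setDP: (subsetP JS _ yJ).
Qed.

(** Induction on [a] with the set [A] of minimal points. If [A] has at most [b] points, an
    increasing chain among the rest extends downwards by one point; otherwise [A], sorted by [f], is
    decreasing in [g]. *)
Lemma erdos_szekeres (f g : I -> nat) a b S :
  {in S &, injective f} -> {in S &, injective g} -> a * b < #|S| ->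
  (exists s, [/\ size s = a.+1, all (mem S) s &
     pairwise (fun x y => (f x < f y) && (g x < g y)) s]) \/
  (exists s, [/\ size s = b.+1, all (mem S) s &
     pairwise (fun x y => (f x < f y) && (g y < g x)) s]).
Proof.
elim: a S => [|a IH] S fi gi lt.
  have /card_gt0P[x xS] : 0 < #|S| by apply: leq_ltn_trans lt.
  by left; exists [:: x]; rewrite /= xS.
pose A := [set x in S | [forall y in S, ~~ ((f y < f x) && (g y < g x))]].
have AS : A \subset S by apply/subsetP => x; rewrite inE => /andP[].
case: (leqP #|A| b) => cA.
  have ltD : a * b < #|S :\: A|.
    by rewrite cardsDS //; move: lt cA; rewrite mulSn; lia.
  have DS : {subset S :\: A <= S} by move=> x /setDP[].
  have [||[s [ss sS ps]]|[s [ss sS ps]]] := IH (S :\: A) _ _ ltD.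
  - by move=> x y /DS xS /DS yS; exact: fi.
  - by move=> x y /DS xS /DS yS; exact: gi.
  - case: s ss sS ps => // x s [ss] /= /andP[xSA sSA] /andP[xs ps].
    have [xS xA] := setDP xSA.
    have [y yS yx] : exists2 y, y \in S & (f y < f x) && (g y < g x).
      move: xA; rewrite inE xS /= => /forall_inPn[y yS]; rewrite negbK => yx.
      by exists y.
    left; exists [:: y, x & s]; split=> /=; first by rewrite ss.
      by rewrite yS xS; apply/allP => v /(allP sSA)/DS.
    rewrite yx xs ps !andbT /=; apply/allP => v /(allP xs) /andP[h1 h2].
    by case/andP: yx => h3 h4; rewrite (ltn_trans h3) // (ltn_trans h4).
  - by right; exists s; split=> //; apply/allP => v /(allP sS)/DS.
right; pose L := sort (fun x y => f x <= f y) (enum A).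
have sL : size L = #|A| by rewrite size_sort -cardE.
have memL x : (x \in L) = (x \in A) by rewrite mem_sort mem_enum.
have Lp : pairwise (fun x y => f x <= f y) L.
  rewrite -sorted_pairwise; last by move=> y x v; exact: leq_trans.
  by apply: sort_sorted => x y; exact: leq_total.
have uL : uniq L by rewrite sort_uniq enum_uniq.
have Ld : pairwise (fun x y => (f x < f y) && (g y < g x)) L.
  have : all (mem A) L by apply/allP => x; rewrite memL.
  elim: (L) Lp uL => //= x s IHs /andP[xs ps] /andP[nx us] /andP[xA sA].
  rewrite IHs // andbT; apply/allP => y ys.
  have yA : y \in A := allP sA y ys.
  have [xS yS] := (subsetP AS _ xA, subsetP AS _ yA).
  have xy : x != y by apply: contraNneq nx => ->.
  have lf : f x < f y.
    rewrite ltn_neqAle (allP xs) // andbT; apply: contra xy => /eqP E.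
    by apply/eqP; exact: fi.
  move: yA; rewrite inE yS => /forall_inP/(_ x xS); rewrite lf /= => ng.
  rewrite ltnNge leq_eqVlt negb_or ng andbT.
  by apply: contra xy => /eqP E; apply/eqP; apply: gi.
exists (take b.+1 L); split.
- by rewrite size_takel // sL.
- by apply/allP => x /mem_take; rewrite memL => /(subsetP AS).
- by apply: subseq_pairwise (take_subseq _ _) Ld.
Qed.

End Combinatorics.

(** * Basic facts on graphs, paths and cycles *)

Section GraphBasics.
Variable T : finType.
Implicit Types (G H B : graph T) (X : {set T}) (x y : T) (s p c : seq T).

Lemma adj_sym G : symmetric (adj G).
Proof. by move=> x y; rewrite /adj setUC. Qed.

Lemma adjP G x y : adj G x y -> [/\ x != y, x \in vset G & y \in vset G].
Proof.
rewrite /adj /eset /vset; case: G => -[X E] /= /forall_inP wf /wf /andP[].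
rewrite cards2 => xy sub; split; first by case: (x != y) xy.
  by apply: (subsetP sub); rewrite !inE eqxx.
by apply: (subsetP sub); rewrite !inE eqxx orbT.
Qed.

Lemma adj_irr G : irreflexive (adj G).
Proof. by move=> x; apply/negP => /adjP[]; rewrite eqxx. Qed.

Lemma vset_mk X (E : {set {set T}}) : vset (mkgraph X E) = X.
Proof. by []. Qed.

Lemma eset_mk X (E : {set {set T}}) :
  eset (mkgraph X E) = [set A in E | (#|A| == 2) && (A \subset X)].
Proof. by []. Qed.

Lemma adj_mk X (E : {set {set T}}) x y :
  adj (mkgraph X E) x y = [&& [set x; y] \in E, x != y, x \in X & y \in X].
Proof.
rewrite /adj eset_mk inE cards2 subUset !sub1set; case: (_ \in E) => //=.
by case: (x != y).
Qed.

Lemma adj_delete G X x y : adj (delete G X) x y = [&& adj G x y, x \notin X & y \notin X].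
Proof.
rewrite adj_mk !inE; apply/and4P/and3P => [[exy _ /andP[_ xX] /andP[_ yX]]//|[exy -> ->]].
by have [-> -> ->] := adjP exy.
Qed.

Lemma vset_delete G X : vset (delete G X) = vset G :\: X.
Proof. by rewrite setDE. Qed.

Lemma esetP G (A : {set T}) : A \in eset G -> exists x y, A = [set x; y] /\ adj G x y.
Proof.
move=> AE; have /andP[/cards2P[x [y [xy EA]]] _] : (#|A| == 2) && (A \subset vset G).
  by move: AE; rewrite /eset /vset; case: G => -[X E] /= /forall_inP wf /wf.
by exists x, y; rewrite /adj -EA.
Qed.

Lemma subgraphP B G : reflect ((forall x, x \in vset B -> x \in vset G) /\
  (forall x y, adj B x y -> adj G x y)) (subgraph B G).
Proof.
apply: (iffP andP) => [[/subsetP vs /subsetP es]|[vs es]]; split.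
- exact: vs.
- by move=> x y; exact: es.
- exact/subsetP.
- by apply/subsetP => A /esetP[x [y [-> /es]]].
Qed.

Lemma sorted_connect (e : rel T) s x y : symmetric e -> sorted e s ->
  x \in s -> y \in s -> connect e x y.
Proof.
move=> es; case: s => // a s /= ps; have H v : v \in a :: s -> connect e a v.
  by move=> vs; exact: (path_connect ps vs).
move=> /H ax /H; apply: connect_trans; by rewrite (sym_connect_sym es).
Qed.

Lemma connectedP G : reflect (vset G != set0 /\
  forall x y, x \in vset G -> y \in vset G -> connect (adj G) x y) (connected G).
Proof.
apply: (iffP andP) => -[-> H]; split=> //.
  by move=> x y xG yG; exact: (forall_inP (forall_inP H x xG) y yG).
by apply/forall_inP => x xG; apply/forall_inP => y; exact: H.
Qed.

Lemma vset_path s : vset (path_graph s) = [set x in s].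
Proof. by []. Qed.

Lemma adj_path s x y : adj (path_graph s) x y ->
  (x, y) \in zip s (behead s) \/ (y, x) \in zip s (behead s).
Proof.
rewrite adj_mk => /and4P[/imsetP[[a b] /= abz E] xy _ _].
have [xa xb] : (x \in [set a; b]) /\ y \in [set a; b] by rewrite -E !inE !eqxx orbT.
move: xa xb; rewrite !inE => /orP[/eqP Ex|/eqP Ex] /orP[/eqP Ey|/eqP Ey]; subst x y.
- by rewrite eqxx in xy.
- by left.
- by right.
- by rewrite eqxx in xy.
Qed.

Lemma zip_mem s p a b : (a, b) \in zip s p -> a \in s /\ b \in p.
Proof.
elim: s p => [|x s IH] [|y p] //=; rewrite inE => /orP[/eqP[-> ->]|/IH[a1 b1]].
  by rewrite !mem_head.
by rewrite !inE a1 b1 !orbT.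
Qed.

Lemma zip_sorted (e : rel T) s a b : sorted e s -> (a, b) \in zip s (behead s) -> e a b.
Proof.
case: s => // x s /=; elim: s x => //= y s IH x /andP[exy ps].
by rewrite inE => /orP[/eqP[-> ->]//|/IH]; apply.
Qed.

Lemma sorted_path_graph s : uniq s -> sorted (adj (path_graph s)) s.
Proof.
move=> us; suff H a b : (a, b) \in zip s (behead s) -> adj (path_graph s) a b.
  case: s us H => // x s us H /=.
  suff: forall x0 s0, (forall a b, (a, b) \in zip (x0 :: s0) s0 -> adj (path_graph (x :: s)) a b) ->
     path (adj (path_graph (x :: s))) x0 s0 by apply; exact: H.
  move=> x0 s0; elim: s0 x0 => //= y s0 IH x0 H0; rewrite H0 ?mem_head //=.
  by apply: IH => a b ab; apply: H0; rewrite inE ab orbT.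
move=> ab; rewrite adj_mk; apply/and4P; split.
- by apply/imsetP; exists (a, b).
- case: s us ab => // x s; elim: s x => //= y s IH x /andP[xys us].
  rewrite inE => /orP[/eqP[-> ->]|/IH]; last by apply.
  by apply: contraNneq xys => ->; rewrite mem_head.
- by have [] := zip_mem ab; rewrite inE.
- by have [_] := zip_mem ab; rewrite inE => /mem_behead.
Qed.

Lemma path_graph_sub G s : sorted (adj G) s -> {subset s <= vset G} ->
  subgraph (path_graph s) G.
Proof.
move=> ss sG; apply/subgraphP; split=> [x|x y]; first by rewrite inE => /sG.
by case/adj_path=> /(zip_sorted ss) //; rewrite adj_sym.
Qed.

Lemma adj_cycle c x y : adj (cycle_graph c) x y -> 
  (x \in c /\ y = next c x) \/ (y \in c /\ x = next c y).
Proof.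
rewrite adj_mk => /and4P[/imsetP[a ac E] xy _ _].
have [xa xb] : (x \in [set a; next c a]) /\ y \in [set a; next c a].
  by rewrite -E !inE !eqxx orbT.
move: xa xb; rewrite !inE => /orP[/eqP Ex|/eqP Ex] /orP[/eqP Ey|/eqP Ey]; subst x y.
- by rewrite eqxx in xy.
- by left.
- by right.
- by rewrite eqxx in xy.
Qed.

Lemma cycle_cycle_graph c : uniq c -> 1 < size c -> cycle (adj (cycle_graph c)) c.
Proof.
move=> uc sc; have := cycle_next uc; apply: (sub_in_cycle (P := mem c)); last exact/allP.
move=> x y xc yc /eqP <-; rewrite adj_mk !inE mem_next xc /= andbT; apply/andP; split.
  by apply/imsetP; exists x.
have [k s E] := rot_to xc; rewrite -(next_rot k) // E.
case: s E => [|b s] E; first by move: sc; rewrite -(size_rot k) E.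
by move: uc; rewrite -(rot_uniq k) E /= eqxx inE => /andP[/norP[]].
Qed.

Lemma cycle_graph_sub G c : cycle (adj G) c -> {subset c <= vset G} ->
  subgraph (cycle_graph c) G.
Proof.
move=> cc cG; apply/subgraphP; split=> [x|x y]; first by rewrite inE => /cG.
by case/adj_cycle=> -[xc ->]; [|rewrite adj_sym]; exact: (next_cycle cc).
Qed.

Lemma cycle_vset G c : cycle (adj G) c -> {subset c <= vset G}.
Proof. by move=> cc x xc; have /adjP[] := next_cycle cc xc. Qed.

(** What remains of a cycle after deletion of at most one vertex is traversed by one path. *)
Lemma cycle_kconnected c : uniq c -> 2 < size c -> kconnected 2 (cycle_graph c).
Proof.
move=> uc sc; have cc := cycle_cycle_graph uc (ltnW sc).
apply/andP; split; first by rewrite cardsE (card_uniqP uc).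
apply/forallP => X; apply/implyP => cX.
have [s [ss sm s0]] : exists s, [/\ sorted (adj (cycle_graph c)) s,
    forall v, (v \in s) = (v \in c) && (v \notin X) & s != [::]].
  case: (pickP [pred v in c | v \in X]) => [v /andP[vc vX]|none].
    have [k s E] := rot_to vc; exists s.
    move: cc uc; rewrite -(rot_cycle k) -(rot_uniq k) E => cc /andP[vs us]; split.
    - by move: cc; rewrite /= rcons_path => /andP[/path_sorted].
    - move=> x; have := mem_rot k c x; rewrite E inE => <-.
      have -> : (x \in X) = (x == v).
        apply/idP/eqP => [xX|->//]; have /card_le1_eqP H : #|X| <= 1 by [].
        exact: H.
      case: eqP => //= [->|_]; last by rewrite andbT.
      exact/negbTE.
    - by apply: contraTneq sc => E0; rewrite -(size_rot k) E E0.
  exists c; split=> //; last by case: (c) sc.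
    case: (c) cc => //= a s; rewrite rcons_path => /andP[] //.
  by move=> v; have := none v; rewrite /= => /negbT; case: (v \in c) => //= ->.
apply/connectedP; split.
  case: s s0 ss sm => // a s _ _ sm; apply/set0Pn; exists a.
  by rewrite vset_delete !inE; have := sm a; rewrite mem_head => /esym; rewrite andbC.
move=> x y; rewrite vset_delete !inE ![(_ \notin X) && _]andbC -!sm => xs ys.
apply: (sorted_connect (adj_sym _) _ xs ys).
apply: (sub_in_sorted (P := mem s) _ _ ss); last exact/allP.
by move=> u v /=; rewrite !sm adj_delete => /andP[_ ->] /andP[_ ->] ->.
Qed.

Lemma subgraph_trans A B C : subgraph A B -> subgraph B C -> subgraph A C.
Proof. by move=> /andP[a1 a2] /andP[b1 b2]; rewrite /subgraph (subset_trans a1) ?(subset_trans a2). Qed.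

Lemma sub_gunionl A B : subgraph A (gunion A B).
Proof.
apply/subgraphP; split=> [x|x y exy]; first by rewrite inE => ->.
have [xy xA yA] := adjP exy; rewrite adj_mk xy !inE xA yA !andbT; apply/orP; left.
exact: exy.
Qed.

Lemma sub_gunionr A B : subgraph B (gunion A B).
Proof.
apply/subgraphP; split=> [x|x y exy]; first by rewrite inE orbC => ->.
have [xy xA yA] := adjP exy; rewrite adj_mk xy !inE xA yA !orbT !andbT; apply/orP; right.
exact: exy.
Qed.

Lemma sub_gbigunion (I : finType) (F : I -> graph T) i : subgraph (F i) (gbigunion F).
Proof.
apply/subgraphP; split=> [x xF|x y exy]; first by apply/bigcupP; exists i.
have [xy xA yA] := adjP exy; rewrite adj_mk xy; apply/and4P; split=> //;
  by apply/bigcupP; exists i.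
Qed.

Lemma adj_gunion A B x y : adj (gunion A B) x y -> adj A x y \/ adj B x y.
Proof. by rewrite adj_mk inE => /andP[/orP[|]]; [left | right]. Qed.

Lemma gunion_sub A B G : subgraph A G -> subgraph B G -> subgraph (gunion A B) G.
Proof.
move=> /subgraphP[vA eA] /subgraphP[vB eB]; apply/subgraphP; split=> [x|x y].
  by rewrite inE => /orP[/vA|/vB].
by rewrite adj_mk inE => /andP[/orP[/eA|/eB]].
Qed.

Lemma gbigunion_sub (I : finType) (F : I -> graph T) G :
  (forall i, subgraph (F i) G) -> subgraph (gbigunion F) G.
Proof.
move=> sF; apply/subgraphP; split=> [x /bigcupP[i _ xF]|x y].
  by have /subgraphP[H _] := sF i; exact: H.
by rewrite adj_mk => /andP[/bigcupP[i _ exy] _]; have /subgraphP[_ H] := sF i; exact: H.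
Qed.

End GraphBasics.

(** * Assembling a necklace from beads *)

Section Necklace.
Variables (T : finType) (G : graph T).
Local Notation e := (adj G).

Lemma cycle_two_arcs (r : rel T) x A y A' : symmetric r -> cycle r (x :: A ++ y :: A') ->
  path r x (rcons A y) /\ path r x (rcons (rev A') y).
Proof.
move=> sr; rewrite (cycle_two r) => /andP[p1 p2]; split=> //.
by rewrite (path_rev_sym sr).
Qed.

Lemma interior_rcons (x : T) s y : interior (x :: rcons s y) = s.
Proof. by rewrite /interior /= size_rcons /= -cats1 take_size_cat. Qed.

Variables (l : nat) (x y : 'I_l -> T) (A A' al be mid : 'I_l -> seq T) (Terr : 'I_l -> {set T}).
Hypothesis l_gt0 : 0 < l.
Hypothesis beads : forall i, bead e (x i) (A i) (al i) (y i) (A' i) (be i).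
Hypothesis in_terr : forall i, {subset x i :: al i ++ A i ++ y i :: be i ++ A' i <= Terr i}.
Hypothesis terr_disj : forall i j v, v \in Terr i -> v \in Terr j -> i = j.
Hypothesis mid_path : forall i,
  path e (last (y i) (be i)) (rcons (mid i) (last (x (ordS i)) (al (ordS i)))).
Hypothesis mid_uniq : forall i, uniq (mid i).
Hypothesis mid_terr : forall i j v, v \in mid i -> v \notin Terr j.
Hypothesis mid_disj : forall i j v, v \in mid i -> v \in mid j -> i = j.

(** [K i] is the cycle of the bead. The tails belong to the connecting paths [Q i]: the tail at
    [y i], the middle part, and the next tail at [x] reversed. *)
Let K i := x i :: A i ++ y i :: A' i.
Let M i := be i ++ mid i ++ rev (al (ordS i)).
Let Q i := y i :: rcons (M i) (x (ordS i)).

(** Each bead with its tails lives in its own territory, and the middle parts avoid all territories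
    and each other; all disjointness requirements follow from this. Every one of the [l] beads is
    wiggly. *)
Lemma necklace_of_beads k : k <= l -> exists2 N, subgraph N G & wiggly_necklace k N.
Proof.
move=> kl; pose B i := cycle_graph (K i).
have Kterr i : {subset K i <= Terr i}.
  move=> v vK; apply: in_terr; move: vK; rewrite /K !(mem_cat, inE).
  by case/or4P=> ->; rewrite ?orbT.
have alterr i : {subset al i <= Terr i}.
  by move=> v vK; apply: in_terr; rewrite !(mem_cat, inE) vK ?orbT.
have beterr i : {subset be i <= Terr i}.
  by move=> v vK; apply: in_terr; rewrite !(mem_cat, inE) vK ?orbT.
have uK i : uniq (K i).
  have /and5P[u _ _ _ _] := beads i; apply: subseq_uniq u; rewrite /K /= eqxx.
  apply: subseq_trans (suffix_subseq (al i) _); apply: cat_subseq => //=.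
  by rewrite eqxx suffix_subseq.
have usplit i : [/\ uniq (al i), uniq (be i), {in al i, forall v, v \notin K i},
    {in be i, forall v, v \notin K i} & {in al i, forall v, v \notin be i}].
  have /and5P[u _ _ _ _] := beads i.
  have : uniq ((al i ++ be i) ++ K i).
    move: u; rewrite (perm_uniq (s2 := (al i ++ be i) ++ K i)) //.
    apply/permP => P; rewrite /K /= !count_cat /= !count_cat /=.
    move: (count P (al i)) (count P (be i)) (count P (A i)) (count P (A' i)) (P (x i)) (P (y i)).
    by clear; lia.
  rewrite !cat_uniq => /and3P[/and3P[ua /hasPn H1 ub] /hasPn H2 _]; split=> // v va.
  - by apply/negP => /H2; rewrite /= mem_cat va.
  - by apply/negP => /H2; rewrite /= mem_cat va orbT.
  - by apply/negP => /H1; rewrite /= va.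
have MK i j v : v \in M i -> v \notin K j.
  rewrite !mem_cat mem_rev => /or3P[vb|vm|va]; apply/negP => vK.
  - have E := terr_disj (beterr _ _ vb) (Kterr _ _ vK); subst j.
    by have [_ _ _ /(_ v vb)] := usplit i; rewrite vK.
  - by have := mid_terr j vm; rewrite (Kterr _ _ vK).
  - have E := terr_disj (alterr _ _ va) (Kterr _ _ vK); subst j.
    by have [_ _ /(_ v va)] := usplit (ordS i); rewrite vK.
have ordSI : injective (@ordS l) by exact: can_inj (@ordSK l).
have MM i j v : v \in M i -> v \in M j -> i = j.
  rewrite !mem_cat !mem_rev => /or3P[v1|v1|v1] /or3P[v2|v2|v2].
  - exact: terr_disj (beterr _ _ v1) (beterr _ _ v2).
  - by have := mid_terr i v2; rewrite beterr.
  - have E := terr_disj (beterr _ _ v1) (alterr _ _ v2).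
    by have [_ _ _ _ /(_ v v2)] := usplit (ordS j); rewrite -E v1.
  - by have := mid_terr j v1; rewrite beterr.
  - exact: mid_disj v1 v2.
  - by have := mid_terr (ordS j) v1; rewrite alterr.
  - have E := terr_disj (alterr _ _ v1) (beterr _ _ v2).
    by have [_ _ _ _ /(_ v v1)] := usplit (ordS i); rewrite E v2.
  - by have := mid_terr (ordS i) v2; rewrite alterr.
  - by apply: ordSI; exact: terr_disj (alterr _ _ v1) (alterr _ _ v2).
have xK i : x i \in K i by exact: mem_head.
have yK i : y i \in K i by rewrite inE mem_cat mem_head !orbT.
have xy i : x i != y i.
  by have := uK i; rewrite /K /= mem_cat inE !negb_or => /andP[/and3P[]].
have KK i j v : v \in K i -> v \in K j -> i = j.
  by move=> v1 v2; exact: terr_disj (Kterr _ _ v1) (Kterr _ _ v2).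
have QP v i : v \in Q i -> [\/ v = y i, v \in M i | v = x (ordS i)].
  rewrite inE mem_rcons inE => /or3P[/eqP->|/eqP->|vM]; [by constructor 1|by constructor 3|].
  by constructor 2.
have uQ i : uniq (Q i).
  rewrite /Q cons_uniq rcons_uniq mem_rcons inE negb_or.
  apply/and3P; split.
  - apply/andP; split; last by apply/negP => /(@MK _ i); rewrite yK.
    apply/eqP => E; have EK : i = ordS i by apply: (KK _ _ (y i)) => //; rewrite E.
    by have := xy i; rewrite E -EK eqxx.
  - by apply/negP => /(@MK _ (ordS i)); rewrite xK.
  - rewrite /M cat_uniq cat_uniq mid_uniq rev_uniq.
    have [ua ub _ _ H] := usplit i; have [ua' _ _ _ _] := usplit (ordS i).
    rewrite ub ua' andbT /=; apply/andP; split.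
      apply/hasPn => v; rewrite mem_cat mem_rev => /orP[vm|va]; apply/negP => /= vb.
        by have := mid_terr i vm; rewrite beterr.
      have E := terr_disj (beterr _ _ vb) (alterr _ _ va).
      by rewrite -E in va; have := H v va; rewrite vb.
    apply/hasPn => v; rewrite mem_rev => va; apply/negP => /= vm.
    by have := mid_terr (ordS i) vm; rewrite alterr.
have sQ i : sorted e (Q i).
  have /and5P[_ _ _ pb _] := beads i; have /and5P[_ _ pa _ _] := beads (ordS i).
  have := mid_path i; rewrite -cats1 cat_path /= andbT => /andP[pm em].
  rewrite /= /M !rcons_cat cat_path pb cat_path pm /=.
  have := rev_path e (x (ordS i)) (al (ordS i)).
  rewrite (eq_path (e' := e)); last by move=> u v; exact: adj_sym.
  rewrite pa; case/lastP: (al (ordS i)) em => [|s u] /=; first by rewrite andbT.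
  by rewrite last_rcons rev_rcons belast_rcons /= rev_cons => ->.
have cK i : cycle e (K i) by have /and5P[_ ->] := beads i.
have szK i : 2 < size (K i).
  have /and5P[_ _ _ _] := beads i; rewrite /near /K /= size_cat /=.
  by move: (size (A i)) (size (A' i)); clear; lia.
have BG i : subgraph (B i) G by apply: cycle_graph_sub (cK i) (cycle_vset (cK i)).
have QG i : {subset Q i <= vset G}.
  case: l_gt0 => _ v; move: (sQ i); rewrite /Q /=; move: (rcons _ _) (size_rcons (M i) (x (ordS i))) => s.
  case: s => // u s _ /= /andP[eyu ps]; rewrite !inE => /or3P[/eqP->|/eqP->|vs].
  - by have [] := adjP eyu.
  - by have [] := adjP eyu.
  - elim: s u ps vs {eyu} => //= t s IH u /andP[eut pt]; rewrite inE => /orP[/eqP->|].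
      by have [] := adjP eut.
    exact: (IH t pt).
pose N := gunion (gbigunion B) (gbigunion (fun i => path_graph (Q i))).
have BN i : subgraph (B i) N by apply: subgraph_trans (sub_gbigunion B i) (sub_gunionl _ _).
have QN i : subgraph (path_graph (Q i)) N.
  by apply: subgraph_trans (sub_gbigunion (fun i => path_graph (Q i)) i) (sub_gunionr _ _).
exists N.
  apply: gunion_sub; apply: gbigunion_sub => i; first exact: BG.
  exact: path_graph_sub (sQ i) (QG i).
exists l, B, Q; split=> //.
- split.
  + by [].
  + split=> [i|i j ij]; first exact: cycle_kconnected.
    apply/pred0P => v /=; apply/negP => /andP[]; rewrite !inE => v1 v2.
    by rewrite (KK _ _ _ v1 v2) eqxx in ij.
  + move=> i j ij; apply/pred0P => v /=; apply/negP => /andP[].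
    rewrite !vset_path ![v \in [set _ in _]]inE => /QP v1 /QP v2; case/negP: ij; apply/eqP.
    case: v1 => [v1|v1|v1]; case: v2 => [v2|v2|v2]; subst.
    * by apply: (KK _ _ (y i)); rewrite // v2.
    * by have := MK _ i _ v2; rewrite yK.
    * have E : i = ordS j by apply: (KK _ _ (y i)); rewrite // v2.
      by have := xy i; rewrite v2 -E eqxx.
    * by have := MK _ j _ v1; rewrite yK.
    * exact: MM v1 v2.
    * by have := MK _ (ordS j) _ v1; rewrite xK.
    * have E : ordS i = j by apply: (KK _ _ (x (ordS i))); rewrite // v2.
      by have := xy j; rewrite -v2 E eqxx.
    * by have := MK _ (ordS i) _ v2; rewrite xK.
    * by apply: ordSI; apply: (KK _ _ (x (ordS i))); rewrite // v2.
  + move=> i; apply/andP; split; last first.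
      rewrite interior_rcons; apply/forall_inP => v vM.
      by rewrite !inE negb_or !(MK _ _ _ vM).
    apply/exists_inP; exists (y i); first by rewrite inE.
    apply/exists_inP; exists (x (ordS i)); first by rewrite inE.
    have /subgraphP[vN eN] := QN i; apply/and5P; split=> //.
    * by rewrite /= last_rcons.
    * by apply/subsetP => v; exact: vN.
    * by apply: sub_sorted (sorted_path_graph (uQ i)) => u v; exact: eN.
  + move=> i j; rewrite interior_rcons; apply/pred0P => v /=; apply/negP => /andP[vM].
    by rewrite inE; apply/negP; exact: MK vM.
- exists [set: 'I_l]; first by rewrite cardsT card_ord.
  move=> i _; exists (x i), (y i); split=> //.
    apply/setP => v; rewrite [LHS]in_set in_set2.
    have -> : (v \in vset (B i)) = (v \in K i) by rewrite /B vset_mk in_set.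
    apply/andP/orP => [[vK /existsP[j /QP]]|].
      case=> [E|vM|E].
      * by right; rewrite E (KK i j v) // E.
      * by have := MK _ i _ vM; rewrite vK.
      * by left; rewrite E -(KK i (ordS j) v) // E.
    case=> /eqP->; split=> //; apply/existsP.
      by exists (ord_pred i); rewrite inE mem_rcons inE ord_predK eqxx orbT.
    by exists i; rewrite mem_head.
  have cB := cycle_cycle_graph (uK i) (ltnW (szK i)).
  (* The two arcs of the bead are the paths whose lengths differ by 1 or 2; which is longer depends
     on the case of [near]. *)
  have [p1 p2] := cycle_two_arcs (adj_sym (B i)) cB.
  have gp1 : gpath (B i) (x i) (y i) (x i :: rcons (A i) (y i)).
    apply/and5P; split=> //; first by rewrite /= last_rcons.
      apply: subseq_uniq (uK i); rewrite /= eqxx -cats1; apply: cat_subseq => //=.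
      by rewrite eqxx sub0seq.
    apply/subsetP => v; rewrite !inE mem_rcons !(inE, mem_cat) => /or3P[->|->|->]; rewrite ?orbT //.
  have gp2 : gpath (B i) (x i) (y i) (x i :: rcons (rev (A' i)) (y i)).
    apply/and5P; split=> //; first by rewrite /= last_rcons.
      have : uniq (x i :: rcons (A' i) (y i)).
        rewrite (perm_uniq (s2 := x i :: y i :: A' i)); last by rewrite perm_cons perm_rcons.
        by apply: subseq_uniq (uK i); rewrite /= eqxx; exact: suffix_subseq.
      by rewrite /= !rcons_uniq !mem_rcons !inE !mem_rev rev_uniq.
    apply/subsetP => v; rewrite !inE mem_rcons !(inE, mem_cat, mem_rev) => /or3P[->|->|->]; rewrite ?orbT //.
  have /and5P[_ _ _ _] := beads i; rewrite /near => /or4P[]/eqP nr.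
  + exists (x i :: rcons (A i) (y i)), (x i :: rcons (rev (A' i)) (y i)).
    by split=> //; left; rewrite /plen /= !size_rcons size_rev nr addn1.
  + exists (x i :: rcons (A i) (y i)), (x i :: rcons (rev (A' i)) (y i)).
    by split=> //; right; rewrite /plen /= !size_rcons size_rev nr addn2.
  + exists (x i :: rcons (rev (A' i)) (y i)), (x i :: rcons (A i) (y i)).
    by split=> //; left; rewrite /plen /= !size_rcons size_rev nr addn1.
  + exists (x i :: rcons (rev (A' i)) (y i)), (x i :: rcons (A i) (y i)).
    by split=> //; right; rewrite /plen /= !size_rcons size_rev nr addn2.
Qed.

End Necklace.

(** * The number of edges of a path *)

Section PathEdges.
Variable T : finType.
Implicit Types (s : seq T) (x y : T).

Lemma card_path_edges_le s : #|eset (path_graph s)| <= (size s).-1.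
Proof.
rewrite eset_mk; apply: leq_trans (_ : #|[set [set d.1; d.2] | d in zip s (behead s)]| <= _).
  by apply: subset_leq_card; apply/subsetP => A; rewrite inE => /andP[].
apply: leq_trans (leq_imset_card _ _) _; apply: leq_trans (card_size _) _.
by rewrite size_zip size_behead geq_minr.
Qed.

Lemma card_path_edges_ge s : uniq s -> (size s).-1 <= #|eset (path_graph s)|.
Proof.
elim: s => // x [|y s] IH //= /andP[xys us].
have {}IH := IH us; set E := eset (path_graph (y :: s)) in IH *.
have nE : [set x; y] \notin E.
  apply/negP => xE; have /adjP[_ xV _] : adj (path_graph (y :: s)) x y := xE.
  by rewrite inE (negPf xys) in xV.
apply: leq_trans (_ : #|[set x; y] |: E| <= _).
  by rewrite cardsU1 nE add1n ltnS.
apply: subset_leq_card; apply/subsetP => A; rewrite in_setU1.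
have us' : uniq (x :: y :: s) by rewrite /= xys.
case/orP=> [/eqP->|/esetP[a [b [-> ab]]]].
  by have /andP[] := sorted_path_graph us'.
have [abn aV bV] := adjP ab; rewrite -/(adj (path_graph (x :: y :: s)) a b) adj_mk abn.
have H z : z \in vset (path_graph (y :: s)) -> z \in [set t in x :: y :: s].
  by rewrite vset_path !in_set (in_cons x) => ->; rewrite orbT.
rewrite !H // !andbT; move: ab; rewrite adj_mk => /andP[/imsetP[d dz ->] _].
by apply/imsetP; exists d; rewrite //= inE; move: dz => /= ->; rewrite orbT.
Qed.

End PathEdges.

(** * The legs of a theta graph in a cubic graph *)

Section Theta.
Variables (T : finType) (G : graph T) (Th : theta T).
Hypothesis Th_in : theta_in G Th.
Local Notation e := (adj G).
Local Notation u := (th_u Th).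
Local Notation v := (th_v Th).

Definition leg (i : 'I_3) : seq T := nth [::] (legs Th) i.
Definition inner (i : 'I_3) : seq T := interior (leg i).
Definition theta_set : {set T} := vset (theta_graph Th).

Lemma leg_gpath i : gpath G u v (leg i).
Proof. by have /and3P[_ /all_nthP H _] := Th_in; apply: H. Qed.

Lemma th_uv : u != v. Proof. by have /and3P[] := Th_in. Qed.

Lemma legE i : leg i = u :: rcons (inner i) v.
Proof.
have := leg_gpath i; rewrite /inner; case: (leg i) => [|x s] /and5P[] // /eqP[->] lv _ _ _.
case/lastP: s lv => [|s y]; first by rewrite /= (negPf th_uv).
by rewrite /= last_rcons => /eqP->; rewrite interior_rcons.
Qed.

Lemma leg_path i : path e u (rcons (inner i) v).
Proof. by have := leg_gpath i; rewrite legE => /and5P[]. Qed.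

Lemma leg_uniq i : uniq (u :: rcons (inner i) v).
Proof. by have := leg_gpath i; rewrite legE => /and5P[]. Qed.

Lemma inner_uniq i : uniq (inner i).
Proof. by have := leg_uniq i; rewrite cons_uniq rcons_uniq => /and3P[]. Qed.

Lemma inner_nu i : u \notin inner i.
Proof. by have := leg_uniq i; rewrite cons_uniq mem_rcons inE => /andP[/norP[]]. Qed.

Lemma inner_nv i : v \notin inner i.
Proof. by have := leg_uniq i; rewrite cons_uniq rcons_uniq => /and3P[]. Qed.

Lemma legs_distinct i j : i != j -> leg i != leg j /\ [disjoint inner i & inner j].
Proof.
have /and3P[_ _] := Th_in => /(pairwiseP [::]) H.
wlog ij : i j / i < j.
  move=> W ij; case: (ltngtP i j) => [lt|lt|E]; first exact: W.
    by rewrite eq_sym disjoint_sym; apply: W; rewrite // eq_sym.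
  by case/negP: ij; apply/eqP/val_inj.
by move=> _; have /andP[] := H i j (ltn_ord i) (ltn_ord j) ij.
Qed.

Lemma inner_disj i j x : x \in inner i -> x \in inner j -> i = j.
Proof.
move=> xi xj; apply/eqP; apply: contraT => /legs_distinct[_ D].
by rewrite (disjointFr D xi) in xj.
Qed.

Lemma inner_nil_eq i j : inner i = [::] -> inner j = [::] -> i = j.
Proof.
move=> i0 j0; apply/eqP; apply: contraT => /legs_distinct[].
by rewrite !legE i0 j0 eqxx.
Qed.

Lemma ord3_all (P : 'I_3 -> Prop) : P (inord 0) -> P (inord 1) -> P (inord 2) -> forall i, P i.
Proof.
move=> p0 p1 p2 [[|[|[|m]]] mi] //.
- by rewrite (_ : Ordinal mi = inord 0) //; apply: val_inj; rewrite /= inordK.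
- by rewrite (_ : Ordinal mi = inord 1) //; apply: val_inj; rewrite /= inordK.
- by rewrite (_ : Ordinal mi = inord 2) //; apply: val_inj; rewrite /= inordK.
Qed.

Lemma theta_adj x y : adj (theta_graph Th) x y <-> exists i, adj (path_graph (leg i)) x y.
Proof.
have sub1 := sub_gunionl (path_graph (leg1 Th)) (gunion (path_graph (leg2 Th)) (path_graph (leg3 Th))).
have sub2 := subgraph_trans (sub_gunionl (path_graph (leg2 Th)) (path_graph (leg3 Th)))
  (sub_gunionr (path_graph (leg1 Th)) _).
have sub3 := subgraph_trans (sub_gunionr (path_graph (leg2 Th)) (path_graph (leg3 Th)))
  (sub_gunionr (path_graph (leg1 Th)) _).
split.
  case/adj_gunion=> [H|/adj_gunion[H|H]].
  - by exists (inord 0); rewrite /leg inordK.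
  - by exists (inord 1); rewrite /leg inordK.
  - by exists (inord 2); rewrite /leg inordK.
case; apply: ord3_all; rewrite /leg inordK //= => H.
- by have /subgraphP[_] := sub1; apply.
- by have /subgraphP[_] := sub2; apply.
- by have /subgraphP[_] := sub3; apply.
Qed.

Lemma theta_vset x : reflect (exists i, x \in leg i) (x \in theta_set).
Proof.
have -> : (x \in theta_set) = [|| x \in leg1 Th, x \in leg2 Th | x \in leg3 Th] by rewrite !inE.
apply: (iffP or3P) => [[] H|[i]].
- by exists (inord 0); rewrite /leg inordK.
- by exists (inord 1); rewrite /leg inordK.
- by exists (inord 2); rewrite /leg inordK.
- move: i; apply: ord3_all; rewrite /leg inordK //= => H;
    [by constructor 1|by constructor 2|by constructor 3].
Qed.

Lemma inner_theta i x : x \in inner i -> x \in theta_set.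
Proof. by move=> xi; apply/theta_vset; exists i; rewrite legE inE mem_rcons inE xi !orbT. Qed.

Lemma u_theta : u \in theta_set.
Proof. by apply/theta_vset; exists ord0; rewrite legE mem_head. Qed.
Lemma v_theta : v \in theta_set.
Proof. by apply/theta_vset; exists ord0; rewrite legE inE mem_rcons mem_head orbT. Qed.

Lemma theta_cases x : x \in theta_set -> [\/ x = u, x = v | exists i, x \in inner i].
Proof.
case/theta_vset=> i; rewrite legE inE mem_rcons inE => /or3P[/eqP->|/eqP->|xi].
- by constructor 1.
- by constructor 2.
- by constructor 3; exists i.
Qed.

Hypothesis G_cubic : cubic G.

Lemma cubic_nbrs x s : uniq s -> all (e x) s -> size s <= 3.
Proof.
case: s => // y s us al; have /adjP[_ xG _] : e x y by case/andP: al.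
have /eqP <- := forall_inP G_cubic x xG; rewrite -(card_uniqP us).
by apply: subset_leq_card; apply/subsetP => z /(allP al); rewrite inE.
Qed.

(** Three distinct neighbours inside the theta graph exhaust the degree of [x]. *)
Lemma end_no_outside (f : 'I_3 -> T) x y :
  (forall i, e x (f i)) -> (forall i j, f i = f j -> i = j) ->
  (forall i, f i \in theta_set) -> e x y -> y \in theta_set.
Proof.
move=> ef fi fT exy; apply: contraT => yT.
have := @cubic_nbrs x (y :: map f (enum 'I_3)); rewrite /= size_map size_enum_ord exy.
have -> : all (e x) (map f (enum 'I_3)) by apply/allP => z /mapP[i _ ->].
rewrite map_inj_uniq ?enum_uniq ?andbT; last by move=> i j; exact: fi.
by case: (y \in _) / mapP => [[i _ E]|_ /(_ isT isT)//]; rewrite E fT in yT.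
Qed.

Lemma u_closed y : e u y -> y \in theta_set.
Proof.
(* A leg consisting of the edge [uv] contributes the default [v]; there is at most one such leg. *)
apply: (@end_no_outside (fun i => head v (inner i))) => [i|i j|i].
- by have := leg_path i; case: (inner i) => //= [|a s] /andP[].
- have := inner_nil_eq (i := i) (j := j); have := @inner_disj i j.
  have := inner_nv i; have := inner_nv j.
  case: (inner i) => [|a s]; case: (inner j) => [|b t] //=.
  + by move=> _ _ _ H _; exact: H.
  + by move=> /[swap] _ /[swap] _ H _ E; rewrite E mem_head in H.
  + by move=> _ H _ _ E; rewrite -E mem_head in H.
  + by move=> _ _ H _ E; apply: (H a); rewrite ?E mem_head.
- case E: (inner i) => [|a s] /=; first exact: v_theta.
  by apply: (@inner_theta i); rewrite E mem_head.
Qed.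

Lemma v_closed y : e v y -> y \in theta_set.
Proof.
apply: (@end_no_outside (fun i => last u (inner i))) => [i|i j|i].
- by have := leg_path i; rewrite rcons_path adj_sym => /andP[].
- have := inner_nil_eq (i := i) (j := j); have := @inner_disj i j.
  have := inner_nu i; have := inner_nu j.
  case/lastP: (inner i) => [|s a]; case/lastP: (inner j) => [|t b]; rewrite ?last_rcons //=.
  + by move=> _ _ _ H _; exact: H.
  + by move=> /[swap] _ /[swap] _ H _ E; rewrite E mem_rcons mem_head in H.
  + by move=> _ H _ _ E; rewrite -E mem_rcons mem_head in H.
  + by move=> _ _ H _ E; apply: (H a); rewrite ?E mem_rcons mem_head.
- case/lastP E: (inner i) => [|s a] /=; first exact: u_theta.
  by rewrite last_rcons; apply: (@inner_theta i); rewrite E mem_rcons mem_head.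
Qed.

(** The leg itself uses two of the three edges at [p]. *)
Lemma inner_outside1 i p y y' : p \in inner i -> e p y -> e p y' ->
  y \notin theta_set -> y' \notin theta_set -> y = y'.
Proof.
move=> pin epy epy' yT y'T; apply/eqP; apply: contraT => yy.
have [m1 [m2 Em]] : exists m1 m2, inner i = m1 ++ p :: m2.
  by case/splitPr: pin => m1 m2; exists m1, m2.
pose a := last u m1; pose b := head v m2.
have := leg_path i; rewrite Em rcons_cat rcons_cons cat_path /= => /and3P[_ ap pb].
have epb : e p b by move: pb; rewrite /b; case: (m2) => [|b' s] /= /andP[].
have epa : e p a by rewrite adj_sym.
have := leg_uniq i; rewrite Em rcons_cat rcons_cons -cat_cons cat_uniq.
case/and3P=> _ /hasPn H _.
have la : a \in u :: m1 by exact: mem_last.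
have lb : b \in rcons m2 v by rewrite /b; case: (m2) => [|b' s]; rewrite ?mem_head.
have ab : a != b.
  by apply/eqP => E; have := H b; rewrite inE lb orbT -E => /(_ isT) /=; rewrite la.
have aT : a \in theta_set.
  apply/theta_vset; exists i; rewrite legE Em rcons_cat -cat_cons mem_cat la //.
have bT : b \in theta_set.
  by apply/theta_vset; exists i; rewrite legE Em rcons_cat rcons_cons !(inE, mem_cat) lb !orbT.
have neq x z : x \in theta_set -> z \notin theta_set -> x != z.
  by move=> xT; apply: contraNneq => <-.
have := @cubic_nbrs p [:: a; b; y; y'].
by rewrite /= !inE !negb_or ab yy epa epb epy epy' !neq // => /(_ isT isT).
Qed.

End Theta.

(** * Shortness: detours cannot shorten a leg *)

Section Detour.
Variables (T : finType) (G : graph T) (Th : theta T).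
Hypothesis Th_short : short_theta G Th.
Local Notation e := (adj G).
Local Notation u := (th_u Th).
Local Notation v := (th_v Th).
Let Th_in : theta_in G Th. Proof. by case: Th_short. Qed.

Lemma theta_in_legs (f : 'I_3 -> seq T) :
  (forall i, gpath G u v (f i)) ->
  (forall i j, i != j -> (f i != f j) && [disjoint interior (f i) & interior (f j)]) ->
  let Th' := Theta u v (f (inord 0)) (f (inord 1)) (f (inord 2)) in
  theta_in G Th' /\ forall i, leg Th' i = f i.
Proof.
move=> gp df Th'; split; last by apply: ord3_all; rewrite /leg inordK.
have neq a b : a < 3 -> b < 3 -> a != b -> (inord a : 'I_3) != inord b.
  by move=> a3 b3; apply: contra => /eqP/(congr1 val); rewrite /= !inordK // => ->.
apply/and3P; split; [exact: th_uv Th_in|by rewrite /= !gp|].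
by rewrite /= !df ?neq.
Qed.

Lemma subseq_middle m1 (s : T) m2 t m3 y :
  subseq (s :: rcons m2 t) (rcons (m1 ++ s :: m2 ++ t :: m3) y).
Proof.
rewrite -[rcons (_ ++ _) _]cats1; apply: subseq_trans (prefix_subseq _ _).
apply: subseq_trans (suffix_subseq m1 _); rewrite /= eqxx -cats1.
by apply: cat_subseq => //=; rewrite eqxx sub0seq.
Qed.

Lemma arc_edges (M : pred T) x p y : all M p -> p != [::] ->
  path (fun a b => M a || M b) x (rcons p y).
Proof.
case: p => //= a p /andP[Ma al] _; rewrite Ma orbT /=.
elim: p a Ma al => [|b p IH] a Ma /=; first by rewrite Ma.
by case/andP=> Mb al; rewrite Ma /= IH.
Qed.

(** Replacing [m2] by [r] gives another theta graph with the same ends, which has at least as many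
    edges by minimality. *)
Lemma theta_detour i m1 s m2 t m3 r : inner Th i = m1 ++ s :: m2 ++ t :: m3 ->
  r != [::] -> uniq r -> {in r, forall x, x \notin theta_set Th} ->
  path e s (rcons r t) -> size m2 <= size r.
Proof.
move=> Ei r0 ur rT pr; have [->//|m20] := eqVneq m2 [::].
pose new := u :: rcons (m1 ++ s :: r ++ t :: m3) v.
pose f j := if j == i then new else leg Th j.
have Eleg : leg Th i = u :: rcons (m1 ++ s :: m2 ++ t :: m3) v by rewrite (legE Th_in) Ei.
have pl := leg_path Th_in i; have ul := leg_uniq Th_in i; rewrite Ei in pl ul.
have newP x : x \in new -> x \in leg Th i \/ x \in r.
  rewrite /new Eleg !(inE, mem_rcons, mem_cat).
  by case/or3P=> [->|->|/or3P[->|->|/or3P[->|->|->]]]; rewrite ?orbT; auto.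
have intnew : interior new = m1 ++ s :: r ++ t :: m3 by rewrite interior_rcons.
have gnew : gpath G u v new.
  apply/and5P; split=> //.
  - by rewrite /= last_rcons.
  - have ss : subseq (u :: rcons (m1 ++ s :: t :: m3) v) (u :: rcons (m1 ++ s :: m2 ++ t :: m3) v).
      rewrite /= eqxx -!cats1 -!catA; apply: cat_subseq => //=; rewrite eqxx -catA.
      exact: suffix_subseq.
    have uss := subseq_uniq ss ul.
    rewrite (perm_uniq (s2 := r ++ (u :: rcons (m1 ++ s :: t :: m3) v))); last first.
      apply/permP => P; rewrite /new -!cats1; do 5! rewrite /= ?count_cat.
      move: (count P m1) (count P r) (count P m3) (P u : nat) (P s : nat) (P t : nat) (P v : nat).
      by clear; lia.
    rewrite cat_uniq ur uss andbT; apply/hasPn => x /(mem_subseq ss) xl.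
    apply/negP => /rT/negP[]; apply/theta_vset; exists i; rewrite Eleg //.
  - apply/subsetP => x; rewrite inE => /newP[xl|xr].
      have /and5P[_ _ _ /subsetP H _] := leg_gpath Th_in i; apply: H; rewrite inE //.
    case/splitPr: xr pr => r1 r2; rewrite rcons_cat cat_path /= => /and3P[_ H _].
    by have [] := adjP H.
  - rewrite /new /=; move: pl; rewrite !rcons_cat !cat_path !rcons_cons /=.
    case/and3P=> -> -> /=; rewrite !rcons_cat !cat_path /= => /and3P[_ _ pm3].
    have /andP[-> ->] : path e s r && e (last s r) t by rewrite -rcons_path.
    by [].
have df j k : j != k -> (f j != f k) && [disjoint interior (f j) & interior (f k)].
  have H j' : j' != i -> (new != leg Th j') && [disjoint interior new & interior (leg Th j')].
    move=> j'i; apply/andP; split.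
      have [x xr] : exists x, x \in r.
        by case: (r) r0 => // x r' _; exists x; rewrite mem_head.
      apply/eqP => E; case/negP: (rT x xr); apply/theta_vset; exists j'.
      by rewrite -E /new !(inE, mem_rcons, mem_cat) xr !orbT.
    apply/pred0P => x /=; apply/negP => /andP[]; rewrite intnew => xn xj.
    have xjl : x \in inner Th j' by [].
    have [xi|xr] : x \in inner Th i \/ x \in r.
      move: xn; rewrite Ei !(inE, mem_cat).
      by case/or3P=> [->|->|/or3P[->|->|->]]; rewrite ?orbT; auto.
      by case/eqP: j'i; exact: (inner_disj Th_in xjl xi).
    by case/negP: (rT x xr); exact: (inner_theta Th_in xjl).
  rewrite /f; case: (j =P i) => [->|/eqP ji]; case: (k =P i) => [->|/eqP ki] jk.
  - by rewrite eqxx in jk.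
  - exact: H.
  - by rewrite eq_sym disjoint_sym; exact: H.
  - by have [-> ->] := legs_distinct Th_in jk.
have gf j : gpath G u v (f j) by rewrite /f; case: ifP => // _; exact: (leg_gpath Th_in).
have [Th'_in Th'_leg] := theta_in_legs gf df.
set Th' := Theta _ _ _ _ _ in Th'_in Th'_leg.
have le : #|eset (theta_graph Th)| <= #|eset (theta_graph Th')| by case: Th_short => _; apply.
(* The edges removed and the edges added by the exchange: at least [size m2 + 1] and at most
   [size r + 1]. *)
pose S := eset (path_graph (s :: rcons m2 t)); pose R := eset (path_graph (s :: rcons r t)).
have cR : #|R| <= (size r).+1 by apply: leq_trans (card_path_edges_le _) _; rewrite /= size_rcons.
have um2 : uniq (s :: rcons m2 t).
  by apply: subseq_uniq ul; apply: subseq_trans (subseq_cons _ _); exact: subseq_middle.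
have cS : (size m2).+1 <= #|S|.
  by apply: leq_trans (card_path_edges_ge um2); rewrite /= size_rcons.
have leg_sorted : path (adj (path_graph (leg Th i))) u (rcons (m1 ++ s :: m2 ++ t :: m3) v).
  have uleg : uniq (leg Th i) by rewrite Eleg.
  by have := sorted_path_graph uleg; set adj0 := adj _; rewrite Eleg.
have SE : S \subset eset (theta_graph Th).
  apply/subsetP => A /esetP[x [y [-> xy]]]; apply/(theta_adj Th); exists i.
  have /subgraphP[_ H] : subgraph (path_graph (s :: rcons m2 t)) (path_graph (leg Th i)).
    apply: path_graph_sub; last first.
      move=> z zs; rewrite vset_path in_set Eleg; move: zs; rewrite !(inE, mem_rcons, mem_cat).
      by case/or3P=> ->; rewrite ?orbT.
    rewrite [sorted _ _]/= rcons_path; move: leg_sorted.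
    rewrite rcons_cat cat_path rcons_cons /= => /and3P[_ _].
    by rewrite rcons_cat cat_path /= => /and3P[-> ->].
  exact: H.
have sub : eset (theta_graph Th') \subset (eset (theta_graph Th) :\: S) :|: R.
  apply/subsetP => A AE; have [x [y [EA xy]]] := esetP AE; rewrite {}EA in AE *.
  have [j] := (theta_adj Th' x y).1 xy; rewrite Th'_leg => xyj.
  (* Every removed edge has an end in [m2], and the new legs avoid [m2]. *)
  have inS_false z : z \in f j -> z \in m2 -> False.
    move=> zf zm; have zi : z \in inner Th i by rewrite Ei !(inE, mem_cat) zm !orbT.
    move: zf; rewrite /f; case: (j =P i) => [_|/eqP ji].
      have zr : z \notin r by apply/negP => /rT/negP[]; exact: (inner_theta Th_in zi).
      move: ul; rewrite (perm_uniq (s2 := m2 ++ (u :: rcons (m1 ++ s :: t :: m3) v))); last first.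
        apply/permP => P; rewrite -!cats1; do 5! rewrite /= ?count_cat.
        move: (count P m1) (count P m2) (count P m3) (P u : nat) (P s : nat) (P t : nat) (P v : nat).
        by clear; lia.
      rewrite cat_uniq => /and3P[_ /hasPn Hn _] zn.
      suff /Hn/negP[] : z \in u :: rcons (m1 ++ s :: t :: m3) v by [].
      move: zn; rewrite /new !(inE, mem_rcons, mem_cat) (negPf zr) /=.
      by case/or3P=> [->|->|/or3P[->|->|/orP[->|->]]]; rewrite ?orbT.
    move=> zl; have := legE Th_in j; move: zl => /[swap] ->; rewrite !(inE, mem_rcons) => /or3P[/eqP E|/eqP E|zj].
    - by have := inner_nu Th_in i; rewrite -E zi.
    - by have := inner_nv Th_in i; rewrite -E zi.
    - by case/eqP: ji; exact: (inner_disj Th_in zj zi).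
  have nS : [set x; y] \notin S.
    apply/negP => xyS; have [_ xf yf] := adjP xyj; rewrite !vset_path !in_set in xf yf.
    have M : sorted (fun a b => (a \in m2) || (b \in m2)) (s :: rcons m2 t).
      by apply: arc_edges => //; apply/allP.
    have [/(zip_sorted M)|/(zip_sorted M)] := adj_path (xyS : adj (path_graph _) x y);
      by case/orP; apply: inS_false.
  rewrite in_setU in_setD nS /=.
  suff [H|H] : adj (path_graph (leg Th i)) x y \/ adj (path_graph (s :: rcons r t)) x y \/ j != i.
  - by apply/orP; left; apply/(theta_adj Th); exists i.
  - case: H => [H|ji]; first by apply/orP; right.
    apply/orP; left; apply/(theta_adj Th); exists j; move: xyj; rewrite /f (negPf ji) //.
  case: (j =P i) => [ji|/eqP ji]; last by right; right.
  move: xyj; rewrite /f ji eqxx => xyn.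
  pose P a b := adj (path_graph (leg Th i)) a b || adj (path_graph (s :: rcons r t)) a b.
  have sP : sorted P new.
    move: leg_sorted; rewrite rcons_cat cat_path rcons_cons /=.
    case/and3P=> q1 q2; rewrite rcons_cat cat_path /= => /and3P[_ _ q3].
    have usr : uniq (s :: rcons r t).
      have /and5P[_ _ un _ _] := gnew; apply: subseq_uniq un.
      by apply: subseq_trans (subseq_cons _ _); exact: subseq_middle.
    have := sorted_path_graph usr; rewrite /= rcons_path => /andP[q4 q5].
    have s1 : subrel (adj (path_graph (leg Th i))) P by move=> a b; rewrite /P => ->.
    have s2 : subrel (adj (path_graph (s :: rcons r t))) P by move=> a b; rewrite /P orbC => ->.
    rewrite /new /= rcons_cat cat_path (sub_path s1 q1) /= s1 // rcons_cat cat_path.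
    by rewrite (sub_path s2 q4) /= s2 // (sub_path s1 q3).
  have Psym a b : P a b = P b a by rewrite /P !(adj_sym _ a b).
  have : P x y by have [/(zip_sorted sP)|/(zip_sorted sP)] := adj_path xyn; rewrite // Psym.
  by case/orP=> H; [left | right; left].
have c1 := subset_leq_card sub; have c2 := leq_trans c1 (leq_card_setU _ _).
have := leq_trans le c2; rewrite cardsDS // => c3.
have := subset_leq_card SE; move: c3 cR cS.
by move: #|eset (theta_graph Th)| #|S| #|R| (size r) (size m2); clear; lia.
Qed.

End Detour.

(** * Blocks and endblocks *)

Section Blocks.
Variable T : finType.
Implicit Types (G H B C : graph T) (x y v : T).

Lemma adj_delete1 G v x y : adj (delete G [set v]) x y = [&& adj G x y, x != v & y != v].
Proof. by rewrite adj_delete !inE. Qed.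

Lemma connect_delete_mono B B' (D : {set T}) x y : subgraph B B' ->
  connect (adj (delete B D)) x y -> connect (adj (delete B' D)) x y.
Proof.
case/subgraphP=> _ sE; apply: connect_sub => a b ab; apply: connect1; move: ab.
by rewrite !adj_delete => /and3P[/sE -> -> ->].
Qed.

Lemma connect_delete_sub B (D : {set T}) x y :
  connect (adj (delete B D)) x y -> connect (adj B) x y.
Proof.
by apply: connect_sub => a b; rewrite adj_delete => /andP[ab _]; exact: connect1.
Qed.

Lemma path_delete G v x p : path (adj (delete G [set v])) x p -> v \notin p.
Proof.
elim: p x => //= y p IH x /andP[]; rewrite adj_delete1 => /and3P[_ _ yv] /IH vp.
by rewrite inE negb_or eq_sym yv.
Qed.

Section TwoConnected.
Variable B : graph T.
Hypothesis B2 : kconnected 2 B.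

Lemma two_connected_card : 2 < #|vset B|. Proof. by case/andP: B2. Qed.

Lemma two_connected_delete v x y : x \in vset B -> y \in vset B -> x != v -> y != v ->
  connect (adj (delete B [set v])) x y.
Proof.
move=> xB yB xv yv; have /andP[_ /forallP/(_ [set v])] := B2.
rewrite cards1 => /connectedP[_]; apply; by rewrite vset_delete !inE ?xv ?yv.
Qed.

Lemma two_connected_connect x y : x \in vset B -> y \in vset B -> connect (adj B) x y.
Proof.
move=> xB yB; have /andP[_ /forallP/(_ set0)] := B2; rewrite cards0 => /connectedP[_ H].
by apply: (@connect_delete_sub B set0); apply: H; rewrite vset_delete !inE.
Qed.

Lemma two_connected_other x y : exists2 z, z \in vset B & (z != x) && (z != y).
Proof.
have : ~~ (vset B \subset [set x; y]).
  apply/negP => /subset_leq_card /(leq_trans two_connected_card); rewrite cards2.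
  by case: (_ != _).
by case/subsetPn => z zB; rewrite !inE negb_or => H; exists z.
Qed.

Lemma connect_first_edge (r : rel T) x y : connect r x y -> x != y -> exists z, r x z.
Proof.
by case/connectP=> [[|z p] /= pp ->]; rewrite ?eqxx // => _; exists z; case/andP: pp.
Qed.

Lemma two_connected_deg x : x \in vset B -> exists a b,
  [/\ a != b, adj B x a & adj B x b].
Proof.
move=> xB; have [w wB /andP[wx _]] := two_connected_other x x.
have [|a xa] := connect_first_edge (two_connected_connect xB wB); first by rewrite eq_sym.
have [w' w'B /andP[w'x w'a]] := two_connected_other x a.
have [ax _ _] := adjP xa.
have [|b] := connect_first_edge (two_connected_delete xB w'B ax w'a); first by rewrite eq_sym.
by rewrite adj_delete1 => /and3P[xb _ ba]; exists a, b; rewrite eq_sym.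
Qed.

(** After deletion of [v], what is left of the 2-connected [B] is connected and serves as a common
    meeting place. *)
Lemma nonsep_extension H B' : subgraph B' H -> subgraph B B' ->
  (forall v a, a \in vset B' -> a != v -> exists2 b, b \in vset B & b != v /\
     connect (adj (delete B' [set v])) a b) -> nonsep H B'.
Proof.
move=> B'H BB' near.
have con v x y : x \in vset B' -> y \in vset B' -> x != v -> y != v ->
    connect (adj (delete B' [set v])) x y.
  move=> xB yB xv yv; have [a aB [av xa]] := near v x xB xv.
  have [b bB [bv yb]] := near v y yB yv; apply: connect_trans xa _.
  apply: connect_trans (connect_delete_mono BB' (two_connected_delete aB bB av bv)) _.
  by rewrite (sym_connect_sym (adj_sym _)).
have /subgraphP[vBB' _] := BB'.
have conB' x y : x \in vset B' -> y \in vset B' -> connect (adj B') x y.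
  move=> xB yB; have [v _ /andP[vx vy]] := two_connected_other x y.
  by apply: (@connect_delete_sub B' [set v]); apply: con; rewrite // eq_sym.
apply/and3P; split=> //.
  apply/connectedP; split=> //.
  have /card_gt0P[z zB] : 0 < #|vset B| by apply: leq_trans two_connected_card.
  by apply/set0Pn; exists z; exact: vBB'.
apply/negP => /existsP[v /andP[vB /exists_inP[x xB /exists_inP[y yB /andP[_]]]]].
move: xB yB; rewrite !in_setD1 => /andP[xv xB] /andP[yv yB]; rewrite con //.
Qed.

Lemma nonsep_ear H x p y : subgraph B H -> x \in vset B -> y \in vset B ->
  uniq (x :: rcons p y) -> path (adj H) x (rcons p y) ->
  nonsep H (gunion B (path_graph (x :: rcons p y))).
Proof.
move=> BH xB yB us pp; have /subgraphP[vBH _] := BH.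
set P := path_graph _; set B' := gunion B P.
have BB' : subgraph B B' := sub_gunionl B P.
have /subgraphP[_ ePB'] : subgraph P B' := sub_gunionr B P.
apply: (@nonsep_extension H B') => //.
  apply: gunion_sub => //; apply: path_graph_sub => // z.
  rewrite inE mem_rcons inE => /or3P[/eqP->|/eqP->|zp]; try exact: vBH.
  have := path_connect pp (_ : z \in x :: rcons p y); rewrite inE mem_rcons inE zp !orbT => /(_ isT).
  by case/connectP=> q; case/lastP: q => [_ ->|q w]; [exact: vBH | rewrite rcons_path last_rcons => /andP[_ /adjP[_ _ wH]] ->].
move=> v a; rewrite [a \in vset B']in_setU => /orP[aB|aP] av; first by exists a.
have [aB|aB] := boolP (a \in vset B); first by exists a.
have ap : a \in p.
  move: aP; rewrite vset_path in_set inE mem_rcons inE => /or3P[/eqP E|/eqP E|//].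
    by rewrite E xB in aB.
  by rewrite E yB in aB.
have sP := sorted_path_graph us; rewrite -/P in sP; clearbody P.
have [p1 [p2 Ep]] : exists p1 p2, p = p1 ++ a :: p2.
  by case/splitPr: ap => p1 p2; exists p1, p2.
rewrite {}Ep {pp ap} in us sP.
have side (s : seq T) : sorted (adj P) s -> v \notin s -> forall z w, z \in s -> w \in s ->
    connect (adj (delete B' [set v])) z w.
  move=> ss vs z w; apply: sorted_connect; first exact: adj_sym.
  apply: (sub_in_sorted (P := mem s)) ss; last exact/allP.
  move=> c d cs ds cd; rewrite adj_delete1 ePB' //.
  by rewrite !(contraNneq _ vs) // => <-.
(* The deleted vertex lies on at most one side of [a] on the ear; leave by the other side. *)
have [vL|vL] := boolP (v \in rcons (x :: p1) a).
  exists y => //; have vR : v \notin a :: rcons p2 y.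
    move: us; rewrite rcons_cat rcons_cons -cat_cons cat_uniq => /and3P[_ /hasPn Hn _].
    apply/negP => vR; move: vL; rewrite mem_rcons inE => /orP[/eqP E|vp].
      by rewrite E eqxx in av.
    by have := Hn v vR; rewrite /= vp.
  split; last first.
    apply: (side (a :: rcons p2 y)); rewrite ?mem_head //= ?inE ?mem_rcons ?mem_head ?orbT //.
    by move: sP; rewrite /= rcons_cat /= cat_path => /andP[_ /= /andP[]].
  by apply: contraNneq vR => <-; rewrite inE mem_rcons mem_head orbT.
exists x => //; split; first by apply: contraNneq vL => <-; rewrite mem_rcons !inE eqxx orbT.
apply: (side (rcons (x :: p1) a)) => //; try by rewrite mem_rcons !inE eqxx ?orbT.
by move: sP; rewrite /= rcons_cat /= -cat_rcons cat_path => /andP[].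
Qed.

End TwoConnected.

Lemma nonsep_union H B C x z : kconnected 2 B -> kconnected 2 C ->
  subgraph B H -> subgraph C H -> x != z -> x \in vset B -> x \in vset C ->
  z \in vset B -> z \in vset C -> nonsep H (gunion B C).
Proof.
move=> B2 C2 BH CH xz xB xC zB zC; have sC := sub_gunionr B C.
apply: (nonsep_extension B2); [exact: gunion_sub | exact: sub_gunionl |].
move=> v a; rewrite in_setU => /orP[aB|aC] av; first by exists a.
have [w [wv wB wC]] : exists w, [/\ w != v, w \in vset B & w \in vset C].
  by have [E|xv] := eqVneq x v; [exists z; rewrite -E eq_sym | exists x].
exists w => //; split=> //; apply: (connect_delete_mono sC).
exact: two_connected_delete.
Qed.

Lemma block_eq H B C : block H B -> nonsep H C -> subgraph B C -> C = B.
Proof. by case/andP=> _ /forallP/(_ C) /implyP H1 nC BC; apply/eqP/H1; rewrite nC. Qed.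

Lemma block_sub H B : block H B -> subgraph B H.
Proof. by case/andP=> /and3P[]. Qed.

(** Each block has two edges at [x], and the degree is at most 3, so they share a neighbour of [x].
    With two common vertices their union has no cutvertex. *)
Lemma blocks_disjoint H B C x : (forall y s, uniq s -> all (adj H y) s -> size s <= 3) ->
  block H B -> kconnected 2 B -> block H C -> kconnected 2 C ->
  x \in vset B -> x \in vset C -> B = C.
Proof.
move=> deg3 bB B2 bC C2 xB xC; have [BH CH] := (block_sub bB, block_sub bC).
have [a [b [ab xa xb]]] := two_connected_deg B2 xB.
have [a' [b' [ab' xa' xb']]] := two_connected_deg C2 xC.
suff [z [zx zB zC]] : exists z, [/\ x != z, z \in vset B & z \in vset C].
  have nU := nonsep_union B2 C2 BH CH zx xB xC zB zC.
  by rewrite -(block_eq bB nU (sub_gunionl B C)) (block_eq bC nU (sub_gunionr B C)).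
have [[xna _ aB] [xnb _ bB']] := (adjP xa, adjP xb).
have [[xna' _ aC] [xnb' _ bC']] := (adjP xa', adjP xb').
have [E|aa'] := eqVneq a a'; first by exists a; split=> //; rewrite E.
have [E|ab''] := eqVneq a b'; first by exists a; split=> //; rewrite E.
have [E|ba'] := eqVneq b a'; first by exists b; split=> //; rewrite E.
have [E|bb'] := eqVneq b b'; first by exists b; split=> //; rewrite E.
have /subgraphP[_ eB] := BH; have /subgraphP[_ eC] := CH.
have := deg3 x [:: a; b; a'; b']; rewrite /= (eB _ _ xa) (eB _ _ xb) (eC _ _ xa') (eC _ _ xb') !inE.
by rewrite (negPf ab) (negPf aa') (negPf ab'') (negPf ba') (negPf bb') (negPf ab') => /(_ isT isT).
Qed.

Section Attachment.
Variables (H B C : graph T).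
Hypotheses (bB : block H B) (B2 : kconnected 2 B) (cC : component H C) (BC : subgraph B C).

Lemma component_adj b y : b \in vset C -> adj H b y -> adj C b y.
Proof.
move=> bC eby; have /and3P[CH /connectedP[C0 Cc] /forallP/(_ (gunion C (path_graph [:: b; y])))] := cC.
have [bny bH yH] := adjP eby.
have PH : subgraph (path_graph [:: b; y]) H.
  apply: path_graph_sub => [|z]; first by rewrite /= eby.
  by rewrite !inE => /orP[/eqP->|/eqP->].
have by' : adj (gunion C (path_graph [:: b; y])) b y.
  have /subgraphP[_] := sub_gunionr C (path_graph [:: b; y]); apply.
  by have := @sorted_path_graph T [:: b; y]; rewrite /= mem_seq1 bny !andbT => /(_ isT).
have /subgraphP[sv se] := sub_gunionl C (path_graph [:: b; y]).
rewrite sub_gunionl gunion_sub //=.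
suff -> : connected (gunion C (path_graph [:: b; y])) by move/eqP=> E; rewrite E in by'.
have tob z : z \in vset (gunion C (path_graph [:: b; y])) ->
    connect (adj (gunion C (path_graph [:: b; y]))) z b.
  rewrite !inE => /orP[zC|/orP[]/eqP->] //; last by apply: connect1; rewrite adj_sym.
  by apply: connect_sub (Cc _ _ zC bC) => p q pq; apply: connect1; exact: se.
apply/connectedP; split; first by apply/set0Pn; exists b; exact: sv.
move=> p q /tob pb /tob; rewrite (sym_connect_sym (adj_sym _)); exact: connect_trans.
Qed.

(** Otherwise [y] could return to [B] without [b], and the resulting ear would enlarge the block. *)
Lemma attachment_cutvertex b y : b \in vset B -> adj H b y -> y \notin vset B ->
  cutvertex C b.
Proof.
move=> bB' eby yB; have /subgraphP[vBC _] := BC; have bC := vBC _ bB'.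
have [bny _ yC] := adjP (component_adj bC eby).
have [x xB /andP[xb _]] := two_connected_other B2 b b.
have /and3P[CH /connectedP[C0 Cc] _] := cC; have /subgraphP[_ eCH] := CH.
apply/andP; split=> //; apply/exists_inP; exists y; first by rewrite in_setD1 eq_sym bny.
apply/exists_inP; exists x; first by rewrite in_setD1 xb vBC.
rewrite (Cc _ _ yC (vBC _ xB)) /=; apply/negP => /connectP[p0 pp0 E].
have [q [uq pq]] : exists q, uniq (y :: rcons q x) /\ path (adj (delete C [set b])) y (rcons q x).
  move: E; have [q pq uq _] := shortenP pp0; case/lastP: q pq uq => [|q w] pq uq.
    by move=> /= E; rewrite -E xB in yB.
  by rewrite last_rcons => E; exists q; rewrite E.
have q0 : path (adj C) y (rcons q x) by apply: sub_path pq => c d; rewrite adj_delete => /andP[].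
have uq' : uniq (b :: rcons (y :: q) x).
  rewrite cons_uniq rcons_cons uq andbT inE (negPf bny) orFb; apply/negP => bq.
  by have := path_delete pq; rewrite bq.
have nB : nonsep H (gunion B (path_graph (b :: rcons (y :: q) x))).
  apply: nonsep_ear => //; first exact: block_sub.
  by rewrite /= eby; apply: sub_path q0.
have EB := block_eq bB nB (sub_gunionl _ _).
by move: yB; rewrite -EB in_setU vset_path in_set inE mem_head !orbT.
Qed.

Lemma block_component : block C B.
Proof.
have /andP[/and3P[_ cB nB] /forallP mB] := bB.
apply/andP; split; first by apply/and3P.
apply/forallP => B'; apply/implyP => /andP[/and3P[B'C cB' nB'] BB'].
apply: (implyP (mB B')); rewrite BB' andbT; apply/and3P; split=> //.
by apply: subgraph_trans B'C _; case/and3P: cC.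
Qed.

End Attachment.

(** Vertices with an edge leaving the block are cutvertices, hence neighbours of the endblock in the
    block-cutvertex tree, where it has degree at most 1. *)
Lemma endblock_attachment H B b b' y y' : endblock H B -> kconnected 2 B ->
  b \in vset B -> b' \in vset B -> adj H b y -> adj H b' y' ->
  y \notin vset B -> y' \notin vset B -> b = b'.
Proof.
case/andP=> bB /existsP[C /and3P[cC BC d1]] B2 bB1 bB2 e1 e2 y1 y2.
have c1 := attachment_cutvertex bB B2 cC BC bB1 e1 y1.
have c2 := attachment_cutvertex bB B2 cC BC bB2 e2 y2.
have bcB := block_component bB cC BC.
apply/eqP; apply: contraLR d1 => bb; rewrite -ltnNge.
have <- : #|[set (inl b : T + graph T); inl b']| = 2 by rewrite cards2 (_ : inl b != inl b').
have edge z : z \in vset B -> cutvertex C z -> adj (bc_tree C) (inr B) (inl z).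
  move=> zB cz; rewrite adj_sym adj_mk !in_set cz bcB andbT /= andbT.
  by apply/imsetP; exists (z, B); rewrite ?in_set.
apply: subset_leq_card; apply/subsetP => z; rewrite in_set2 in_set => /orP[]/eqP->; exact: edge.
Qed.

End Blocks.

(** * An endblock satisfies the local hypotheses *)

Section EndblockLocal.
Variables (T : finType) (G : graph T) (Th : theta T).
Hypotheses (G_cubic : cubic G) (G_3conn : kconnected 3 G) (Th_in : theta_in G Th).
Local Notation e := (adj G).
Local Notation H := (gminus G (theta_plus G Th)).
Implicit Types (B : graph T) (x y f : T) (i j : 'I_3).

Definition fringe B : {set T} := [set f in Fset G Th | [exists y in vset B, e f y]].
(** The ends of the theta graph have no neighbours outside it, so inner vertices suffice, and they
    determine the leg. *)
Definition exit x i := [exists p in inner Th i, e x p].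

Lemma exitP x i : reflect (exists2 p, p \in inner Th i & e x p) (exit x i).
Proof. exact: exists_inP. Qed.

Lemma in_nbrs x y : (y \in nbrs G x) = e x y.
Proof. by rewrite in_set. Qed.

Lemma FsetP x : reflect [/\ x \in vset G, x \notin theta_set Th &
    exists p q, [/\ p != q, p \in theta_set Th, q \in theta_set Th, e x p & e x q]]
  (x \in Fset G Th).
Proof.
rewrite [x \in Fset _ _]in_set /gminus vset_delete in_setD -/(theta_set Th); apply: (iffP idP).
  case/andP=> /andP[xT xG] /card_gt1P[p [q [+ + pq]]]; rewrite !in_setI !in_nbrs -!/(theta_set Th).
  by move=> /andP[ep pT] /andP[eq qT]; split=> //; exists p, q.
case=> xG xT [p [q [pq pT qT ep eq]]]; rewrite xG xT /=.
by apply/card_gt1P; exists p, q; rewrite !in_setI !in_nbrs -!/(theta_set Th) ep eq pT qT.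
Qed.

Lemma in_H x : (x \in vset H) = [&& x \in vset G, x \notin theta_set Th & x \notin Fset G Th].
Proof.
rewrite /gminus vset_delete in_setD vset_mk in_setI in_setU -/(theta_set Th).
by case: (x \in vset G); rewrite ?andbF // negb_or andbT.
Qed.

Lemma adj_H x y : adj H x y = [&& e x y, x \in vset H & y \in vset H].
Proof.
rewrite /gminus adj_delete; case exy: (adj G x y) => //=; have [_ xG yG] := adjP exy.
by rewrite !vset_delete !in_setD xG yG !andbT.
Qed.

Lemma outside_nbr_inner x y : x \notin theta_set Th -> y \in theta_set Th -> e x y ->
  exists i, y \in inner Th i.
Proof.
move=> xT yT exy; case: (theta_cases Th_in yT) => // E; case/negP: xT.
  by apply: (u_closed Th_in G_cubic); rewrite adj_sym -E.
by apply: (v_closed Th_in G_cubic); rewrite adj_sym -E.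
Qed.

Lemma exit_of_theta x y : x \notin theta_set Th -> y \in theta_set Th -> e x y ->
  exists i, exit x i.
Proof.
move=> xT yT exy; have [i yi] := outside_nbr_inner xT yT exy.
by exists i; apply/exitP; exists y.
Qed.

Lemma cubic_deg x : x \in vset G -> #|[set y | e x y]| = 3.
Proof. by move=> xG; apply/eqP; exact: (forall_inP G_cubic). Qed.

Section Block.
Variable B : graph T.
Hypotheses (B_end : endblock H B) (B2 : kconnected 2 B) (B_conn : theta_connecting G Th B).
Local Notation X := (vset B).
Local Notation F := (fringe B).

Lemma B_sub : subgraph B H.
Proof. by case/andP: B_end => /block_sub. Qed.

Lemma in_block x : x \in X -> [/\ x \in vset G, x \notin theta_set Th & x \notin Fset G Th].
Proof. by have /subgraphP[sv _] := B_sub; move/sv; rewrite in_H => /and3P[]. Qed.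

Lemma adj_block x y : adj B x y -> e x y.
Proof. by have /subgraphP[_ se] := B_sub; move/se; rewrite adj_H => /and3P[]. Qed.

Lemma in_fringe f : f \in F -> f \in Fset G Th /\ exists2 x, x \in X & e f x.
Proof. by rewrite in_set => /andP[fF /exists_inP[x xX efx]]; split; rewrite //; exists x. Qed.

Lemma block_fringe_off x : x \in X :|: F -> x \in vset G /\ x \notin theta_set Th.
Proof. by rewrite in_setU => /orP[/in_block[]|/in_fringe[/FsetP[]]]. Qed.

(** Two of the three edges at [f] go to the theta graph. *)
Lemma fringe_nbr f x y : f \in F -> x \in X -> e f x -> e f y -> y \notin theta_set Th -> x = y.
Proof.
move=> fF xX efx efy yT; have [/FsetP[_ _ [p [q [pq pT qT ep eq]]]] _] := in_fringe fF.
apply/eqP; apply: contraT => xy; have [_ xT _] := in_block xX.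
have := @cubic_nbrs T G G_cubic f [:: x; y; p; q]; rewrite /= efx efy ep eq => H.
suff: uniq [:: x; y; p; q] by move/H => /(_ isT).
have ne a b : a \notin theta_set Th -> b \in theta_set Th -> a != b.
  by move=> aT; apply: contraTneq => <-.
by rewrite /= !mem_seq2 !mem_seq3 mem_seq1 !negb_or xy pq !ne.
Qed.

Lemma block_exits i : exists2 x, x \in X :|: F & exists2 j, j != i & exit x j.
Proof.
have /and3P[_ _ /(all_nthP [::])/(_ i (ltn_ord i))] := B_conn; rewrite -/(leg Th i).
case/subsetPn => t; rewrite in_set => /andP[tT /exists_inP[x xO etx]] tl.
have {xO} xO : x \in X :|: F by move: xO; rewrite /sub_plus vset_mk in_setI => /andP[].
have [xG xT] := block_fringe_off xO; exists x => //.
rewrite adj_sym in etx; have [j tj] := outside_nbr_inner xT tT etx.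
exists j; last by apply/exitP; exists t.
by apply: contraNneq tl => <-; rewrite (legE Th_in) inE mem_rcons inE tj !orbT.
Qed.

(** An edge from the block to none of [X], [F] and the theta graph is an edge of [H] leaving the
    block; in an endblock all these start at one vertex. *)
Lemma block_attachment : exists c,
  (forall x y, x \in X -> x != c -> e x y -> y \in X :|: F :|: theta_set Th) /\
  (c \in X -> exists2 y, e c y & y \notin X :|: F :|: theta_set Th).
Proof.
pose out x := [exists y, e x y && (y \notin X :|: F :|: theta_set Th)].
have outH x y : x \in X -> e x y -> y \notin X :|: F :|: theta_set Th ->
    adj H x y /\ y \notin X.
  move=> xX exy; rewrite in_setU negb_or => /andP[+ yT]; rewrite in_setU negb_or => /andP[yX yF].
  have [xG xT xF] := in_block xX; have [_ _ yG] := adjP exy.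
  rewrite adj_H exy !in_H xG xT xF yG yT; split=> //; apply: contra yF => yF.
  by rewrite in_set yF; apply/exists_inP; exists x; rewrite // adj_sym.
case: (pickP [pred x in X | out x]) => [c /= /andP[cX oc]|no].
  exists c; split; last by move=> _; case/existsP: oc => y /andP[]; exists y.
  move=> x y xX xc exy; apply: contraT => yO; case/existsP: oc => y' /andP[ecy' y'O].
  have [a1 a2] := outH _ _ xX exy yO; have [b1 b2] := outH _ _ cX ecy' y'O.
  by rewrite (endblock_attachment B_end B2 xX cX a1 b1 a2 b2) eqxx in xc.
(* There is no such edge: any vertex off [X] will do for [c]. *)
exists (th_u Th); split; last by case/in_block; rewrite (u_theta Th_in).
move=> x y xX _ exy; apply: contraT => yO; have := no x; rewrite /= xX /=.
by move/negbT/existsPn/(_ y); rewrite exy yO.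
Qed.

(** The boundary separates [S] from the end [th_u Th], which is not adjacent to [S]. *)
Lemma boundary_three (S : {set T}) : S \subset X :|: F -> S != set0 -> 2 < #|boundary e S|.
Proof.
move=> sS /set0Pn[s sS']; rewrite ltnNge; apply/negP => b2.
have /andP[_ /forallP/(_ (boundary e S))/implyP/(_ b2) /connectedP[_ con]] := G_3conn.
have notu x : x \in X :|: F -> ~~ e x (th_u Th) /\ x != th_u Th.
  move=> xO; have [_ xT] := block_fringe_off xO; split; last by apply: contraNneq xT => ->; exact: (u_theta Th_in).
  by rewrite adj_sym; apply: contra xT; exact: (u_closed Th_in G_cubic).
have uS : th_u Th \notin S by apply/negP => /(subsetP sS)/notu[_]; rewrite eqxx.
have /connectP[p pp E] : connect (adj (delete G (boundary e S))) s (th_u Th).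
  apply: con; rewrite vset_delete in_setD.
    have [-> _] := block_fringe_off (subsetP sS _ sS'); rewrite andbT.
    by apply/boundaryP => -[]; rewrite sS'.
  have /and3P[_ /andP[/and5P[_ _ _ /subsetP uG _] _] _] := Th_in.
  rewrite uG ?andbT; last first.
    by rewrite -[leg1 Th]/(nth [::] (legs Th) (ord0 : 'I_3)) -/(leg Th ord0) in_set (legE Th_in) mem_head.
  by apply/boundaryP => -[_ [x xS exu]]; have [/negP] := notu x (subsetP sS _ xS).
case/negP: uS; rewrite E {E}; elim: p s sS' pp => //= x p IH s sS' /andP[].
rewrite adj_delete => /and3P[esx _ xb] /IH; apply.
by apply: contraT => xS; case/negP: xb; apply/boundaryP; split=> //; exists s.
Qed.

Lemma boundary_two (S : {set T}) : S \subset X -> S != set0 -> 1 < #|X :\: S| ->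
  1 < #|boundary e S :&: X|.
Proof.
move=> sS /set0Pn[s sS'] XS; rewrite ltnNge; apply/negP => b1.
have [/andP[_ /forallP/(_ (boundary e S :&: X))/implyP/(_ b1) /connectedP[_ con]]] := B2.
have /subsetPn[t tXS tb] : ~~ (X :\: S \subset boundary e S :&: X).
  by apply: contraL XS => /subset_leq_card; rewrite -leqNgt; move/leq_trans; apply.
move: tXS; rewrite in_setD => /andP[tS tX]; case/negP: tS.
have /connectP[p pp ->] : connect (adj (delete B (boundary e S :&: X))) s t.
  apply: con; rewrite vset_delete in_setD ?tb // (subsetP sS) // andbT in_setI negb_and.
  by apply/orP; left; apply/boundaryP => -[]; rewrite sS'.
elim: p s sS' pp => //= x p IH s sS' /andP[].
rewrite adj_delete => /and3P[esx _ xb] /IH; apply; have [_ _ xX] := adjP esx.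
apply: contraT => xS; case/negP: xb; rewrite in_setI xX andbT.
by apply/boundaryP; split=> //; exists s => //; exact: adj_block.
Qed.

(** Fringe vertices that see a single leg are left to [fringe_connector]. *)
Lemma block_local_hyp : (forall f, f \in F -> exists i j, [/\ i != j, exit f i & exit f j]) ->
  exists c, local_hyp e X F (theta_set Th) exit c.
Proof.
move=> exF; have [c [cX cO]] := block_attachment; exists c.
split=> //.
- exact: adj_sym.
- exact: adj_irr.
- by move=> x /block_fringe_off[xG _]; exact: cubic_deg.
- by apply/pred0P => x /=; apply/negbTE/negP => /andP[/in_block[_ _ /negP nF] /in_fringe[]].
- by apply/pred0P => x /=; apply/negbTE/negP => /andP[/block_fringe_off[_ /negP]].
- move=> f y fF efy; rewrite in_setU; have [_|yT] := boolP (y \in theta_set Th); first by rewrite orbT.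
  by have [_ [x xX efx]] := in_fringe fF; rewrite -(fringe_nbr fF xX efx efy yT) xX.
- by move=> f /in_fringe[].
- by move=> f x y fF xX yX efx efy; apply: (fringe_nbr fF) => //; case: (in_block yX).
- by move=> x y /block_fringe_off[_ xT]; exact: exit_of_theta.
- by move=> x i _ /exitP[p pi exp]; exists p => //; exact: (inner_theta Th_in pi).
- exact: block_exits.
- exact: boundary_two.
- exact: boundary_three.
- exact: two_connected_card.
Qed.

End Block.
End EndblockLocal.

(** * Rearranging beads *)

Section Beads.
Variables (V : eqType) (e : rel V).
Implicit Types (x y w : V) (A l W : seq V).

Lemma bead_swap x A l1 y A' l2 : bead e x A l1 y A' l2 -> bead e y A' l2 x A l1.
Proof.
case/and5P=> u c p1 p2 nr; apply/and5P; split=> //.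
- rewrite (perm_uniq (_ : perm_eq _ (x :: l1 ++ A ++ y :: l2 ++ A'))) //.
  by apply/permP => a; rewrite /= !count_cat /= !count_cat /=; lia.
- by rewrite -(rot_cycle (size (y :: A'))) -cat_cons rot_size_cat.
- by move: nr; rewrite /near; lia.
Qed.

(** The marked vertex [x] has an empty tail because it will already lie on a leg. *)
Lemma arc_bead x w W A' l : uniq (x :: (w :: W) ++ A' ++ l) -> path e x (w :: W) ->
  path e (last w W) A' -> e (last (last w W) A') x ->
  path e (last w W) l -> near (size W) (size A') ->
  bead e x (belast w W) [::] (last w W) A' l.
Proof.
move=> u pW pA ex pl nr; apply/and5P; split=> //.
- rewrite (perm_uniq (_ : perm_eq _ (x :: (w :: W) ++ A' ++ l))) //.
  rewrite /= perm_cons -cat_rcons -lastI /= perm_cons perm_cat2l; exact/permEl/perm_catC.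
- by rewrite -cat_rcons -lastI /= in pW *; case/andP: pW => -> pW; rewrite rcons_cat cat_path pW rcons_path pA.
- by rewrite size_belast.
Qed.

Lemma arc_perm x w W A' l p :
  perm_eq (x :: (w :: W) ++ A' ++ rcons l p) ((w :: W ++ l) ++ p :: x :: A').
Proof. by apply/permP => f; rewrite /= !count_cat /= -cats1 !count_cat /=; lia. Qed.

Lemma arc_perm_bead x w W A' l p :
  perm_eq (x :: [::] ++ belast w W ++ last w W :: rcons l p ++ A') ((x :: A') ++ p :: (w :: W ++ l)).
Proof.
apply/permP => f; have := congr1 (count f) (lastI w W); rewrite -!cats1 !count_cat /= !count_cat /=.
by rewrite !count_cat /=; lia.
Qed.

End Beads.

Section Joint.
Variables (T : finType) (e : rel T) (u : T).
Implicit Types (O : {set T}) (P Q : seq T).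

Definition seq_zone P a b : {set T} := [set v in P | a <= index v P <= b].

Definition seq_joint O P Q a b a' b' s s' := exists x A l1 y A' l2,
  [/\ bead e x A l1 y A' l2, last x l1 = nth u P s, last y l2 = nth u Q s' &
      {subset x :: l1 ++ A ++ y :: l2 ++ A' <= O :|: seq_zone P a b :|: seq_zone Q a' b'}].

Lemma seq_joint_swap O P Q a b a' b' s s' :
  seq_joint O P Q a b a' b' s s' -> seq_joint O Q P a' b' a b s' s.
Proof.
case=> x [A [l1 [y [A' [l2 [bd E1 E2 sub]]]]]].
exists y, A', l2, x, A, l1; split=> //; first exact: bead_swap.
move=> v vin; rewrite setUAC; apply: sub; move: vin; rewrite !(inE, mem_cat).
by do !case: (_ \in _) || case: (_ == _); rewrite ?orbT.
Qed.

End Joint.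

(** * Connectors between two legs *)

Section Connector.
Variables (T : finType) (G : graph T) (Th : theta T).
Local Notation e := (adj G).
Local Notation u := (th_u Th).
Implicit Types (O : {set T}) (i j : 'I_3) (a b : nat).

Local Notation zone i := (seq_zone (inner Th i)).
Local Notation joint O i j := (seq_joint e u O (inner Th i) (inner Th j)).

Definition owns O i a := [exists x in O, e (nth u (inner Th i) a) x].

(** All four choices of interval ends are required because the necklace enters at the lower end on
    one leg and leaves at the upper end on the other, in either direction. The length bound and
    [con_own] limit how many other connectors can interfere. *)
Record connector O i j a b a' b' : Prop := Connector {
  con_legs : i != j;
  con_left : a <= b < size (inner Th i);
  con_right : a' <= b' < size (inner Th j);
  con_short : (b - a) + (b' - a') <= 4;
  con_own : [&& owns O i a, owns O i b, owns O j a' & owns O j b'];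
  con_bead : forall s s', s \in [:: a; b] -> s' \in [:: a'; b'] -> joint O i j a b a' b' s s' }.

Lemma connector_swap O i j a b a' b' : connector O i j a b a' b' -> connector O j i a' b' a b.
Proof.
case=> ij l r sh /and4P[o1 o2 o3 o4] H; split; rewrite ?o1 ?o2 ?o3 ?o4 1?eq_sym 1?addnC //.
by move=> s s' si sj; apply: seq_joint_swap; exact: H.
Qed.

Hypothesis Th_in : theta_in G Th.

Lemma zone_theta i a b v : v \in zone i a b -> v \in theta_set Th.
Proof. by rewrite in_set => /andP[vi _]; exact: (inner_theta Th_in vi). Qed.

Lemma zone_point i p : p \in inner Th i -> p \in zone i (index p (inner Th i)) (index p (inner Th i)).
Proof. by move=> pi; rewrite in_set pi leqnn. Qed.

Lemma zone_block i m1 m2 m3 : inner Th i = m1 ++ m2 ++ m3 ->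
  {subset m2 <= zone i (size m1) (size m1 + size m2).-1}.
Proof.
move=> E v vm; have := inner_uniq Th_in i; rewrite in_set E cat_uniq => /and3P[_ /hasPn nm _].
rewrite !mem_cat vm orbT /= !index_cat vm.
have := nm v; rewrite mem_cat vm => /(_ isT) /negPf /= ->.
by have := vm; rewrite -index_mem; move: (index v m2) (size m2) (size m1); clear; lia.
Qed.

Section Arc.
Variables (O : {set T}) (i j : 'I_3).
Hypotheses (OT : forall x, x \in O -> x \notin theta_set Th) (ij : i != j).

Lemma arc_joint a b x s w W A' l p : x = nth u (inner Th i) s ->
  {subset x :: A' <= zone i a b} -> uniq (x :: A') ->
  {subset w :: W ++ l <= O} -> uniq (w :: W ++ l) ->
  p \in inner Th j -> path e x (w :: W) -> path e (last w W) A' -> e (last (last w W) A') x ->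
  path e (last w W) (rcons l p) -> near (size W) (size A') ->
  joint O i j a b (index p (inner Th j)) (index p (inner Th j)) s (index p (inner Th j)).
Proof.
move=> xs subA uA subW uW pj pW pA ex pl nr.
have pT := inner_theta Th_in pj.
have pz : p \notin x :: A'.
  by apply/negP => /subA; rewrite in_set => /andP[/(inner_disj Th_in pj) E]; move: ij; rewrite E eqxx.
exists x, (belast w W), [::], (last w W), A', (rcons l p); split=> //.
- apply: arc_bead => //.
  rewrite (perm_uniq (arc_perm _ _ _ _ _ _)).
  rewrite cat_uniq uW cons_uniq pz uA !andbT.
  apply/hasPn => v; rewrite inE => vz; apply/negP => /subW /OT /negP; apply.
  by case/predU1P: vz => [->|/subA/zone_theta].
- by rewrite last_rcons nth_index.
move=> v; rewrite (perm_mem (arc_perm_bead _ _ _ _ _ _)).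
rewrite mem_cat inE => /or3P[/subA vz|/eqP->|/subW vO].
- by rewrite in_setU in_setU vz orbT.
- by rewrite in_setU zone_point ?orbT.
- by rewrite !in_setU vO.
Qed.

(** The segment of leg [i] from [pa] to [pb] and a path through [O] form the cycle. Its marked
    vertices are an end of the segment and the far end of that path, from where a tail leads to leg
    [j]. The interval on leg [i] is the segment, the one on leg [j] a point. *)
Lemma arc_connector m1 pa m2 pb m3 w W l l' p :
  inner Th i = m1 ++ pa :: m2 ++ pb :: m3 -> size m2 <= 3 ->
  near (size W) (size m2).+1 -> path e pa (rcons (w :: W) pb) ->
  {subset w :: W ++ l <= O} -> {subset w :: W ++ l' <= O} ->
  uniq (w :: W ++ l) -> uniq (w :: W ++ l') -> p \in inner Th j ->
  path e (last w W) (rcons l p) -> path e w (rcons l' p) -> owns O j (index p (inner Th j)) ->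
  connector O i j (size m1) (size m1 + (size m2).+1) (index p (inner Th j)) (index p (inner Th j)).
Proof.
move=> Ei m23 nr pW subl subl' ul ul' pj pl pl' op.
have Ea : pa = nth u (inner Th i) (size m1) by rewrite Ei nth_cat ltnn subnn.
have Eb : pb = nth u (inner Th i) (size m1 + (size m2).+1).
  by rewrite Ei nth_cat ltnNge leq_addr /= addKn /= nth_cat ltnn subnn.
have pm : path e pa (rcons m2 pb).
  have := leg_path Th_in i; rewrite Ei rcons_cat rcons_cons rcons_cat rcons_cons cat_path.
  by move=> /andP[_ /= /andP[_]]; rewrite -cat_rcons cat_path => /andP[].
have um : uniq (pa :: rcons m2 pb).
  have := inner_uniq Th_in i; rewrite Ei cat_uniq => /and3P[_ _].
  by rewrite -cat_rcons -cat_cons cat_uniq => /and3P[].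
have zm : {subset pa :: rcons m2 pb <= zone i (size m1) (size m1 + (size m2).+1)}.
  have := @zone_block i m1 (pa :: rcons m2 pb) m3; rewrite Ei /= cat_rcons => /(_ erefl).
  by rewrite size_rcons addnS.
have pm' : path e pb (rcons (rev m2) pa) by rewrite (path_rev_sym (@adj_sym _ G)).
have pW' : path e pb (rcons (rev (w :: W)) pa) by rewrite (path_rev_sym (@adj_sym _ G)).
have wO v : v \in w :: W -> v \in O.
  by move=> vW; apply: subl; rewrite -cat_cons mem_cat vW.
have [ew el] : e pa w /\ e (last w W) pb.
  by move: pW; rewrite /= rcons_path => /and3P[].
split=> //.
- by rewrite leq_addr Ei size_cat ltn_add2l /= size_cat /= ltnS addnS ltnS leq_addr.
- by rewrite leqnn index_mem.
- by rewrite addKn subnn addn0.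
- rewrite op !andbT; apply/andP; split; apply/exists_inP.
    by exists w; rewrite -?Ea // wO ?mem_head.
  by exists (last w W); rewrite -?Eb 1?adj_sym // wO ?mem_last.
move=> s s'; rewrite !inE => ss; rewrite orbb => /eqP->; case/orP: ss => /eqP->.
- apply: (@arc_joint _ _ pa _ w W (pb :: rev m2) l p) => //.
  + by move=> v; rewrite in_cons -mem_rev rev_cons revK => ?; apply: zm; rewrite in_cons.
  + by rewrite cons_uniq -mem_rev rev_cons revK -rev_uniq rev_cons revK -cons_uniq.
  + by move: pW; rewrite rcons_path => /andP[].
  + by rewrite /= el; move: pm'; rewrite rcons_path => /andP[].
  + by rewrite last_cons; move: pm'; rewrite rcons_path => /andP[].
  + by rewrite /= size_rev.
(* From [pb] the path is read backwards, and the tail [l'] starts at [w]. *)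
case Er: (rev (w :: W)) pW' => [|w2 W2] pW'.
  by have := congr1 size Er; rewrite size_rev.
have Elast : last w2 W2 = w.
  by have := congr1 (last w2) Er; rewrite rev_cons last_rcons.
have permW : perm_eq (w2 :: W2 ++ l') (w :: W ++ l').
  by rewrite -!cat_cons perm_cat2r -Er perm_rev.
apply: (@arc_joint _ _ pb _ w2 W2 (pa :: m2) l' p) => //.
- by move=> v vin; apply: zm; move: vin; rewrite !inE mem_rcons inE orbCA.
- by move: um; rewrite -rcons_cons rcons_uniq.
- by move=> v; rewrite (perm_mem permW); exact: subl'.
- by rewrite (perm_uniq permW).
- by move: pW'; rewrite rcons_path => /andP[].
- by rewrite Elast /= adj_sym ew; move: pm; rewrite rcons_path => /andP[].
- by rewrite last_cons; move: pm; rewrite rcons_path => /andP[].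
- by rewrite Elast.
- by have := congr1 size Er; rewrite size_rev /= => -[<-].
Qed.

End Arc.
End Connector.

Lemma split_two (V : eqType) (s : seq V) p q : p != q -> p \in s -> q \in s ->
  exists p' q' m1 m2 m3, s = m1 ++ p' :: m2 ++ q' :: m3 /\
    ((p' = p /\ q' = q) \/ (p' = q /\ q' = p)).
Proof.
move=> pq /splitPr[s1 s2]; rewrite mem_cat inE eq_sym (negPf pq) /=.
case/orP=> /splitPr[t1 t2].
  by exists q, p, t1, t2, s2; rewrite -catA /=; split; [|right].
by exists p, q, s1, t1, t2; split; [|left].
Qed.

Lemma index_two (V : eqType) (m1 : seq V) p m2 q m3 :
  uniq (m1 ++ p :: m2 ++ q :: m3) ->
  index p (m1 ++ p :: m2 ++ q :: m3) = size m1 /\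
  index q (m1 ++ p :: m2 ++ q :: m3) = size m1 + (size m2).+1.
Proof.
move=> us; split.
  by rewrite -{1}[p](_ : nth p (m1 ++ p :: m2 ++ q :: m3) (size m1) = p) ?index_uniq //
       ?nth_cat ?ltnn ?subnn // size_cat /= addnS ltnS leq_addr.
rewrite -{1}[q](_ : nth p (m1 ++ p :: m2 ++ q :: m3) (size m1 + (size m2).+1) = q) ?index_uniq //.
  by rewrite size_cat ltn_add2l /= size_cat ltnS addnS ltnS leq_addr.
by rewrite nth_cat ltnNge leq_addr /= addKn /= nth_cat ltnn subnn.
Qed.

Lemma bead_ends_perm (V : eqType) x (l1 A : seq V) y l2 A' p q :
  perm_eq (x :: rcons l1 p ++ A ++ y :: rcons l2 q ++ A') (p :: q :: x :: l1 ++ A ++ y :: l2 ++ A').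
Proof. by apply/permP => f; rewrite /= -!cats1 !count_cat /= !count_cat /=; lia. Qed.

(** Each step adds 2 modulo 4, so an odd number of them cannot return. *)
Lemma two_step_mod4 (f : nat -> nat) h : odd h ->
  (forall k, k < h -> f k.+1 = f k + 2 \/ f k = f k.+1 + 2) -> f h <> f 0.
Proof.
move=> oh step E; have H k : k <= h -> f k = f 0 + 2 * k %[mod 4].
  elim: k => [|k IH] kh; first by rewrite muln0 addn0.
  by have := IH (ltnW kh); case: (step k kh) => ->; lia.
by have := H h (leqnn h); rewrite E; lia.
Qed.

Lemma split_fourth (V : Type) (x0 : V) s t : 2 < t < size s -> exists la ld,
  s = [:: nth x0 s 0, nth x0 s 1, nth x0 s 2 & la ++ nth x0 s t :: ld].
Proof.
case: t => [|[|[|t]]] //; case: s => [|a [|b [|d s]]] //= ts.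
by exists (take t s), (drop t.+1 s); rewrite -drop_nth // cat_take_drop.
Qed.

(** * Every counted block yields a connector *)

Section BlockConnector.
Variables (T : finType) (G : graph T) (Th : theta T).
Hypotheses (G_cubic : cubic G) (G_3conn : kconnected 3 G) (Th_short : short_theta G Th).
Let Th_in : theta_in G Th. Proof. by case: Th_short. Qed.
Local Notation e := (adj G).
Local Notation u := (th_u Th).
Local Notation H := (gminus G (theta_plus G Th)).
Variable B : graph T.
Hypotheses (B_end : endblock H B) (B2 : kconnected 2 B) (B_conn : theta_connecting G Th B).
Local Notation X := (vset B).
Local Notation F := (fringe G Th B).
Local Notation O := (vset B :|: fringe G Th B).
Implicit Types (x y f : T) (i j : 'I_3).

Let off_theta x : x \in O -> x \notin theta_set Th.
Proof. by case/(block_fringe_off B_end). Qed.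

Lemma owns_index i p x : p \in inner Th i -> x \in O -> e x p -> owns G Th O i (index p (inner Th i)).
Proof. by move=> pi xO exp; apply/exists_inP; exists x; rewrite // nth_index // adj_sym. Qed.

Lemma block_walk x y : x \in X -> y \in X -> exists q,
  [/\ path e x q, last x q = y, uniq (x :: q) & {subset x :: q <= X}].
Proof.
move=> xX yX; have /connectP[q pq E] := two_connected_connect B2 xX yX.
move: E; have [s ps us _] := shortenP pq => E; exists s; split=> //.
  by apply: (sub_path _ ps) => a b; exact: (adj_block B_end).
move=> v; rewrite inE => /predU1P[->//|vs].
elim: s x ps vs {us E pq xX} => //= a s IH x /andP[/adjP[_ _ aX] ps].
by rewrite inE => /predU1P[->//|]; exact: IH ps.
Qed.

Lemma fringe_walk f y : f \in F -> y \in O -> f != y -> exists l,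
  [/\ path e f l, last f l = y, uniq (f :: l) & {subset f :: l <= O}].
Proof.
move=> fF yO fy; have [fS [x xX efx]] := in_fringe fF.
have XF v : v \in X -> v \notin F.
  move=> vX; apply/negP => /in_fringe[vF _]; have [_ _] := in_block B_end vX.
  by rewrite vF.
have [yX|yX] := boolP (y \in X).
  have [q [pq lq uq sq]] := block_walk xX yX; exists (x :: q); split=> //.
  - by rewrite /= efx.
  - by rewrite cons_uniq uq andbT; apply/negP => /sq/XF; rewrite fF.
  by move=> v; rewrite inE in_setU => /predU1P[->|/sq->//]; rewrite fF orbT.
have yF : y \in F by move: yO; rewrite in_setU (negPf yX).
have [_ [z zX eyz]] := in_fringe yF.
have [q [pq lq uq sq]] := block_walk xX zX; exists (x :: rcons q y); split=> //.
- by rewrite /= efx rcons_path pq lq adj_sym.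
- by rewrite /= last_rcons.
- rewrite cons_uniq -rcons_cons mem_rcons inE negb_or fy rcons_uniq uq andbT.
  by apply/andP; split; apply/negP => /sq/XF; rewrite ?fF ?yF.
move=> v; rewrite inE -rcons_cons mem_rcons inE in_setU => /or3P[/eqP->|/eqP->|/sq->//].
  by rewrite fF orbT.
by rewrite yF orbT.
Qed.

Definition has_connector := exists i j a b a' b', connector G Th O i j a b a' b'.

(** By shortness at most one vertex separates the two neighbours of [f] on leg [i]; with [f] the
    segment forms the cycle. A walk from [f] through [O] to an exit on another leg is the tail. *)
Lemma fringe_connector f i : f \in F -> (forall j, exit G Th f j -> j = i) -> has_connector.
Proof.
move=> fF only; have [/FsetP[_ fT [p [q [pq pT qT ep eq]]]] _] := in_fringe fF.
have onI t : t \in theta_set Th -> e f t -> t \in inner Th i.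
  move=> tT et; have [j tj] := outside_nbr_inner G_cubic Th_in fT tT et.
  by rewrite -(only j) //; apply/exitP; exists t.
have [p' [q' [m1 [m2 [m3 [Ei pq']]]]]] := split_two pq (onI p pT ep) (onI q qT eq).
have [ep' eq'] : e f p' /\ e f q' by case: pq' => -[-> ->].
have [x xO [j ji exj]] := block_exits G_cubic Th_in B_end B_conn i.
have /exitP[t tj ext] := exj.
have fx : f != x by apply: contraNneq ji => E; apply/eqP/only; rewrite E.
have [l [pl ll ul sl]] := fringe_walk fF xO fx.
have m21 : size m2 <= 1.
  apply: (theta_detour Th_short (r := [:: f]) Ei) => //.
    by move=> v; rewrite inE => /eqP->.
  by rewrite /= adj_sym ep' eq'.
exists i, j; do 4 eexists.
apply: (@arc_connector T G Th Th_in O i j _ _ m1 p' m2 q' m3 f [::] l l t) => //.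
- by rewrite eq_sym.
- by apply: leq_trans m21 _.
- by case: (m2) m21 => [|? []].
- by rewrite /= adj_sym ep' eq'.
- by rewrite /= rcons_path pl ll.
- by rewrite rcons_path pl ll.
- exact: owns_index ext.
Qed.

(** Each tail is extended by one vertex on its leg, and the intervals are these single vertices. *)
Lemma leg_bead_connector : leg_bead e X F (exit G Th) -> has_connector.
Proof.
case=> x [A [l1 [y [A' [l2 [i [j [bd sub ij /exitP[p pi ep] /exitP[q qj eq]]]]]]]]].
have sO v : v \in x :: l1 ++ A ++ y :: l2 ++ A' -> v \in O := allP sub v.
have lxO : last x l1 \in O.
  by apply: sO; rewrite -cat_cons mem_cat mem_last.
have lyO : last y l2 \in O.
  by apply: sO; rewrite inE !mem_cat -cat_cons mem_cat mem_last !orbT.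
exists i, j, (index p (inner Th i)), (index p (inner Th i)).
exists (index q (inner Th j)), (index q (inner Th j)); split=> //.
- by rewrite leqnn index_mem.
- by rewrite leqnn index_mem.
- by rewrite !subnn.
- by rewrite (owns_index pi lxO ep) (owns_index qj lyO eq).
move=> s s'; rewrite !inE !orbb => /eqP-> /eqP->.
exists x, A, (rcons l1 p), y, A', (rcons l2 q); split; rewrite ?last_rcons ?nth_index //.
  have /and5P[ub cb p1 p2 nr] := bd.
  apply/and5P; split=> //; rewrite ?rcons_path ?p1 ?p2 //.
  rewrite (perm_uniq (bead_ends_perm _ _ _ _ _ _ _ _)); move: ub sO; set L := x :: l1 ++ _ => ub sO.
  have nO t k : t \in inner Th k -> t \notin L.
    by move=> tk; apply/negP => /sO/off_theta; rewrite (inner_theta Th_in tk).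
  rewrite 2!cons_uniq in_cons negb_or ub !(nO _ _ pi) !(nO _ _ qj) !andbT.
  by apply: contraNneq ij => E; apply/eqP/(inner_disj Th_in pi); rewrite E.
move=> v; rewrite (perm_mem (bead_ends_perm _ _ _ _ _ _ _ _)) in_cons in_cons.
case/or3P=> [/eqP->|/eqP->|/sO vO]; rewrite in_setU in_setU ?zone_point ?orbT //.
by rewrite vO.
Qed.

Lemma three_arc_connector i j a b d pa pd la ld t : i != j ->
  pa \in inner Th i -> pd \in inner Th i -> pa != pd -> t \in inner Th j ->
  (index pd (inner Th i) != index pa (inner Th i) + 2) ->
  (index pa (inner Th i) != index pd (inner Th i) + 2) ->
  path e pa [:: a; b; d; pd] -> {subset [:: a; b; d] <= O} ->
  {subset la <= O} -> {subset ld <= O} -> uniq [:: a, b, d & ld] -> uniq [:: d, b, a & la] ->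
  path e d (rcons ld t) -> path e a (rcons la t) -> owns G Th O j (index t (inner Th j)) ->
  has_connector.
Proof.
move=> ij pai pdi; wlog : a d pa pd la ld pai pdi / index pa (inner Th i) < index pd (inner Th i).
  move=> W pp tj n1 n2 par s3 sa sd ua ud pld pla ot.
  case: (ltngtP (index pa (inner Th i)) (index pd (inner Th i))) => lt.
  - exact: (W a d pa pd la ld).
  - apply: (W d a pd pa ld la) => //; rewrite 1?eq_sym //.
      by move: par; rewrite /= !andbT (adj_sym G pd) (adj_sym G d b) (adj_sym G b a) (adj_sym G a pa) => /and4P[-> -> -> ->].
    by move=> v vin; apply: s3; rewrite -mem_rev.
  - by case/eqP: pp; rewrite -(nth_index u pai) lt nth_index.
move=> lt pp tj n1 n2 par s3 sa sd ua ud pld pla ot.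
have [p' [q' [m1 [m2 [m3 [Ei pq']]]]]] := split_two pp pai pdi.
have ui := inner_uniq Th_in i.
have [ip iq] : index p' (inner Th i) = size m1 /\ index q' (inner Th i) = size m1 + (size m2).+1.
  move: ui; rewrite Ei; exact: index_two.
case: pq' => -[Ep Eq]; subst p' q'; last by move: lt; rewrite ip iq ltnNge leq_addr.
have m23 : size m2 <= 3.
  apply: (theta_detour Th_short (r := [:: a; b; d]) Ei) => //.
    by move: ua; rewrite -[_ :: _]/([:: a; b; d] ++ ld) cat_uniq => /and3P[].
  by move=> v /s3/off_theta.
exists i, j; do 4 eexists.
apply: (@arc_connector T G Th Th_in O i j _ _ m1 pa m2 pd m3 a [:: b; d] ld la t) => //.
(* The arcs have 2 and [size m2 + 1] inner vertices; the latter is at most 4 by shortness and is not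
   2 by assumption. *)
- by move: n1; rewrite ip iq eqn_add2l; case: (m2) m23 => [|? [|? [|? [|]]]].
- by move=> v; rewrite -[a :: _]/([:: a; b; d] ++ ld) mem_cat => /orP[/s3|/sd].
- move=> v; rewrite -[a :: _]/([:: a; b; d] ++ la) mem_cat => /orP[/s3|/sa] //.
- have pe : perm_eq ([:: a; b; d] ++ la) ([:: d; b; a] ++ la).
    by rewrite perm_cat2r -[[:: d; b; a]]/(rev [:: a; b; d]) perm_sym perm_rev.
  exact: etrans (perm_uniq pe) ud.
Qed.

(** There is an odd number of odd vertices, so by [two_step_mod4] the positions of their neighbours
    on leg [i] cannot change by exactly 2 each time. A pair where this fails, and an even vertex
    leading to another leg, feed [three_arc_connector]. *)
Lemma direct_cycle_connector c cs i : direct_cycle e X F (exit G Th) c cs i -> has_connector.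
Proof.
case=> /and4P[_ ucs ccs /allP sX] m5 m4 dodd deven.
set m := size cs in m5 m4; pose z := cnth c cs; pose P := inner Th i.
pose pos n := find (e (z n)) P; pose pt n := nth u P (pos n).
have m0 : 0 < m by apply: leq_trans m5.
have zX n : z n \in X by apply: sX; exact: cnth_mem.
have zO n : z n \in O by rewrite in_setU zX.
have hasp n : odd n -> has (e (z n)) P.
  by move=> /dodd /exitP[p pi ep]; apply/hasP; exists p.
have ppt n : odd n -> e (z n) (pt n) by move=> on; exact: nth_find (hasp n on).
have pti n : odd n -> pt n \in P by move=> on; rewrite mem_nth // -has_find hasp.
have ipt n : odd n -> index (pt n) P = pos n.
  by move=> on; rewrite index_uniq ?(inner_uniq Th_in) // -has_find hasp.
have zinj n n' : z n = z n' -> n = n' %[mod m].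
  by move/eqP; rewrite nth_uniq ?ltn_mod // => /eqP.
have posinj n n' : odd n -> odd n' -> pos n = pos n' -> z n = z n'.
  move=> on on' E; apply: (inner_outside1 Th_in G_cubic (pti n on)); rewrite ?off_theta //.
    by rewrite adj_sym ppt.
  by rewrite /pt E adj_sym ppt.
have [n [on n1 n2]] : exists n, [/\ odd n, pos n.+2 != pos n + 2 & pos n != pos n.+2 + 2].
  case: (boolP [exists n : 'I_m, [&& odd n, pos n.+2 != pos n + 2 & pos n != pos n.+2 + 2]]).
    by case/existsP=> n /and3P[]; exists n.
  move/existsPn=> no; have oh : odd m./2 by move: m4; clear; lia.
  have em : m = m./2.*2 by move: m4; clear; lia.
  case: (@two_step_mod4 (fun k => pos k.*2.+1) m./2 oh).
    move=> k km; have km2 : k.*2.+1 < m by rewrite em ltn_Sdouble.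
    have := no (Ordinal km2); rewrite /= odd_double /= negb_and !negbK doubleS.
    by case/orP=> /eqP ->; [left|right].
  by rewrite -em /pos -add1n /z cnth_period.
have on2 : odd n.+2 by rewrite /= negbK.
pose c1 := rot (n %% m) cs; have zc1 t : t < m -> nth c c1 t = z (n + t) by exact: nth_rot_cnth.
have uc1 : uniq c1 by rewrite rot_uniq.
have cc1 : cycle e c1 by rewrite rot_cycle.
have sc1 : size c1 = m by rewrite size_rot.
have Oc1 v : v \in c1 -> v \in O by rewrite mem_rot in_setU => /sX vX; apply/orP; left.
(* Offsets 3 and 5 give two even vertices beyond [z n.+2], and only one can be [c]. *)
have [t [tm nc ot]] : exists t, [/\ 2 < t < m, z (n + t) != c & ~~ odd (n + t)].
  have [E|] := eqVneq (z (n + 3)) c; last first.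
    by exists 3; rewrite oddD on; split=> //; apply: leq_trans m5.
  exists 5; rewrite oddD on; split=> //; apply/eqP => E5; have := zinj (n + 3) (n + 5).
  by rewrite E E5 => /(_ erefl) /eqP; rewrite eqn_modDl !modn_small // ltnW // ltnW.
have [l [j [ji pl ul lB exj]]] := deven _ ot nc.
have /exitP[q qj eq] := exj.
set r := cnth c cs (n + t) in pl eq exj.
have [la [ld]] : exists la ld, c1 = [:: z n, z n.+1, z n.+2 & la ++ r :: ld].
  have [|la [ld]] := @split_fourth _ c c1 t; first by rewrite sc1.
  have zt k : k <= t -> nth c c1 k = z (n + k).
    by move=> kt; apply: zc1; case/andP: tm => _; exact: leq_ltn_trans.
  have [t1 t2] : 1 <= t /\ 2 <= t by move: tm; clear; lia.
  by rewrite !zt // addn0 addn1 addn2 => E; exists la, ld.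
move: (z n.+1) => b Ec1.
have lO v : v \in l -> v \in O /\ v \notin c1.
  move=> vl; have := allP lB v vl; rewrite -[mem _ v]/(v \in off X F cs) in_off mem_rot.
  by case/andP.
have nq : z n != z n.+2.
  by move: uc1; rewrite Ec1 /= !inE !negb_or => /andP[/and3P[]].
have [pcd pca] : path e (z n.+2) (rcons la r) /\ path e (z n) (rcons (rev ld) r).
  move: cc1; rewrite Ec1 -cat_rcons /= rcons_cat cat_path last_rcons => /and4P[_ _ -> pa].
  by rewrite (path_rev_sym (@adj_sym _ G)).
have lc1 : ~~ has (mem c1) l by apply/hasPn => v /lO[].
have ulR R : uniq R -> {subset R <= c1} -> uniq (R ++ l).
  move=> uR sR; rewrite cat_uniq uR ul andbT; apply/hasPn => v /lO[_].
  by apply: contra => /sR.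
apply: (@three_arc_connector i j (z n) b (z n.+2) (pt n) (pt n.+2) (rev ld ++ r :: l) (la ++ r :: l) q).
- by rewrite eq_sym.
- exact: pti.
- exact: pti.
- apply: contraNneq nq => E; apply/eqP/posinj => //; by rewrite -(ipt n) // E ipt.
- exact: qj.
- by rewrite !ipt.
- by rewrite !ipt.
- move: cc1; rewrite Ec1 /= => /and3P[-> -> _].
  by rewrite adj_sym ppt // ppt.
- by move=> v vin; apply: Oc1; rewrite Ec1 -[_ :: _]/([:: z n; b; z n.+2] ++ _) mem_cat vin.
- move=> v; rewrite mem_cat mem_rev inE => H; case/or3P: H => [vl|/eqP->|/lO[]//];
    by apply: Oc1; rewrite Ec1 !inE mem_cat inE ?vl ?eqxx !orbT.
- move=> v; rewrite mem_cat inE => H; case/or3P: H => [vl|/eqP->|/lO[]//];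
    by apply: Oc1; rewrite Ec1 !inE mem_cat inE ?vl ?eqxx !orbT.
- rewrite -cat_rcons; apply: (ulR ([:: z n, b, z n.+2 & rcons la r])).
    by move: uc1; rewrite Ec1 -cat_rcons -!cat_cons cat_uniq => /and3P[].
  by move=> v vin; rewrite Ec1 -cat_rcons -!cat_cons mem_cat vin.
- have pe : perm_eq ([:: z n.+2; b; z n] ++ rcons (rev ld) r) ([:: z n; b; z n.+2] ++ r :: ld).
    by rewrite -rev_cons; apply: perm_cat; rewrite ?perm_rev // (perm_rev [:: z n; b; z n.+2]).
  have sub : subseq ([:: z n; b; z n.+2] ++ r :: ld) c1.
    by rewrite Ec1; exact: (cat_subseq (subseq_refl [:: z n; b; z n.+2]) (suffix_subseq la _)).
  rewrite -cat_rcons; apply: (ulR ([:: z n.+2, b, z n & rcons (rev ld) r])).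
    by rewrite (perm_uniq pe); apply: subseq_uniq uc1.
  by move=> v; rewrite (perm_mem pe); exact: mem_subseq sub v.
- by rewrite -cat_rcons rcons_cat cat_path pcd last_rcons rcons_path pl.
- by rewrite -cat_rcons rcons_cat cat_path pca last_rcons rcons_path pl.
apply: owns_index qj _ eq.
by have := mem_last r l; rewrite inE => /predU1P[->|/lO[]//]; exact: zO.
Qed.

Lemma block_connector : has_connector.
Proof.
case: (boolP [forall f in F, exists i, exists j, [&& i != j, exit G Th f i & exit G Th f j]]).
  move/forall_inP=> exF; have [|c lh] := block_local_hyp G_cubic G_3conn Th_in B_end B2 B_conn.
    by move=> f /exF/existsP[i /existsP[j /and3P[]]]; exists i, j.
  have [|[cs [i]]] := bead_or_direct lh; first exact: leg_bead_connector.
  exact: direct_cycle_connector.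
rewrite negb_forall_in => /exists_inP[f fF no].
have [/FsetP[_ fT [p [q [pq pT qT ep eq]]]] _] := in_fringe fF.
have [i exi] := exit_of_theta G_cubic Th_in fT pT ep.
apply: (@fringe_connector f i) => // j exj; apply/eqP; apply: contraT => ji.
by case/negP: no; apply/existsP; exists j; apply/existsP; exists i; rewrite ji exi exj.
Qed.

End BlockConnector.

(** * Segments of a duplicate-free sequence *)

Section Segments.
Variables (V : eqType) (e : rel V) (u : V).
Implicit Types (P : seq V).

Lemma mem_take_index P n v : uniq P -> (v \in take n P) = (v \in P) && (index v P < n).
Proof.
move=> uP; apply/idP/andP => [vt|[vP vn]]; last by rewrite in_take.
have vP := mem_take vt; by rewrite -in_take.
Qed.

Lemma mem_drop_index P n v : uniq P -> (v \in drop n P) = (v \in P) && (n <= index v P).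
Proof.
move=> uP; have := uP; rewrite -{1 3}(cat_take_drop n P) cat_uniq => /and3P[_ /hasPn H _].
rewrite mem_cat leqNgt; have := mem_take_index n v uP; have := @mem_drop n _ P v.
case vd: (v \in drop n P) => vP.
  have /negPf -> := H v vd; rewrite (vP isT) /= => /esym/negbT.
  by move=> ->.
case vt: (v \in take n P) => //= /esym/andP[_ ->]; by [].
Qed.

Lemma mem_segment P m n v : uniq P ->
  (v \in drop m (take n P)) = [&& v \in P, m <= index v P & index v P < n].
Proof.
move=> uP; rewrite mem_drop_index ?take_uniq // mem_take_index //.
case vP: (v \in P) => //=; case lt: (index v P < n); rewrite ?andbF //=.
rewrite andbT; congr (_ <= _); rewrite -[in RHS](cat_take_drop n P) index_cat.
by rewrite mem_take_index // vP lt.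
Qed.

Lemma segment_path P m n : sorted e P -> m < n -> n < size P ->
  path e (nth u P m) (rcons (drop m.+1 (take n P)) (nth u P n)).
Proof.
move=> sP mn nP; have mt : m < size (take n P) by rewrite size_takel // ltnW.
have Em : nth u P m = nth u (take n P) m by rewrite nth_take.
have : sorted e (take n.+1 P) by exact: take_sorted.
rewrite (take_nth u) // {}Em; set q := take n P in mt *.
rewrite -{1}(cat_take_drop m q) (drop_nth u mt) rcons_cat rcons_cons.
by case: (take m _) => [|p s] //=; rewrite cat_path => /andP[_ /= /andP[]].
Qed.

Lemma tail_path P m : sorted e P -> m < size P ->
  path e (nth u P m) (drop m.+1 P) /\ last (nth u P m) (drop m.+1 P) = nth u P (size P).-1.
Proof.
move=> sP mP; split; last first.
  rewrite -nth_last size_drop; case: (leqP (size P) m.+1) => H.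
    by rewrite drop_oversize // nth_nil; congr (nth u P _); move: H mP; clear; lia.
  rewrite (set_nth_default u) ?size_drop; last by move: H; clear; lia.
  by rewrite nth_drop; congr (nth u P _); move: H mP; clear; lia.
move: sP; rewrite -{1}(cat_take_drop m P) (drop_nth u mP).
by case: (take m _) => [|p s] //=; rewrite cat_path => /andP[_ /= /andP[]].
Qed.

End Segments.

(** * A necklace in zigzag along two sequences *)

Section Zigzag.
Variables (T : finType) (G : graph T) (u : T).
Local Notation e := (adj G).
Variables (P Q D : seq T) (O : nat -> {set T}) (a b a' b' : nat -> nat) (l : nat).
Hypotheses (uP : uniq P) (uQ : uniq Q) (uD : uniq D) (sP : sorted e P) (sQ : sorted e Q).
Hypotheses (PQ : forall v, v \in P -> v \notin Q) (PD : forall v, v \in P -> v \notin D)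
  (QD : forall v, v \in Q -> v \notin D).
Hypothesis close : path e (nth u P (size P).-1) (rcons D (nth u P 0)).
Hypothesis O_off : forall t v, t < l -> v \in O t -> [/\ v \notin P, v \notin Q & v \notin D].
Hypothesis O_disj : forall t t' v, t < l -> t' < l -> v \in O t -> v \in O t' -> t = t'.
Hypotheses (ab : forall t, t < l -> a t <= b t < size P)
  (ab' : forall t, t < l -> a' t <= b' t < size Q).
Hypotheses (mono : forall t t', t < t' -> t' < l -> b t < a t')
  (mono' : forall t t', t < t' -> t' < l -> b' t < a' t').
Hypothesis beads : forall t s s', t < l -> s \in [:: a t; b t] -> s' \in [:: a' t; b' t] ->
  seq_joint e u (O t) P Q (a t) (b t) (a' t) (b' t) s s'.
Hypotheses (l_gt0 : 0 < l) (l_even : ~~ odd l).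

(** Beads of even index are crossed from [P] to [Q], the others from [Q] to [P]; each is entered at
    a lower zone end and left at an upper one. *)
Let entry t := if odd t then nth u Q (a' t) else nth u P (a t).
Let leave t := if odd t then nth u P (b t) else nth u Q (b' t).
Let terr t := O t :|: seq_zone P (a t) (b t) :|: seq_zone Q (a' t) (b' t).
(** As [l] is even, the last bead is left on [P]. From there the way continues to the end of [P],
    through [D], and from the start of [P] to the first zone. *)
Let mid t := if ~~ odd t then drop (b' t).+1 (take (a' t.+1) Q)
  else if t.+1 < l then drop (b t).+1 (take (a t.+1) P)
  else drop (b t).+1 P ++ D ++ take (a 0) P.

Lemma odd_last t : t < l -> odd t -> (t.+1 < l) || (t.+1 == l).
Proof. by rewrite orbC -leq_eqVlt. Qed.

Lemma even_next t : t < l -> ~~ odd t -> t.+1 < l.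
Proof. by move=> tl ot; rewrite ltn_neqAle tl andbT; apply: contraNneq l_even => <-; rewrite /= ot. Qed.

Lemma joint_oriented t : t < l -> exists x A al y A' be,
  [/\ bead e x A al y A' be, last x al = entry t, last y be = leave t &
      {subset x :: al ++ A ++ y :: be ++ A' <= terr t}].
Proof.
move=> tl; rewrite /entry /leave /terr; case: ifP => _.
  have [x [A [al [y [A' [be [bd E1 E2 sub]]]]]]] :=
    seq_joint_swap (beads tl (mem_last _ [:: b t]) (mem_head _ _)).
  exists x, A, al, y, A', be; split=> // v vin; rewrite setUAC; exact: sub.
exact: beads tl (mem_head _ _) (mem_last _ [:: b' t]).
Qed.

Lemma mid_even t v : ~~ odd t -> (v \in mid t) =
  [&& v \in Q, b' t < index v Q & index v Q < a' t.+1].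
Proof. by move=> ot; rewrite /mid ot mem_segment. Qed.

Lemma mid_odd t v : odd t -> t.+1 < l -> (v \in mid t) =
  [&& v \in P, b t < index v P & index v P < a t.+1].
Proof. by move=> ot tl; rewrite /mid ot tl mem_segment. Qed.

Lemma mid_last t v : odd t -> ~~ (t.+1 < l) -> (v \in mid t) =
  (v \in D) || (v \in P) && ((b t < index v P) || (index v P < a 0)).
Proof.
move=> ot tl; rewrite /mid ot (negPf tl) !mem_cat mem_drop_index // mem_take_index //.
by case: (v \in P) => //=; rewrite ?orbF // orbCA.
Qed.

Lemma in_terr_zone t v : v \in terr t -> [\/ v \in O t, v \in P /\ a t <= index v P <= b t |
  v \in Q /\ a' t <= index v Q <= b' t].
Proof.
rewrite in_setU in_setU => /orP[/orP[vO|]|]; first by constructor 1.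
  by rewrite in_set => /andP[]; constructor 2.
by rewrite in_set => /andP[]; constructor 3.
Qed.

(** [f] and [g] stand for the lower and upper zone ends, so that the interval arguments can serve
    [P] and [Q] alike. *)
Lemma mono_eq t t' n (f g : nat -> nat) : t < l -> t' < l ->
  (forall t t', t < t' -> t' < l -> g t < f t') ->
  f t <= n <= g t -> f t' <= n <= g t' -> t = t'.
Proof.
move=> tl t'l fg H H'; case: (ltngtP t t') => // lt.
  by have := fg _ _ lt t'l; move: H H'; clear; lia.
by have := fg _ _ lt tl; move: H H'; clear; lia.
Qed.

Lemma terr_disjoint t t' v : t < l -> t' < l -> v \in terr t -> v \in terr t' -> t = t'.
Proof.
move=> tl t'l /in_terr_zone[vO|[vP H]|[vQ H]] /in_terr_zone[vO'|[vP' H']|[vQ' H']].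
- exact: O_disj vO vO'.
- by have [] := O_off tl vO; rewrite vP'.
- by have [_] := O_off tl vO; rewrite vQ'.
- by have [] := O_off t'l vO'; rewrite vP.
- exact: mono_eq mono H H'.
- by have := PQ vP; rewrite vQ'.
- by have [_] := O_off t'l vO'; rewrite vQ.
- by have := PQ vP'; rewrite vQ.
- exact: mono_eq mono' H H'.
Qed.

Lemma gap_not_zone t t' n (f g : nat -> nat) : t.+1 < l -> t' < l ->
  (forall t, t < l -> f t <= g t) ->
  (forall t t', t < t' -> t' < l -> g t < f t') ->
  g t < n -> n < f t.+1 -> f t' <= n <= g t' -> False.
Proof.
move=> tl t'l le fg H1 H2 H; case: (leqP t' t) => lt.
  have : g t' <= g t.
    move: lt; rewrite leq_eqVlt => /predU1P[->//|lt].
    by apply: leq_trans (ltnW (fg _ _ lt (ltnW tl))) (le _ (ltnW tl)).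
  by move: H H1; clear; lia.
have : f t.+1 <= f t'.
  move: lt; rewrite leq_eqVlt => /predU1P[->//|lt].
  by apply: leq_trans (le _ tl) (ltnW (fg _ _ lt t'l)).
by move: H H2; clear; lia.
Qed.

Lemma end_not_zone t' n (f g : nat -> nat) : t' < l ->
  (forall t, t < l -> f t <= g t) ->
  (forall t t', t < t' -> t' < l -> g t < f t') ->
  (g l.-1 < n) || (n < f 0) -> f t' <= n <= g t' -> False.
Proof.
move=> t'l le fg H1 H.
have H2 : g t' <= g l.-1.
  have : t' <= l.-1 by move: t'l; clear; lia.
  rewrite leq_eqVlt => /predU1P[->//|lt].
  have ll : l.-1 < l by rewrite prednK.
  exact: leq_trans (ltnW (fg _ _ lt ll)) (le _ ll).
have H3 : f 0 <= f t'.
  case: t' t'l {H H2} => // t' t'l.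
  exact: leq_trans (le _ l_gt0) (ltnW (fg _ _ (ltn0Sn _) t'l)).
by move: H H1 H2 H3; clear; lia.
Qed.

Lemma gap_eq t t' n (f g : nat -> nat) : t < l -> t' < l ->
  (forall t, t < l -> f t <= g t) ->
  (forall t t', t < t' -> t' < l -> g t < f t') ->
  g t < n < f t.+1 -> g t' < n < f t'.+1 -> t = t'.
Proof.
move=> tl t'l le fg H H'.
have step s s' : s' < l -> s < s' -> f s.+1 <= g s'.
  move=> s'l; rewrite leq_eqVlt => /predU1P[->|lt]; first exact: le.
  by apply: leq_trans (le _ (ltn_trans lt s'l)) _; apply: leq_trans (ltnW (fg _ _ lt s'l)) (le _ s'l).
case: (ltngtP t t') => // lt.
  by have := step _ _ t'l lt; move: H H'; clear; lia.
by have := step _ _ tl lt; move: H H'; clear; lia.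
Qed.

Lemma gap_not_end t n (f g : nat -> nat) : t.+1 < l ->
  (forall t, t < l -> f t <= g t) ->
  (forall t t', t < t' -> t' < l -> g t < f t') ->
  (g l.-1 < n) || (n < f 0) -> g t < n < f t.+1 -> False.
Proof.
move=> tl le fg H H'.
have [_ z] : (True /\ (f 0 <= f t <= g t)).
  split=> //; rewrite (le _ (ltnW tl)) andbT; case: t tl {H'} => // t tl.
  by apply: leq_trans (le _ l_gt0) (ltnW (fg _ _ _ (ltnW tl))).
have z' : f t.+1 <= f l.-1 <= g l.-1.
  have ll : l.-1 < l by rewrite prednK.
  rewrite le // andbT; have : t.+1 <= l.-1 by move: tl; clear; lia.
  rewrite leq_eqVlt => /predU1P[<-//|lt].
  exact: leq_trans (le _ tl) (ltnW (fg _ _ lt ll)).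
by move: H H' z z'; clear; lia.
Qed.

Let leab t : t < l -> a t <= b t. Proof. by case/ab/andP. Qed.
Let leab' t : t < l -> a' t <= b' t. Proof. by case/ab'/andP. Qed.

Lemma last_odd t : t < l -> ~~ (t.+1 < l) -> t = l.-1.
Proof. by clear; lia. Qed.

Lemma mid_not_terr t t' v : t < l -> t' < l -> v \in mid t -> v \notin terr t'.
Proof.
move=> tl t'l vm; apply/negP => /in_terr_zone H; move: vm.
have [ot|ot] := boolP (odd t); last first.
  rewrite mid_even // => /and3P[vQ i1 i2]; have tl1 := even_next tl ot; case: H => [vO|[vP _]|[_ H]].
  - by have [_] := O_off t'l vO; rewrite vQ.
  - by have := PQ vP; rewrite vQ.
  - exact: gap_not_zone tl1 t'l leab' mono' i1 i2 H.
have [tl1|tl1] := boolP (t.+1 < l).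
  rewrite mid_odd // => /and3P[vP i1 i2]; case: H => [vO|[_ H]|[vQ _]].
  - by have [] := O_off t'l vO; rewrite vP.
  - exact: gap_not_zone tl1 t'l leab mono i1 i2 H.
  - by have := PQ vP; rewrite vQ.
rewrite mid_last // => /orP[vD|/andP[vP i1]]; case: H => [vO|[vP' H]|[vQ H]].
- by have [_ _] := O_off t'l vO; rewrite vD.
- by have := PD vP'; rewrite vD.
- by have := QD vQ; rewrite vD.
- by have [] := O_off t'l vO; rewrite vP.
- by apply: end_not_zone t'l leab mono _ H; rewrite -(last_odd tl tl1).
- by have := PQ vP; rewrite vQ.
Qed.

Lemma mid_disjoint t t' v : t < l -> t' < l -> v \in mid t -> v \in mid t' -> t = t'.
Proof.
have PDQ s w : odd s -> s < l -> w \in mid s -> w \notin Q.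
  move=> os sl; have [sl1|sl1] := boolP (s.+1 < l).
    by rewrite mid_odd // => /and3P[/PQ].
  rewrite mid_last // => /orP[wD|/andP[/PQ//]].
  by apply/negP => /QD; rewrite wD.
move=> tl t'l; have [ot|ot] := boolP (odd t); have [ot'|ot'] := boolP (odd t'); last first.
- rewrite !mid_even // => /and3P[_ i1 i2] /and3P[_ j1 j2].
  by apply: (gap_eq tl t'l leab' mono' (n := index v Q)); apply/andP.
- by rewrite mid_even // => /and3P[vQ _ _] /(PDQ _ _ ot' t'l); rewrite vQ.
- by move=> /(PDQ _ _ ot tl) vQ; rewrite mid_even // (negPf vQ).
have [tl1|tl1] := boolP (t.+1 < l); have [tl1'|tl1'] := boolP (t'.+1 < l); last first.
- by rewrite (last_odd tl tl1) -(last_odd t'l tl1').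
- rewrite mid_last // mid_odd // => H /and3P[vP j1 j2]; move: H; rewrite vP (negPf (PD vP)) /= => H.
  by case: (@gap_not_end t' (index v P) a b tl1' leab mono); rewrite -?(last_odd tl tl1) // j1.
- rewrite mid_odd // mid_last // => /and3P[vP j1 j2]; rewrite vP (negPf (PD vP)) /= => H.
  by case: (@gap_not_end t (index v P) a b tl1 leab mono); rewrite -?(last_odd t'l tl1') // j1.
rewrite !mid_odd // => /and3P[_ i1 i2] /and3P[_ j1 j2].
by apply: (gap_eq tl t'l leab mono (n := index v P)); apply/andP.
Qed.

Lemma uniq_mid t : t < l -> uniq (mid t).
Proof.
move=> tl; rewrite /mid; case: ifP => _; first by rewrite drop_uniq ?take_uniq.
case: ifP => tl1; first by rewrite drop_uniq ?take_uniq.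
rewrite !cat_uniq drop_uniq // uD take_uniq // andbT /=; apply/andP; split.
  apply/hasPn => v; rewrite mem_cat mem_take_index // mem_drop_index // => H.
  have a0 : a 0 <= b t.
    case: t tl {tl1 H} => [|t] tl; first exact: leab.
    by apply: leq_trans (leab l_gt0) _; apply: leq_trans (ltnW (mono (ltn0Sn _) tl)) (leab tl).
  case/orP: H => [vD|/andP[vP lt]]; apply/negP => /andP[vP' lt'].
    by have := PD vP'; rewrite vD.
  by move: lt lt' a0; clear; lia.
apply/hasPn => v; rewrite mem_take_index // => /andP[vP _]; exact: PD.
Qed.

Lemma mid_connects t : t < l -> path e (leave t) (rcons (mid t) (entry (t.+1 %% l))).
Proof.
move=> tl; have [ot|ot] := boolP (odd t); last first.
  have tl1 := even_next tl ot; rewrite modn_small // /leave /entry /mid /= (negPf ot) /=.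
  by apply: segment_path; rewrite // ?mono' //; case/andP: (ab' tl1) => lt; apply: leq_ltn_trans.
rewrite /leave /entry /mid ot /=; have [tl1|tl1] := boolP (t.+1 < l).
  rewrite modn_small //= ot /=.
  by apply: segment_path; rewrite // ?mono //; case/andP: (ab tl1) => lt; apply: leq_ltn_trans.
have -> : t.+1 = l by move: tl tl1; clear; lia.
rewrite modnn /=.
have [pt lt] : path e (nth u P (b t)) (drop (b t).+1 P) /\
    last (nth u P (b t)) (drop (b t).+1 P) = nth u P (size P).-1.
  by apply: tail_path => //; case/andP: (ab tl).
have a0P : a 0 < size P by case/andP: (ab l_gt0); exact: leq_ltn_trans.
rewrite rcons_cat cat_path pt lt rcons_cat -take_nth //.
have := take_sorted (a 0).+1 sP; have := close; case: (P) a0P => //= p s _.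
by rewrite rcons_path cat_path => /andP[-> ep] ps; rewrite /= ep.
Qed.

Lemma zigzag_necklace k : k <= l -> exists2 N, subgraph N G & wiggly_necklace k N.
Proof.
move=> kl.
have joints (t : 'I_l) : exists w : (T * seq T * seq T) * (T * seq T * seq T),
    [/\ bead e w.1.1.1 w.1.1.2 w.1.2 w.2.1.1 w.2.1.2 w.2.2,
      last w.1.1.1 w.1.2 = entry t, last w.2.1.1 w.2.2 = leave t &
      {subset w.1.1.1 :: w.1.2 ++ w.1.1.2 ++ w.2.1.1 :: w.2.2 ++ w.2.1.2 <= terr t}].
  have [x [A [al [y [A' [be H]]]]]] := joint_oriented (ltn_ord t).
  by exists ((x, A, al), (y, A', be)).
have [w wP] := fin_all_exists joints.
apply: (@necklace_of_beads T G l (fun t => (w t).1.1.1) (fun t => (w t).2.1.1) (fun t => (w t).1.1.2)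
  (fun t => (w t).2.1.2) (fun t => (w t).1.2) (fun t => (w t).2.2) (fun t => mid t)
  (fun t => terr t)) => //.
- by move=> t; have [] := wP t.
- by move=> t; have [] := wP t.
- by move=> s t v vs vt; apply: ord_inj; exact: terr_disjoint vs vt.
- move=> t; have [_ _ -> _] := wP t; have [_ -> _ _] := wP (ordS t); exact: mid_connects.
- by move=> t; exact: uniq_mid.
- by move=> s t v; exact: mid_not_terr.
- by move=> s t v vs vt; apply: ord_inj; exact: mid_disjoint vs vt.
Qed.

End Zigzag.

(** * Reversing one of the two sequences *)

Section ReverseJoint.
Variables (T : finType) (e : rel T) (u : T).
Implicit Types (P Q : seq T).

Lemma index_rev_uniq Q v : uniq Q -> v \in Q -> index v (rev Q) = (size Q).-1 - index v Q.
Proof.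
move=> uQ vQ; have iQ : index v Q < size Q by rewrite index_mem.
have lt : (size Q).-1 - index v Q < size Q by move: iQ; clear; lia.
have E : v = nth v (rev Q) ((size Q).-1 - index v Q).
  rewrite nth_rev // (_ : size Q - _ = index v Q) ?nth_index //.
  by move: iQ; clear; lia.
by rewrite {1}E index_uniq ?rev_uniq // size_rev.
Qed.

Lemma seq_joint_rev O P Q a b a' b' s s' : uniq Q -> a' <= b' < size Q -> s' < size Q ->
  seq_joint e u O P Q a b a' b' s s' ->
  seq_joint e u O P (rev Q) a b ((size Q).-1 - b') ((size Q).-1 - a') s ((size Q).-1 - s').
Proof.
move=> uQ ab sQ [x [A [l1 [y [A' [l2 [bd E1 E2 sub]]]]]]].
exists x, A, l1, y, A', l2; split=> //.
  rewrite E2 nth_rev; last by move: sQ; clear; lia.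
  by congr (nth u Q _); move: sQ; clear; lia.
move=> v /sub; rewrite in_setU [v \in _ :|: seq_zone (rev Q) _ _]in_setU => /orP[->//|].
rewrite [v \in seq_zone Q _ _]in_set [v \in seq_zone (rev Q) _ _]in_set mem_rev.
case/andP=> vQ H; rewrite vQ index_rev_uniq //; apply/orP; right.
have : index v Q < size Q by rewrite index_mem.
by move: ab H; clear; lia.
Qed.

End ReverseJoint.

(** * A necklace from monotone connectors on two legs *)

Section LegNecklace.
Variables (T : finType) (G : graph T) (Th : theta T).
Hypotheses (Th_in : theta_in G Th).
Local Notation e := (adj G).
Local Notation u := (th_u Th).
Local Notation v := (th_v Th).
Variables (i j o : 'I_3) (O : nat -> {set T}) (a b a' b' : nat -> nat) (l : nat).
Hypotheses (oi : o != i) (oj : o != j).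
Hypothesis O_off : forall t x, t < l -> x \in O t -> x \notin theta_set Th.
Hypothesis O_disj : forall t t' x, t < l -> t' < l -> x \in O t -> x \in O t' -> t = t'.
Hypothesis cons : forall t, t < l -> connector G Th (O t) i j (a t) (b t) (a' t) (b' t).
Hypothesis mono : forall t t', t < t' -> t' < l -> b t < a t'.
Hypothesis mono' : (forall t t', t < t' -> t' < l -> b' t < a' t') \/
  (forall t t', t < t' -> t' < l -> b' t' < a' t).
Hypotheses (l_gt0 : 0 < l) (l_even : ~~ odd l).

(** The third leg, run from [v] to [u]: it leads from the end of leg [i] back to its beginning. *)
Let back := v :: rcons (rev (inner Th o)) u.

Lemma inner_sorted k : sorted e (inner Th k).
Proof.
by have := leg_path Th_in k; case: (inner Th k) => //= p s; rewrite rcons_path => /and3P[].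
Qed.

Lemma back_mem x : (x \in back) = [|| x == v, x == u | x \in inner Th o].
Proof. by rewrite inE mem_rcons inE mem_rev. Qed.

Lemma back_off k x : o != k -> x \in inner Th k -> x \notin back.
Proof.
move=> ok xk; rewrite back_mem !negb_or; apply/and3P; split.
- by apply: contraTneq xk => ->; exact: (inner_nv Th_in).
- by apply: contraTneq xk => ->; exact: (inner_nu Th_in).
by apply: contra ok => xo; apply/eqP/(inner_disj Th_in xo).
Qed.

Lemma back_path : inner Th i != [::] ->
  path e (nth u (inner Th i) (size (inner Th i)).-1) (rcons back (nth u (inner Th i) 0)).
Proof.
have := leg_path Th_in i; case: (inner Th i) => // p s + _.
rewrite rcons_cons /= rcons_path => /and3P[up ps sv].
rewrite (_ : nth u (p :: s) (size s) = last p s); last exact: (nth_last u (p :: s)).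
rewrite sv rcons_path last_rcons up andbT.
by rewrite (path_rev_sym (@adj_sym _ G)) leg_path.
Qed.

Lemma leg_necklace k : k <= l -> exists2 N, subgraph N G & wiggly_necklace k N.
Proof.
have inn0 : inner Th i != [::].
  by case/andP: (con_left (cons l_gt0)) => _; case: (inner Th i).
have ij : i != j by case: (cons l_gt0).
have uback : uniq back.
  rewrite cons_uniq mem_rcons inE mem_rev rcons_uniq mem_rev rev_uniq eq_sym negb_or.
  by rewrite (th_uv Th_in) (inner_nv Th_in) (inner_nu Th_in) (inner_uniq Th_in).
have backT x : x \in back -> x \in theta_set Th.
  rewrite back_mem => /or3P[/eqP->|/eqP->|]; [exact: (v_theta Th_in)|exact: (u_theta Th_in)|exact: (inner_theta Th_in)].
have offs t x : t < l -> x \in O t -> [/\ x \notin inner Th i, x \notin inner Th j & x \notin back].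
  move=> tl xO; have xT := O_off tl xO.
  by split; apply: contra xT; [exact: (inner_theta Th_in)|exact: (inner_theta Th_in)|exact: backT].
have dij x : x \in inner Th i -> x \notin inner Th j.
  by move=> xi; apply: contra ij => xj; apply/eqP/(inner_disj Th_in xi).
have uj := inner_uniq Th_in j.
case: mono' => mono''.
  apply: (@zigzag_necklace T G u (inner Th i) (inner Th j) back O a b a' b' l) => //.
  - exact: (inner_uniq Th_in).
  - exact: inner_sorted.
  - exact: inner_sorted.
  - by move=> x; exact: back_off.
  - by move=> x; exact: back_off.
  - exact: back_path.
  - by move=> t tl; case: (cons tl).
  - by move=> t tl; case: (cons tl).
  - by move=> t s s' tl; case: (cons tl) => _ _ _ _ _; apply.
(* Zones in decreasing order on leg [j] are in increasing order on its reversal, with lower and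
   upper ends exchanged. *)
pose n := (size (inner Th j)).-1.
apply: (@zigzag_necklace T G u (inner Th i) (rev (inner Th j)) back O a b
  (fun t => n - b' t) (fun t => n - a' t) l) => //.
- exact: (inner_uniq Th_in).
- by rewrite rev_uniq.
- exact: inner_sorted.
- have := inner_sorted j; rewrite -[X in _ -> sorted _ (rev X)]/(id _).
  by rewrite rev_sorted; apply: sub_sorted => x y; rewrite adj_sym.
- by move=> x; rewrite mem_rev; exact: dij.
- by move=> x; exact: back_off.
- by move=> x; rewrite mem_rev; exact: back_off.
- exact: back_path.
- by move=> t x tl xO; rewrite mem_rev; exact: offs tl xO.
- by move=> t tl; case: (cons tl).
- move=> t tl; case: (cons tl) => _ _ + _ _ _; rewrite size_rev /n.
  by move: (size _); clear; lia.
- move=> t t' tt' t'l; have := mono'' _ _ tt' t'l.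
  case: (cons (ltn_trans tt' t'l)) => _ _ + _ _ _; case: (cons t'l) => _ _ + _ _ _.
  by rewrite /n; move: (size _); clear; lia.
move=> t s s' tl si s'i; have cn := cons tl; have r := con_right cn.
have [s'' [s''i -> s''j]] : exists s'', [/\ s'' \in [:: a' t; b' t], s' = n - s'' & s'' < size (inner Th j)].
  move: s'i; rewrite !inE => /orP[]/eqP->; [exists (b' t) | exists (a' t)]; split;
    rewrite ?inE ?eqxx ?orbT //; by move: r; clear; lia.
by apply: seq_joint_rev => //; apply: (con_bead cn).
Qed.

End LegNecklace.

(** A pair of legs is named by the third leg [o], which later closes the necklace. *)
Lemma ord3_pair (i j : 'I_3) : i != j -> exists o : 'I_3,
  (i = ordS o /\ j = ordS (ordS o)) \/ (i = ordS (ordS o) /\ j = ordS o).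
Proof.
case: i j => [[|[|[|?]]] ?] [[|[|[|?]]] ?] //= _; 
  (exists (@Ordinal 3 0 isT) + exists (@Ordinal 3 1 isT) + exists (@Ordinal 3 2 isT));
  solve [by left; split; apply: val_inj | by right; split; apply: val_inj].
Qed.

Lemma ordS3_neq (o : 'I_3) : [/\ o != ordS o, o != ordS (ordS o) & ordS o != ordS (ordS o)].
Proof. by case: o => [[|[|[|?]]] ?]. Qed.

Lemma pigeonhole_sum (I J : finType) (f : I -> J) (S : {set I}) d :
  d * #|J| < #|S| -> exists y, d < #|[set x in S | f x == y]|.
Proof.
move=> lt; apply/existsP; apply: contraLR lt => /existsPn H; rewrite -leqNgt.
rewrite -sum1_card (partition_big f predT) //= mulnC -sum_nat_const; apply: leq_sum => y _.
by rewrite sum1dep_card leqNgt H.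
Qed.

(** * Selecting compatible connectors *)

Section Selection.
Variables (T : finType) (G : graph T) (Th : theta T).
Hypotheses (G_cubic : cubic G) (G_3conn : kconnected 3 G) (Th_short : short_theta G Th).
Let Th_in : theta_in G Th. Proof. by case: Th_short. Qed.
Local Notation e := (adj G).
Local Notation u := (th_u Th).
Local Notation H := (gminus G (theta_plus G Th)).
Implicit Types (B C : graph T) (x y : T) (i j o : 'I_3).

Definition counted : {set graph T} :=
  [set B | [&& endblock H B, kconnected 2 B & theta_connecting G Th B]].
Local Notation O B := (vset B :|: fringe G Th B).

Lemma countedP B : reflect [/\ endblock H B, kconnected 2 B & theta_connecting G Th B] (B \in counted).
Proof. by rewrite in_set; exact: and3P. Qed.

(** Distinct blocks are disjoint in a cubic graph, and a fringe vertex has a single neighbour off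
    the theta graph. *)
Lemma plus_disjoint B C x : B \in counted -> C \in counted -> x \in O B -> x \in O C -> B = C.
Proof.
case/countedP=> eB B2 _ /countedP[eC C2 _].
have vB : forall y, y \in vset B -> y \in vset C -> B = C.
  move=> y yB yC; apply: (@blocks_disjoint T H B C y) => //; [|by case/andP: eB|by case/andP: eC].
  move=> z s us al; apply: (cubic_nbrs G_cubic us (x := z)); apply: sub_all al => w.
  by rewrite adj_H => /and3P[ezw _ _].
rewrite !in_setU => /orP[xB|xB] /orP[xC|xC]; first exact: vB xB xC.
- by have [_ _] := in_block eB xB; have [-> _] := in_fringe xC.
- by have [_ _] := in_block eC xC; have [-> _] := in_fringe xB.
have [_ [y yB xy]] := in_fringe xB; have [_ [z zC xz]] := in_fringe xC.
have [_ zT _] := in_block eC zC.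
by apply: (vB y) => //; rewrite (fringe_nbr G_cubic eB xB yB xy xz zT).
Qed.

(** An inner vertex of a leg has at most one neighbour off the theta graph. *)
Lemma owns_inj B C i n : B \in counted -> C \in counted -> n < size (inner Th i) ->
  owns G Th (O B) i n -> owns G Th (O C) i n -> B = C.
Proof.
move=> cB cC ni /exists_inP[x xB ex] /exists_inP[y yC ey].
have [[eB _ _] [eC _ _]] := (countedP _ cB, countedP _ cC).
have [_ xT] := block_fringe_off eB xB; have [_ yT] := block_fringe_off eC yC.
have E := inner_outside1 Th_in G_cubic (mem_nth u ni) ex ey xT yT.
by apply: (plus_disjoint cB cC xB); rewrite E.
Qed.

Lemma counted_connector B : B \in counted -> exists o a b a' b',
  connector G Th (O B) (ordS o) (ordS (ordS o)) a b a' b'.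
Proof.
case/countedP=> eB B2 cB.
have [i [j [a [b [a' [b' con]]]]]] := block_connector G_cubic G_3conn Th_short eB B2 cB.
have [o [[E1 E2]|[E1 E2]]] := ord3_pair (con_legs con); rewrite E1 E2 in con; exists o.
  by exists a, b, a', b'.
by exists a', b', a, b; exact: connector_swap.
Qed.

Section Legs.
Variables (i j : 'I_3) (S : {set graph T}) (a b a' b' : graph T -> nat).
Hypotheses (sub : S \subset counted)
  (con : forall B, B \in S -> connector G Th (O B) i j (a B) (b B) (a' B) (b' B)).

(** A one-sided relation: some zone end of [C] falls into a zone of [B]. Zones that overlap are
    related in one direction at least. *)
Definition meets B C := (C != B) &&
  [|| a B <= a C <= b B, a B <= b C <= b B, a' B <= a' C <= b' B | a' B <= b' C <= b' B].

Let cS B : B \in S -> B \in counted. Proof. exact: (subsetP sub). Qed.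

(* The end of the zone of [C] which lies in the zone of [B], with its leg. *)
Let witness B C := if a B <= a C <= b B then (true, a C) else
  if a B <= b C <= b B then (true, b C) else
  if a' B <= a' C <= b' B then (false, a' C) else (false, b' C).

Let owned B (w : bool * nat) := (w.2 < size (inner Th (if w.1 then i else j))) &&
  owns G Th (O B) (if w.1 then i else j) w.2.

Let owned_inj B C w : B \in S -> C \in S -> owned B w -> owned C w -> B = C.
Proof. by move=> BS CS /andP[lt oB] /andP[_ oC]; exact: owns_inj (cS BS) (cS CS) lt oB oC. Qed.

Let owned_ends B : B \in S ->
  [/\ owned B (true, a B), owned B (true, b B), owned B (false, a' B) & owned B (false, b' B)].
Proof.
case/con=> _ /andP[l1 l2] /andP[r1 r2] _ /and4P[o1 o2 o3 o4] _.
by rewrite /owned /= o1 o2 o3 o4 l2 r2 (leq_ltn_trans l1 l2) (leq_ltn_trans r1 r2).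
Qed.

Let owned_witness B C : C \in S -> owned C (witness B C).
Proof.
by move=> /owned_ends[o1 o2 o3 o4]; rewrite /witness; case: ifP => // _; case: ifP => // _; case: ifP.
Qed.

(** A zone end of [C] in a zone of [B] is not an end of the latter, because the ends belong to [B].
    Zones of total length at most 4 have at most 3 inner positions, and each position belongs to at
    most one block. *)
Lemma meets_sparse B : B \in S -> #|[set C in S | meets B C]| <= 3.
Proof.
move=> BS; set M := [set C in S | meets B C].
pose L := [seq (true, n) | n <- iota (a B).+1 (b B - (a B).+1)] ++
          [seq (false, n) | n <- iota (a' B).+1 (b' B - (a' B).+1)].
have sL : size L <= 3.
  rewrite size_cat !size_map !size_iota; have [_ l1 r1 sh _ _] := con BS.
  by move: l1 r1 sh; clear; lia.
apply: leq_trans sL; rewrite cardE -(size_map (witness B)); apply: uniq_leq_size.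
  rewrite map_inj_in_uniq ?enum_uniq // => C C'; rewrite !mem_enum !in_set.
  move=> /andP[CS _] /andP[C'S _] E; apply: (owned_inj CS C'S (owned_witness B CS)).
  by rewrite E owned_witness.
move=> w /mapP[C]; rewrite mem_enum in_set => /andP[CS /andP[CB mt]] ->.
have [o1 o2 o3 o4] := owned_ends BS; have oC := owned_witness B CS.
have notB w' : owned B w' -> witness B C != w'.
  by move=> ow; apply: contraNneq CB => E; apply/eqP/(owned_inj CS BS oC); rewrite E.
have [n1 n2 n3 n4] := And4 (notB _ o1) (notB _ o2) (notB _ o3) (notB _ o4).
have memL b0 n : ((b0, n) \in L) = if b0 then (a B < n < b B) else (a' B < n < b' B).
  rewrite mem_cat; case: b0; [rewrite orbC|];
    rewrite (_ : _ \in map _ _ = false) ?orFb; try by apply/mapP => -[].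
    by rewrite mem_map ?mem_iota; [move: (a B) (b B); clear; lia|move=> ? ? []].
  by rewrite mem_map ?mem_iota; [move: (a' B) (b' B); clear; lia|move=> ? ? []].
move: mt n1 n2 n3 n4; rewrite /witness; case: ifP => [h _|_]; last case: ifP => [h _|_];
  last case: ifP => [h _|_ /= h]; rewrite memL !xpair_eqE /= => n1 n2 n3 n4;
  by move: h n1 n2 n3 n4; clear; lia.
Qed.

Let bounds B : B \in S -> (a B <= b B) && (a' B <= b' B).
Proof. by case/con=> _ /andP[-> _] /andP[-> _]. Qed.

Lemma not_meets_separated B C : B \in S -> C \in S -> C != B -> ~~ meets B C -> ~~ meets C B ->
  ((b B < a C) || (b C < a B)) && ((b' B < a' C) || (b' C < a' B)).
Proof.
move=> /bounds + /bounds; rewrite /meets eq_sym => + + ->.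
by move: (a B) (b B) (a' B) (b' B) (a C) (b C) (a' C) (b' C); clear; lia.
Qed.

(** With outdegree at most 3, one connector in 2 * 3 + 1 = 7 survives, so more than [k * k] have
    pairwise disjoint zones and Erdős-Szekeres applies with [a = b = k]. *)
Lemma many_connectors k o : o != i -> o != j -> 0 < k -> 7 * (k * k) < #|S| -> good k G.
Proof.
move=> oi oj k0 ltS; have [J [JS cJ ind]] := sparse_independent meets_sparse.
have kJ : k * k < #|J| by rewrite -(ltn_pmul2l (isT : 0 < 7)); exact: leq_trans ltS cJ.
have inS B : B \in J -> B \in S by exact: (subsetP JS).
have sep B C : B \in J -> C \in J -> B != C ->
    ((b B < a C) || (b C < a B)) && ((b' B < a' C) || (b' C < a' B)).
  move=> BJ CJ BC; apply: not_meets_separated; rewrite ?inS ?ind // 1?eq_sym //.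
have inj (f g : graph T -> nat) :
    (forall B C, B \in J -> C \in J -> B != C -> (g B < f C) || (g C < f B)) ->
    (forall B, B \in J -> f B <= g B) -> {in J &, injective f}.
  move=> fg le B C BJ CJ E; apply/eqP; apply: contraT => BC.
  by have := fg _ _ BJ CJ BC; have := le _ BJ; have := le _ CJ; rewrite E; clear; lia.
have [leJ leJ'] : (forall B, B \in J -> a B <= b B) /\ (forall B, B \in J -> a' B <= b' B).
  by split=> B /inS/bounds/andP[].
have ia : {in J &, injective a}.
  by apply: (inj _ b) => // B C BJ CJ BC; case/andP: (sep _ _ BJ CJ BC).
have ia' : {in J &, injective a'}.
  by apply: (inj _ b') => // B C BJ CJ BC; case/andP: (sep _ _ BJ CJ BC).
(* The zigzag needs an even number of beads; a monotone chain of [k + 1] connectors always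
   suffices. *)
pose l := if odd k then k.+1 else k.
have [lk kl el] : [/\ l <= k.+1, k <= l & ~~ odd l] by rewrite /l; case: ifP => /= [->|->].
have l0 : 0 < l := leq_trans k0 kl.
suff [s [ss /(all_nthP G) sJ pw]] : exists s : seq (graph T),
    [/\ size s = k.+1, all (mem J) s &
      pairwise (fun B C => (a B < a C) && (a' B < a' C)) s \/
      pairwise (fun B C => (a B < a C) && (a' C < a' B)) s].
  have inJ t : t < l -> nth G s t \in J.
    by move=> tl; apply: sJ; rewrite ss; apply: leq_trans lk.
  have cmp (r : rel (graph T)) t t' : pairwise r s -> t < t' -> t' < l -> r (nth G s t) (nth G s t').
    by move=> /(pairwiseP G) rs tt t'l; apply: rs; rewrite // inE ss;
      apply: leq_trans lk; first exact: ltn_trans t'l.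
  have lta t t' : t < t' -> t' < l -> a (nth G s t) < a (nth G s t').
    by move=> tt t'l; case: pw => /cmp/(_ tt t'l)/andP[].
  have neq t t' : t < t' -> t' < l -> nth G s t != nth G s t'.
    by move=> tt t'l; apply: contraTneq (lta _ _ tt t'l) => ->; rewrite ltnn.
  have [N sN wN] : exists2 N, subgraph N G & wiggly_necklace k N; last first.
    by constructor 2; exists N.
  apply: (@leg_necklace T G Th Th_in i j o (fun t => O (nth G s t)) (a \o nth G s) (b \o nth G s)
    (a' \o nth G s) (b' \o nth G s) l) => //.
  - move=> t x tl; have [eB _ _] := countedP _ (cS (inS _ (inJ t tl))).
    by case/(block_fringe_off eB).
  - move=> t t' x tl t'l xt xt'.
    have E := plus_disjoint (cS (inS _ (inJ t tl))) (cS (inS _ (inJ t' t'l))) xt xt'.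
    by case: (ltngtP t t') => // lt; [have := neq _ _ lt t'l | have := neq _ _ lt tl]; rewrite E eqxx.
  - by move=> t tl; apply: con; apply/inS/inJ.
  - move=> t t' tt t'l /=; have tl := ltn_trans tt t'l.
    have /andP[+ _] := sep _ _ (inJ t tl) (inJ t' t'l) (neq _ _ tt t'l).
    have := lta _ _ tt t'l; have := leJ _ (inJ t tl); have := leJ _ (inJ t' t'l).
    by move: (a _) (b _) (a _) (b _); clear; lia.
  case: pw => pw; [left|right] => t t' tt t'l /=; have tl := ltn_trans tt t'l;
    have /andP[_ +] := sep _ _ (inJ t tl) (inJ t' t'l) (neq _ _ tt t'l);
    have /andP[_] := cmp _ _ _ pw tt t'l; have := leJ' _ (inJ t tl); have := leJ' _ (inJ t' t'l);
    by move: (a' _) (b' _) (a' _) (b' _); clear; lia.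
have [[s [ss sJ pw]]|[s [ss sJ pw]]] := erdos_szekeres ia ia' kJ; exists s; split=> //.
  by left.
by right.
Qed.

End Legs.

(** The factor 21 is 3 times 7: pigeonhole over the three pairs of legs comes first. *)
Lemma many_counted k : 0 < k -> 21 * (k * k) < #|counted| -> good k G.
Proof.
move=> k0 lt.
have choice B : exists w : 'I_3 * ((nat * nat) * (nat * nat)), B \in counted ->
    connector G Th (O B) (ordS w.1) (ordS (ordS w.1)) w.2.1.1 w.2.1.2 w.2.2.1 w.2.2.2.
  have [|] := boolP (B \in counted); last by exists (ord0, ((0, 0), (0, 0))).
  by case/counted_connector => o [a [b [a' [b' con]]]]; exists (o, ((a, b), (a', b'))).
have [w wP] := fin_all_exists choice.
have [o lto] : exists o, 7 * (k * k) < #|[set B in counted | (w B).1 == o]|.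
  by apply: pigeonhole_sum; rewrite card_ord mulnAC.
have [oi oj ij] := ordS3_neq o.
apply: (@many_connectors (ordS o) (ordS (ordS o)) [set B in counted | (w B).1 == o]
  (fun B => (w B).2.1.1) (fun B => (w B).2.1.2) (fun B => (w B).2.2.1) (fun B => (w B).2.2.2)
  _ _ k o) => //.
  by apply/subsetP => B; rewrite in_set => /andP[].
by move=> B; rewrite in_set => /andP[Bc /eqP <-]; exact: wP.
Qed.

End Selection.

(** * The case k = 0 and the conclusion *)

Lemma good0 (T : finType) (G : graph T) : kconnected 3 G -> good 0 G.
Proof.
move=> G3; constructor 2.
have G2 : kconnected 2 G.
  have /andP[c3 /forallP H] := G3; apply/andP; split; first exact: ltnW.
  by apply/forallP => X; apply/implyP => X2; apply: (implyP (H X)); exact: leqW.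
have /card_gt0P[x xG] : 0 < #|vset G| by case/andP: G3 => + _; exact: leq_trans.
exists G; first by rewrite /subgraph !subxx.
have xpath : subgraph (path_graph [:: x]) G.
  by apply: path_graph_sub => // y; rewrite inE => /eqP->.
(* One bead, the whole graph, joined to itself by a path with a single vertex; no bead has to be
   wiggly. *)
exists 1, (fun=> G), (fun=> [:: x]); split=> //; last by exists set0 => // i; rewrite inE.
have one (i j : 'I_1) : i = j by rewrite [i]ord1 [j]ord1.
split.
- set N := gunion _ _.
  have sub : subgraph N G by apply: gunion_sub; apply: gbigunion_sub => // _; rewrite /subgraph !subxx.
  have sup : subgraph G N.
    exact: subgraph_trans (sub_gbigunion (fun _ : 'I_1 => G) ord0) (sub_gunionl _ _).
  have [/andP[v1 e1] /andP[v2 e2]] := (sub, sup).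
  apply: val_inj; rewrite /= [gval G]surjective_pairing; congr pair; apply/eqP; rewrite eqEsubset.
    by apply/andP.
  by apply/andP.
- by split=> // i j; rewrite (one i j) eqxx.
- by move=> i j; rewrite (one i j) eqxx.
- move=> i; apply/andP; split; last by apply/forallP => z; apply/implyP.
  apply/exists_inP; exists x => //; apply/exists_inP; exists x => //.
  by apply/and5P; split=> //; apply/subsetP => y; rewrite in_set inE => /eqP->.
by move=> i j; rewrite disjoint_has.
Qed.

Theorem theorem5p8 (k : nat) (T : finType) (G : graph T) (Th : theta T)
  (G_cubic : cubic G) (G_3conn : kconnected 3 G) (Th_short : short_theta G Th) :
  let H := gminus G (theta_plus G Th) in
  let n := #|[set B : graph T | [&& endblock H B, kconnected 2 B
                                  & theta_connecting G Th B]]| in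
  (21%:R * k%:R ^+ 2 + 3%:R / 2%:R * k%:R <= n%:R :> rat)%R ->
  good k G.
Proof.
case: (posnP k) => [->|k0] H n many; first exact: good0.
apply: (many_counted G_cubic G_3conn Th_short k0).
suff : ((21 * (k * k))%:R < n%:R :> rat)%R by rewrite ltr_nat.
(* The positive summand 3/2 k makes the bound strict. *)
apply: lt_le_trans many; rewrite !natrM expr2 ltrDl.
by rewrite mulr_gt0 ?divr_gt0 ?ltr0n.
Qed.
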